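(* Let $w$ be a strictly positive analytic weight on the unit circle $\mathbb T_1$, let $\rho<1$ be the associated constant, fix $r$ with $\rho<r<1$, and let $\Lambda=\max_{|z|=r}|\mathcal F(z)|$. Then for each $n\in\mathbb N$ the Verblunsky coefficients $\alpha_n$ satisfy $$\overline{\alpha_n}=-\frac1{2\pi i}\oint_{\mathbb T_r}t^n\mathcal F(t)\,dt+\mathcal O(r^{3n})=-c_{-n-1}+\mathcal O(r^{3n}),$$ where $c_{-n-1}$ is the coefficient of $z^{-n-1}$ in the Laurent expansion of $\mathcal F$. Consequently, $$|\alpha_n|\le\Lambda\,r^{n+1}+\mathcal O(r^{3n}).$$ Furthermore, the leading coefficients $\kappa_n$ of the orthonormal polynomials satisfy $$\left|\kappa_n^2-\frac{\tau^2}{2\pi}\right|\le\frac{\Lambda^2r^{2n}}{1-r^2}.$$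
   Context: Notation: for $s>0$, $\mathbb T_s=\{z\in\mathbb C:|z|=s\}$, oriented counterclockwise. A strictly positive analytic weight on $\mathbb T_1$ is a function $w$ that is strictly positive on $\mathbb T_1$ and extends to a nowhere vanishing holomorphic function on an open set containing $\mathbb T_1$. The orthonormal polynomials $\varphi_n(z)=\kappa_nz^n+\dots$, $\kappa_n>0$, satisfy $\oint_{\mathbb T_1}\varphi_n\overline{\varphi_m}\,w\,|dz|=\delta_{mn}$, and $\Phi_n=\varphi_n/\kappa_n$ is monic. Verblunsky coefficients: $\alpha_n=-\overline{\Phi_{n+1}(0)}$. Szegő functions: $D(z)=\exp\left(\frac1{4\pi}\int_0^{2\pi}\log w(e^{i\theta})\frac{e^{i\theta}+z}{e^{i\theta}-z}\,d\theta\right)$ for $|z|\ne1$; $D_{\rm i}$ is its restriction to $|z|<1$ and $D_{\rm e}$ its restriction to $|z|>1$. Both extend holomorphically across $\mathbb T_1$ (same notation), and $D_{\rm i}/D_{\rm e}=w$. Put $\rho=\inf\{0<s<1: D_{\rm e}\text{ is (extends) holomorphic in }|z|>s\}<1$, $\tau=1/D_{\rm i}(0)=\exp\left(-\frac1{4\pi}\int_0^{2\pi}\log w(e^{i\theta})\,d\theta\right)>0$ and $\mathcal F(z)=D_{\rm i}(z)D_{\rm e}(z)$, holomorphic in $\rho<|z|<1$ with Laurent expansion $\mathcal F(z)=\sum_{k=-\infty}^{\infty}c_kz^k$ there.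
   Formalization: The last inequality, for κ_n², fails for some n and w (rescaling w changes only its left side); it is proved as displayed for all sufficiently large n, and for every n with the right-hand side multiplied by τ²/(2π). *)

(* Defs.v *)
(* Stdlib reals with Coquelicot; complex-valued functions of a real variable
   are integrated as functions into the R-normed module C. *)
From Stdlib Require Import Reals ZArith.
From Coquelicot Require Export Coquelicot.

Set Implicit Arguments.

Open Scope R_scope.

Definition cis (t : R) : C := (cos t, sin t).

Definition Cexp (z : C) : C := (RtoC (exp (Re z)) * cis (Im z))%C.

Definition CInt (f : R -> C) (x y : R) : C :=
  RInt (V := C_R_CompleteNormedModule) f x y.

Definition circ (s : R) (z : C) : Prop := Cmod z = s.

Definition outside (s : R) (z : C) : Prop := s < Cmod z.

Definition annulus (s t : R) (z : C) : Prop := s < Cmod z < t.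

Definition contour_int (s : R) (f : C -> C) : C :=
  CInt (fun t => f (s * cis t)%C * (Ci * (s * cis t)))%C 0 (2 * PI).

Definition arclength_int (s : R) (f : C -> C) : C :=
  CInt (fun t => f (s * cis t)%C * RtoC s)%C 0 (2 * PI).

Definition holomorphic (U : C -> Prop) (f : C -> C) : Prop :=
  forall z, U z -> ex_derive (K := C_AbsRing) (V := C_NormedModule) f z.

Definition positive_analytic_weight (w : C -> R) : Prop :=
  (forall z, circ 1 z -> 0 < w z) /\
  exists (U : C -> Prop) (W : C -> C),
    open U /\
    (forall z, circ 1 z -> U z) /\
    holomorphic U W /\
    (forall z, U z -> W z <> 0%C) /\
    (forall z, circ 1 z -> W z = RtoC (w z)).

(* [a n k] is the coefficient of z^k in the n-th polynomial; the entries with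
   k > n are never used. *)
Definition poly_eval (a : nat -> nat -> C) (n : nat) (z : C) : C :=
  sum_n (fun k => a n k * z ^ k)%C n.

Definition orthonormal_polynomials (w : C -> R)
    (a : nat -> nat -> C) (kappa : nat -> R) : Prop :=
  (forall n, 0 < kappa n /\ a n n = RtoC (kappa n)) /\
  (forall n m,
     arclength_int 1 (fun z =>
       poly_eval a n z * Cconj (poly_eval a m z) * RtoC (w z))%C
     = RtoC (if Nat.eqb n m then 1 else 0)).

Definition monic_poly (a : nat -> nat -> C) (kappa : nat -> R)
    (n : nat) (z : C) : C :=
  (poly_eval a n z / RtoC (kappa n))%C.

Definition verblunsky (a : nat -> nat -> C) (kappa : nat -> R) (n : nat) : C :=
  (- Cconj (monic_poly a kappa (S n) 0))%C.

(* Meaningful for |z| <> 1: it is D_i for |z| < 1 and D_e for |z| > 1. *)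
Definition szego (w : C -> R) (z : C) : C :=
  Cexp (RtoC (/ (4 * PI)) *
        CInt (fun t => RtoC (ln (w (cis t))) * ((cis t + z) / (cis t - z)))%C
             0 (2 * PI))%C.

Definition ext_szego_extension (w : C -> R) (s : R) (De : C -> C) : Prop :=
  holomorphic (outside s) De /\ (forall z, outside 1 z -> De z = szego w z).

(* The set is nonempty for a positive analytic weight, so the infimum is finite
   and [real] only changes its type. *)
Definition rho (w : C -> R) : R :=
  real (Glb_Rbar (fun s => 0 < s < 1 /\ exists De, ext_szego_extension w s De)).

Definition tau (w : C -> R) : R :=
  exp (- (/ (4 * PI) * RInt (fun t => ln (w (cis t))) 0 (2 * PI))).

(* The function F = D_i D_e on rho < |z| < 1, where D_i is given by the integral
   formula and D_e by its extension. *)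
Definition scattering (w : C -> R) (De : C -> C) (z : C) : C :=
  (szego w z * De z)%C.

(* [c k] is the coefficient of z^k; the parts with nonnegative and with negative
   exponents are required to converge separately. *)
Definition laurent_expansion (U : C -> Prop) (f : C -> C) (c : Z -> C) : Prop :=
  forall z, U z ->
    exists p q : C,
      is_series (K := C_AbsRing) (V := C_NormedModule)
        (fun k : nat => c (Z.of_nat k) * z ^ k)%C p /\
      is_series (K := C_AbsRing) (V := C_NormedModule)
        (fun k : nat => c (- Z.of_nat (S k))%Z / z ^ (S k))%C q /\
      f z = (p + q)%C.

Definition is_max_mod_on_circle (r : R) (f : C -> C) (L : R) : Prop :=
  (exists z, circ r z /\ Cmod (f z) = L) /\
  (forall z, circ r z -> Cmod (f z) <= L).

Definition is_bigO (e : nat -> C) (b : nat -> R) : Prop :=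
  exists M : R, forall n, Cmod (e n) <= M * b n.

(* Main.v *)
(* Write x = sqrt (2 pi) kappa_n / tau, so that kappa_n^2 = x^2 tau^2 / (2 pi).  On the unit
   circle D_i conj D_e = 1, |D_i|^2 = w and |F| = 1.  Splitting phi_n w = A + B, where A carries
   the frequencies >= n and B the negative ones (those in between vanish by orthogonality), gives
   f = sqrt (2 pi) phi_n^* D_i = conj al + q with al analytic, al(0) = 1/x, f analytic,
   f(0) = x and ||f|| = 1; hence ||q||^2 = ||al||^2 - 1.  The nonpositive frequencies of q are
   therefore x - 1/x and minus the conjugates of those of al.  Since q = F z^n v with v analytic
   and v(0) = 0, comparing L^2 norms on |z| = r and |z| = 1 yields
     (x - 1/x)^2 + sum_{k >= 1} |al_k|^2 r^{-2k} <= Lambda^2 r^{2n+2} ||q||^2.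
   This forces 1 - x^2 <= Lambda^2 r^{2n+2} and al_k = O(r^{2n+k}) for k >= 1.  Reading the
   constant term of sqrt (2 pi) phi_n D_i = F z^n al + sqrt (2 pi) B D_e gives
   x Phi_n(0) = sum_k al_k c_{-n-k} = c_{-n} / x + O(r^{3n}). *)
Require Import Defs.
From Stdlib Require Import Reals ZArith Lra Lia Classical.
From Coquelicot Require Import Coquelicot.

Open Scope R_scope.

(** * Fourier coefficients on a circle *)

(** Analyticity is encoded by Fourier coefficients: on the circle of radius s the m-th coefficient
    is s^m times a number free of s. Products, exponentials and the passage to |z| = 1 then act on
    coefficients, with no contour deformation. Two facts are not formal, uniqueness of Fourier
    coefficients and |D_i|^2 -> w at the boundary; both come from positivity of the Poisson kernel.
    The integral formula for D_i says nothing at |z| = 1, so 1 / conj D_e serves as its boundary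
    value. The splitting phi_n w = A + B is a Riesz projection; since w is C^1 on the circle, B is
    an absolutely convergent series. The identity for ||q||^2 rests on <f, conj al> = 1. It closes
    the argument because the weighted bound on q has ||q||^2 on both sides; eliminating it leaves an
    inequality for 1 - x^2 alone. In the error r^{3n}, one factor r^n comes from the coefficients
    c_{-n-k} and r^{2n} from the al_k with k >= 1, or from 1/x^2 - 1 when k = 0. *)

Definition ccont (f : R -> C) : Prop :=
  forall t, continuous (fun u => Re (f u)) t /\ continuous (fun u => Im (f u)) t.

Definition mean (f : R -> C) : C :=
  (/ (2 * PI) * RInt (fun t => Re (f t)) 0 (2 * PI),
   / (2 * PI) * RInt (fun t => Im (f t)) 0 (2 * PI)).

Definition ek (k : Z) (t : R) : C := cis (IZR k * t).

Definition fc (f : R -> C) (k : Z) : C := mean (fun t => f t * ek (- k) t)%C.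

Definition nsq (f : R -> C) : R :=
  / (2 * PI) * RInt (fun t => Cmod (f t) ^ 2) 0 (2 * PI).

(* [RInt] has type [CompleteSpace.sort _], on which [ring] and [field] find no structure. *)
Ltac Req :=
  repeat match goal with
  | |- context [@RInt ?V ?f ?a ?b] =>
      let x := fresh "x" in
      generalize (@RInt V f a b); intro x; simpl in x; change R in (type of x)
  end;
  match goal with |- @eq _ ?a ?b => change (@eq R a b) end.

Lemma two_PI_pos : 0 < 2 * PI.
Proof. generalize PI_RGT_0; lra. Qed.

Lemma C_eq (x y : C) : Re x = Re y -> Im x = Im y -> x = y.
Proof. destruct x, y; unfold Re, Im; simpl; intros -> ->; reflexivity. Qed.

Lemma sum_n_C_S (u : nat -> C) (n : nat) :
  sum_n u (S n) = (sum_n u n + u (S n))%C.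
Proof. now rewrite sum_Sn. Qed.

Lemma cis_add (x y : R) : cis (x + y) = (cis x * cis y)%C.
Proof.
  unfold cis; apply C_eq; unfold Re, Im; simpl.
  - now rewrite cos_plus.
  - rewrite sin_plus; ring.
Qed.

Lemma cis_0 : cis 0 = RtoC 1.
Proof. unfold cis; now rewrite cos_0, sin_0. Qed.

Lemma cis_conj (x : R) : Cconj (cis x) = cis (- x).
Proof. unfold cis, Cconj; simpl; now rewrite cos_neg, sin_neg. Qed.

Lemma Cmod_cis (x : R) : Cmod (cis x) = 1.
Proof.
  unfold Cmod, cis; simpl fst; simpl snd.
  replace (cos x ^ 2 + sin x ^ 2) with (Rsqr (sin x) + Rsqr (cos x))
    by (unfold Rsqr; ring).
  rewrite sin2_cos2; apply sqrt_1.
Qed.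

Lemma ek_add (j k : Z) (t : R) : ek (j + k) t = (ek j t * ek k t)%C.
Proof. unfold ek; rewrite <- cis_add, plus_IZR; f_equal; ring. Qed.

Lemma ek_0 (t : R) : ek 0 t = RtoC 1.
Proof. unfold ek; rewrite Rmult_0_l; apply cis_0. Qed.

Lemma ek_conj (k : Z) (t : R) : Cconj (ek k t) = ek (- k) t.
Proof. unfold ek; rewrite cis_conj, opp_IZR; f_equal; ring. Qed.

Lemma Cmod_ek (k : Z) (t : R) : Cmod (ek k t) = 1.
Proof. apply Cmod_cis. Qed.

Lemma cis_neq_0 (t : R) : cis t <> RtoC 0.
Proof. intros H; generalize (Cmod_cis t); rewrite H, Cmod_0; lra. Qed.

Lemma cis_opp (t : R) : cis (- t) = (/ cis t)%C.
Proof.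
  rewrite <- (Cmult_1_r (cis (- t))), <- (Cinv_r (cis t)) by apply cis_neq_0.
  rewrite Cmult_assoc, <- cis_add, Rplus_opp_l, cis_0; ring.
Qed.

Lemma ek_neg_l (k : Z) (t : R) : (ek (- k) t * ek k t)%C = RtoC 1.
Proof. rewrite <- ek_add; replace (- k + k)%Z with 0%Z by lia; apply ek_0. Qed.

Lemma ek_nat (n : nat) (t : R) : ek (Z.of_nat n) t = (cis t ^ n)%C.
Proof.
  induction n as [|n IH].
  - apply ek_0.
  - rewrite Nat2Z.inj_succ, <- Z.add_1_l, ek_add, IH, Cpow_S.
    f_equal; unfold ek; f_equal; ring.
Qed.

Lemma ek_1 (t : R) : ek 1 t = cis t.
Proof. unfold ek; f_equal; ring. Qed.

Lemma cis_2PI (t : R) (k : Z) : ek k (t + 2 * PI) = ek k t.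
Proof.
  assert (H : cis (t + 2 * PI) = cis t)
    by (unfold cis; now rewrite cos_plus, sin_plus, cos_2PI, sin_2PI, !Rmult_1_r,
          !Rmult_0_r, Rminus_0_r, Rplus_0_r).
  destruct (Z_le_gt_dec 0 k) as [Hk|Hk].
  - rewrite <- (Z2Nat.id k Hk), !ek_nat; now rewrite H.
  - assert (Hk' : (0 <= - k)%Z) by lia.
    replace k with (- (- k))%Z by lia.
    rewrite <- !(ek_conj (- k)), <- (Z2Nat.id (- k) Hk'), !ek_nat; now rewrite H.
Qed.

Lemma ccont_const (c : C) : ccont (fun _ => c).
Proof. intros t; split; apply continuous_const. Qed.

Lemma ccont_plus (f g : R -> C) :
  ccont f -> ccont g -> ccont (fun t => f t + g t)%C.
Proof.
  intros Hf Hg t; destruct (Hf t) as [H1 H2], (Hg t) as [H3 H4]; split.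
  - exact (continuous_plus _ _ _ H1 H3).
  - exact (continuous_plus _ _ _ H2 H4).
Qed.

Lemma ccont_opp (f : R -> C) : ccont f -> ccont (fun t => - f t)%C.
Proof.
  intros Hf t; destruct (Hf t) as [H1 H2]; split.
  - exact (continuous_opp _ _ H1).
  - exact (continuous_opp _ _ H2).
Qed.

Lemma ccont_minus (f g : R -> C) :
  ccont f -> ccont g -> ccont (fun t => f t - g t)%C.
Proof. intros Hf Hg; apply ccont_plus; [exact Hf|now apply ccont_opp]. Qed.

Lemma ccont_mult (f g : R -> C) :
  ccont f -> ccont g -> ccont (fun t => f t * g t)%C.
Proof.
  intros Hf Hg t; destruct (Hf t) as [H1 H2], (Hg t) as [H3 H4]; split.
  - apply (continuous_minus (fun u => Re (f u) * Re (g u)) (fun u => Im (f u) * Im (g u)));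
      now apply (continuous_mult (K := R_AbsRing)).
  - apply (continuous_plus (fun u => Re (f u) * Im (g u)) (fun u => Im (f u) * Re (g u)));
      now apply (continuous_mult (K := R_AbsRing)).
Qed.

Lemma ccont_conj (f : R -> C) : ccont f -> ccont (fun t => Cconj (f t)).
Proof.
  intros Hf t; destruct (Hf t) as [H1 H2]; split; [exact H1|].
  exact (continuous_opp _ _ H2).
Qed.

Lemma Re_Im_sqr_neq_0 (z : C) : z <> RtoC 0 -> Re z ^ 2 + Im z ^ 2 <> 0.
Proof.
  intros Hz H; apply Hz; apply C_eq; simpl.
  - assert (Re z ^ 2 = 0) by nra. change (Re z = 0); nra.
  - assert (Im z ^ 2 = 0) by nra. change (Im z = 0); nra.
Qed.

Lemma ccont_inv (f : R -> C) :
  ccont f -> (forall t, f t <> RtoC 0) -> ccont (fun t => / f t)%C.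
Proof.
  intros Hf H0 t; destruct (Hf t) as [H1 H2].
  assert (Hd : continuous (fun u => / (Re (f u) ^ 2 + Im (f u) ^ 2)) t).
  { apply continuous_Rinv_comp; [|now apply Re_Im_sqr_neq_0].
    apply (continuous_plus (fun u => Re (f u) ^ 2) (fun u => Im (f u) ^ 2)).
    - apply (continuous_mult (K := R_AbsRing)); [exact H1|].
      apply (continuous_mult (K := R_AbsRing)); [exact H1|apply continuous_const].
    - apply (continuous_mult (K := R_AbsRing)); [exact H2|].
      apply (continuous_mult (K := R_AbsRing)); [exact H2|apply continuous_const]. }
  split.
  - exact (continuous_mult (K := R_AbsRing) _ _ _ H1 Hd).
  - exact (continuous_mult (K := R_AbsRing) _ _ _ (continuous_opp _ _ H2) Hd).
Qed.

Lemma ccont_ek (k : Z) : ccont (ek k).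
Proof.
  intros t; split; unfold ek, cis, Re, Im; simpl;
    apply (ex_derive_continuous (V := R_NormedModule)); auto_derive; exact I.
Qed.

Lemma ccont_sum_n (u : nat -> R -> C) (n : nat) :
  (forall k, ccont (u k)) -> ccont (fun t => sum_n (fun k => u k t) n).
Proof.
  intros Hu; induction n as [|n IH]; intros t.
  - destruct (Hu O t) as [H1 H2]; split.
    + eapply continuous_ext; [|exact H1]; intros x; now rewrite sum_O.
    + eapply continuous_ext; [|exact H2]; intros x; now rewrite sum_O.
  - destruct (ccont_plus _ _ IH (Hu (S n)) t) as [H1 H2]; split.
    + eapply continuous_ext; [|exact H1]; intros x; now rewrite sum_n_C_S.
    + eapply continuous_ext; [|exact H2]; intros x; now rewrite sum_n_C_S.
Qed.

Lemma ccont_ext (f g : R -> C) : (forall t, f t = g t) -> ccont f -> ccont g.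
Proof.
  intros E Hf t; destruct (Hf t) as [H1 H2]; split.
  - eapply continuous_ext; [|exact H1]; intros x; now rewrite <- E.
  - eapply continuous_ext; [|exact H2]; intros x; now rewrite <- E.
Qed.

Ltac ccont_tac :=
  repeat (assumption || match goal with
  | |- ccont (fun t => ?c) => apply (ccont_const c)
  | |- ccont (fun t => ek ?k t) => apply (ccont_ek k)
  | |- ccont (ek ?k) => apply (ccont_ek k)
  | |- ccont (fun t => Cconj (@?f t)) => apply (ccont_conj f)
  | |- ccont (fun t => Cmult (@?f t) (@?g t)) => apply (ccont_mult f g)
  | |- ccont (fun t => Cminus (@?f t) (@?g t)) => apply (ccont_minus f g)
  | |- ccont (fun t => Cplus (@?f t) (@?g t)) => apply (ccont_plus f g)
  | |- ccont (fun t => Copp (@?f t)) => apply (ccont_opp f)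
  end).

Lemma ex_RInt_cont (f : R -> R) (a b : R) :
  (forall t, continuous f t) -> ex_RInt f a b.
Proof. intros H; apply (ex_RInt_continuous (V := R_CompleteNormedModule)); auto. Qed.

Lemma ccont_Re_int (f : R -> C) (a b : R) :
  ccont f -> ex_RInt (fun t => Re (f t)) a b.
Proof. intros H; apply ex_RInt_cont; apply H. Qed.

Lemma ccont_Im_int (f : R -> C) (a b : R) :
  ccont f -> ex_RInt (fun t => Im (f t)) a b.
Proof. intros H; apply ex_RInt_cont; apply H. Qed.

Lemma CInt_mean (f : R -> C) :
  ccont f -> CInt f 0 (2 * PI) = (RtoC (2 * PI) * mean f)%C.
Proof.
  intros Hf; unfold CInt.
  assert (Hp := two_PI_pos).
  apply (is_RInt_unique (V := C_R_CompleteNormedModule)).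
  replace (RtoC (2 * PI) * mean f)%C
    with ((RInt (fun t => Re (f t)) 0 (2 * PI), RInt (fun t => Im (f t)) 0 (2 * PI)) : C).
  - apply (is_RInt_fct_extend_pair (U := R_NormedModule) (V := R_NormedModule)).
    + exact (RInt_correct _ _ _ (ccont_Re_int _ _ _ Hf)).
    + exact (RInt_correct _ _ _ (ccont_Im_int _ _ _ Hf)).
  - unfold mean; apply C_eq; unfold Re, Im; simpl; Req; field; lra.
Qed.

Lemma mean_ext (f g : R -> C) :
  (forall t, 0 <= t <= 2 * PI -> f t = g t) -> mean f = mean g.
Proof.
  intros H; assert (Hp := two_PI_pos); unfold mean; f_equal; f_equal; apply RInt_ext;
    intros t Ht; rewrite H; auto; rewrite Rmin_left, Rmax_right in Ht by lra; lra.
Qed.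

Lemma mean_plus (f g : R -> C) :
  ccont f -> ccont g -> mean (fun t => f t + g t)%C = (mean f + mean g)%C.
Proof.
  intros Hf Hg; unfold mean.
  rewrite (RInt_plus (V := R_CompleteNormedModule) (fun t => Re (f t)) (fun t => Re (g t)))
    by (now apply ccont_Re_int).
  rewrite (RInt_plus (V := R_CompleteNormedModule) (fun t => Im (f t)) (fun t => Im (g t)))
    by (now apply ccont_Im_int).
  apply C_eq; unfold Re, Im, plus; simpl; Req; ring.
Qed.

Lemma mean_scal (c : C) (f : R -> C) :
  ccont f -> mean (fun t => c * f t)%C = (c * mean f)%C.
Proof.
  intros Hf; unfold mean.
  assert (HR := ccont_Re_int f 0 (2 * PI) Hf).
  assert (HI := ccont_Im_int f 0 (2 * PI) Hf).
  rewrite (RInt_minus (V := R_CompleteNormedModule)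
    (fun t => scal (Re c) (Re (f t))) (fun t => scal (Im c) (Im (f t))))
    by (now apply (ex_RInt_scal (V := R_NormedModule))).
  rewrite (RInt_plus (V := R_CompleteNormedModule)
    (fun t => scal (Re c) (Im (f t))) (fun t => scal (Im c) (Re (f t))))
    by (now apply (ex_RInt_scal (V := R_NormedModule))).
  rewrite !(RInt_scal (V := R_CompleteNormedModule)) by assumption.
  apply C_eq; unfold Re, Im, minus, plus, opp, scal; simpl; unfold mult; simpl; Req; ring.
Qed.

Lemma mean_opp (f : R -> C) : ccont f -> mean (fun t => - f t)%C = (- mean f)%C.
Proof.
  intros Hf; transitivity (RtoC (-1) * mean f)%C.
  - rewrite <- mean_scal by assumption; apply mean_ext; intros t _.
    apply C_eq; unfold Re, Im; simpl; ring.
  - apply C_eq; unfold Re, Im; simpl; ring.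
Qed.

Lemma mean_minus (f g : R -> C) :
  ccont f -> ccont g -> mean (fun t => f t - g t)%C = (mean f - mean g)%C.
Proof.
  intros Hf Hg; unfold Cminus.
  rewrite mean_plus by ccont_tac; now rewrite mean_opp.
Qed.

Lemma mean_conj (f : R -> C) :
  ccont f -> mean (fun t => Cconj (f t)) = Cconj (mean f).
Proof.
  intros Hf; unfold mean.
  rewrite <- (RInt_ext (fun t => opp (Im (f t))) (fun t => Im (Cconj (f t))))
    by reflexivity.
  rewrite (RInt_opp (V := R_CompleteNormedModule)) by (now apply ccont_Im_int).
  apply C_eq; unfold Re, Im, opp; simpl; Req; ring.
Qed.

Lemma mean_ek (k : Z) : mean (ek k) = RtoC (if Z.eqb k 0 then 1 else 0).
Proof.
  assert (Hp := two_PI_pos).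
  destruct (Z.eqb_spec k 0) as [->|Hk].
  - unfold mean.
    rewrite (RInt_ext (fun t => Re (ek 0 t)) (fun _ => 1))
      by (intros t _; now rewrite ek_0).
    rewrite (RInt_ext (fun t => Im (ek 0 t)) (fun _ => 0))
      by (intros t _; now rewrite ek_0).
    rewrite !RInt_const; unfold scal; simpl; unfold mult; simpl.
    apply C_eq; unfold Re, Im; simpl; Req; field; lra.
  - assert (Hk' : IZR k <> 0) by now apply not_0_IZR.
    assert (Hper := cis_2PI 0 k).
    rewrite Rplus_0_l in Hper; unfold ek, cis in Hper; rewrite Rmult_0_r in Hper.
    injection Hper as Hc Hs; rewrite cos_0 in Hc; rewrite sin_0 in Hs.
    unfold mean.
    assert (H1 : is_RInt (fun t => Re (ek k t)) 0 (2 * PI) 0).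
    { replace 0 with (minus (sin (IZR k * (2 * PI)) / IZR k) (sin (IZR k * 0) / IZR k)) at 2
        by (rewrite Hs, Rmult_0_r, sin_0; unfold minus, plus, opp; simpl; field; exact Hk').
      apply (is_RInt_derive (V := R_CompleteNormedModule) (fun t => sin (IZR k * t) / IZR k)).
      - intros x _; auto_derive; [exact I|]; unfold ek, cis, Re; simpl; field; exact Hk'.
      - intros x _; exact (proj1 (ccont_ek k x)). }
    assert (H2 : is_RInt (fun t => Im (ek k t)) 0 (2 * PI) 0).
    { replace 0 with (minus (- cos (IZR k * (2 * PI)) / IZR k) (- cos (IZR k * 0) / IZR k)) at 2
        by (rewrite Hc, Rmult_0_r, cos_0; unfold minus, plus, opp; simpl; field; exact Hk').
      apply (is_RInt_derive (V := R_CompleteNormedModule) (fun t => - cos (IZR k * t) / IZR k)).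
      - intros x _; auto_derive; [exact I|]; unfold ek, cis, Im; simpl; field; exact Hk'.
      - intros x _; exact (proj2 (ccont_ek k x)). }
    rewrite (is_RInt_unique _ _ _ _ H1), (is_RInt_unique _ _ _ _ H2).
    apply C_eq; unfold Re, Im; simpl; ring.
Qed.

Ltac Ceq := match goal with |- @eq _ ?a ?b => change (@eq C a b) end.

Lemma fc_ext (f g : R -> C) (k : Z) :
  (forall t, 0 <= t <= 2 * PI -> f t = g t) -> fc f k = fc g k.
Proof. intros H; apply mean_ext; intros t Ht; now rewrite H. Qed.

Lemma fc_plus (f g : R -> C) (k : Z) :
  ccont f -> ccont g -> fc (fun t => f t + g t)%C k = (fc f k + fc g k)%C.
Proof.
  intros Hf Hg; unfold fc; rewrite <- mean_plus by ccont_tac.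
  apply mean_ext; intros t _; ring.
Qed.

Lemma fc_minus (f g : R -> C) (k : Z) :
  ccont f -> ccont g -> fc (fun t => f t - g t)%C k = (fc f k - fc g k)%C.
Proof.
  intros Hf Hg; unfold fc; rewrite <- mean_minus by ccont_tac.
  apply mean_ext; intros t _; ring.
Qed.

Lemma fc_scal (c : C) (f : R -> C) (k : Z) :
  ccont f -> fc (fun t => c * f t)%C k = (c * fc f k)%C.
Proof.
  intros Hf; unfold fc; rewrite <- mean_scal by ccont_tac.
  apply mean_ext; intros t _; ring.
Qed.

Lemma fc_sum_n (u : nat -> R -> C) (n : nat) (k : Z) :
  (forall j, ccont (u j)) ->
  fc (fun t => sum_n (fun j => u j t) n) k = sum_n (fun j => fc (u j) k) n.
Proof.
  intros Hu; induction n as [|n IH].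
  - rewrite sum_O; apply fc_ext; intros t _; now rewrite sum_O.
  - rewrite sum_n_C_S, <- IH, <- fc_plus; [|now apply ccont_sum_n|apply Hu].
    apply fc_ext; intros t _; now rewrite sum_n_C_S.
Qed.

Lemma fc_ek_mul (f : R -> C) (j k : Z) :
  fc (fun t => ek j t * f t)%C k = fc f (k - j).
Proof.
  apply mean_ext; intros t _.
  replace (- (k - j))%Z with (- k + j)%Z by lia.
  rewrite ek_add; ring.
Qed.

Lemma fc_ek (j k : Z) : fc (ek j) k = RtoC (if Z.eqb j k then 1 else 0).
Proof.
  unfold fc; rewrite (mean_ext _ (ek (j - k))).
  - rewrite mean_ek; f_equal.
    destruct (Z.eqb_spec j k), (Z.eqb_spec (j - k) 0); lia || reflexivity.
  - intros t _; unfold Z.sub; now rewrite ek_add.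
Qed.

Lemma fc_conj (f : R -> C) (k : Z) :
  ccont f -> fc (fun t => Cconj (f t)) k = Cconj (fc f (- k)).
Proof.
  intros Hf; unfold fc; rewrite <- mean_conj by ccont_tac.
  apply mean_ext; intros t _.
  now rewrite Cmult_conj, ek_conj, Z.opp_involutive.
Qed.

Lemma mean_fc (f : R -> C) : mean f = fc f 0.
Proof. apply mean_ext; intros t _; simpl Z.opp; rewrite ek_0; ring. Qed.

Lemma continuous_Cmod_sqr (f : R -> C) (t : R) :
  ccont f -> continuous (fun t => Cmod (f t) ^ 2) t.
Proof.
  intros Hf; destruct (ccont_mult _ _ Hf (ccont_conj _ Hf) t) as [H _].
  apply (continuous_ext (fun t => Re (f t * Cconj (f t))%C)); [|exact H].
  intros x; rewrite <- Cmod2_conj; reflexivity.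
Qed.

Lemma nsq_mean (f : R -> C) :
  RtoC (nsq f) = mean (fun t => f t * Cconj (f t))%C.
Proof.
  unfold nsq, mean, RtoC; f_equal.
  - f_equal; apply RInt_ext; intros t _; rewrite <- Cmod2_conj; reflexivity.
  - rewrite (RInt_ext _ (fun _ => 0)).
    + rewrite RInt_const; unfold scal; simpl; unfold mult; simpl; Req; ring.
    + intros t _; rewrite <- Cmod2_conj; reflexivity.
Qed.

Lemma nsq_le (f g : R -> C) :
  ccont f -> ccont g ->
  (forall t, 0 <= t <= 2 * PI -> Cmod (f t) <= Cmod (g t)) -> nsq f <= nsq g.
Proof.
  intros Hf Hg H; assert (Hp := two_PI_pos); unfold nsq.
  apply Rmult_le_compat_l; [apply Rlt_le; now apply Rinv_0_lt_compat|].
  apply RInt_le; [lra| | |].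
  - apply ex_RInt_cont; intros t; now apply continuous_Cmod_sqr.
  - apply ex_RInt_cont; intros t; now apply continuous_Cmod_sqr.
  - intros t Ht; apply pow_incr; split; [apply Cmod_ge_0|apply H; lra].
Qed.

Lemma nsq_const (c : C) : nsq (fun _ => c) = Cmod c ^ 2.
Proof.
  assert (Hp := two_PI_pos); unfold nsq; rewrite RInt_const.
  unfold scal; simpl; unfold mult; simpl; field; lra.
Qed.

Lemma nsq_bound (f : R -> C) (B : R) :
  ccont f -> 0 <= B -> (forall t, 0 <= t <= 2 * PI -> Cmod (f t) <= B) ->
  nsq f <= B ^ 2.
Proof.
  intros Hf HB H.
  replace (B ^ 2) with (nsq (fun _ => RtoC B)).
  - apply nsq_le; [assumption|apply ccont_const|].
    intros t Ht; rewrite Cmod_R, Rabs_pos_eq by assumption; auto.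
  - rewrite nsq_const, Cmod_R, Rabs_pos_eq by assumption; reflexivity.
Qed.

Lemma nsq_ge_0 (f : R -> C) : ccont f -> 0 <= nsq f.
Proof.
  intros Hf; replace 0 with (nsq (fun _ => RtoC 0)).
  - apply nsq_le; [apply ccont_const|assumption|].
    intros t _; rewrite Cmod_0; apply Cmod_ge_0.
  - rewrite nsq_const, Cmod_0; ring.
Qed.

Lemma nsq_ext (f g : R -> C) :
  (forall t, 0 <= t <= 2 * PI -> Cmod (f t) = Cmod (g t)) -> nsq f = nsq g.
Proof.
  intros H; assert (Hp := two_PI_pos); unfold nsq; f_equal; apply RInt_ext.
  intros t Ht; rewrite H; auto; rewrite Rmin_left, Rmax_right in Ht by lra; lra.
Qed.

Lemma RtoC_neq_0 (x : R) : x <> 0 -> RtoC x <> RtoC 0.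
Proof. intros H E; apply H; now apply RtoC_inj. Qed.

Lemma nsq_scal (c : C) (f : R -> C) :
  ccont f -> nsq (fun t => c * f t)%C = Cmod c ^ 2 * nsq f.
Proof.
  intros Hf; apply RtoC_inj; rewrite RtoC_mult, !nsq_mean, Cmod2_conj.
  rewrite <- mean_scal by ccont_tac; apply mean_ext; intros t _.
  rewrite Cmult_conj; ring.
Qed.

Lemma nsq_minus (f g : R -> C) :
  ccont f -> ccont g ->
  nsq (fun t => f t - g t)%C
  = nsq f + nsq g - 2 * Re (mean (fun t => f t * Cconj (g t))%C).
Proof.
  intros Hf Hg; apply RtoC_inj.
  rewrite RtoC_minus, RtoC_plus, RtoC_mult, re_alt, !nsq_mean.
  rewrite <- mean_conj by ccont_tac.
  replace (2 * ((mean (fun t => f t * Cconj (g t)) +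
      mean (fun t => Cconj (f t * Cconj (g t)))) / 2))%C
   with (mean (fun t => f t * Cconj (g t) + Cconj (f t * Cconj (g t))))%C
   by (rewrite mean_plus by ccont_tac; field; apply RtoC_neq_0; lra).
  rewrite <- mean_plus by ccont_tac.
  rewrite <- mean_minus by ccont_tac.
  apply mean_ext; intros t _.
  rewrite Cminus_conj, Cmult_conj, Cconj_conj; ring.
Qed.

Lemma sum_n_C_zero (u : nat -> C) (n : nat) :
  (forall k, (k <= n)%nat -> u k = RtoC 0) -> sum_n u n = RtoC 0.
Proof.
  induction n as [|n IH]; intros H.
  - rewrite sum_O; auto.
  - rewrite sum_n_C_S, IH, H by auto; Ceq; ring.
Qed.

(** Frequencies are removed one at a time. Since [sg] is injective, subtracting the earlier terms
    leaves the coefficient at the next frequency unchanged, so each removal lowers the squared norm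
    by exactly one squared coefficient. *)
Lemma bessel_eq (f : R -> C) (sg : nat -> Z) (n : nat) :
  ccont f -> (forall i j, sg i = sg j -> i = j) ->
  nsq (fun t => f t - sum_n (fun k => fc f (sg k) * ek (sg k) t) n)%C
  = nsq f - sum_n (fun k => Cmod (fc f (sg k)) ^ 2) n.
Proof.
  intros Hf Hsg.
  assert (step : forall g j, ccont g ->
    nsq (fun t => g t - fc g j * ek j t)%C = nsq g - Cmod (fc g j) ^ 2).
  { intros g j Hg; rewrite nsq_minus by ccont_tac.
    rewrite nsq_scal by ccont_tac.
    rewrite (nsq_ext (ek j) (fun _ => RtoC 1))
      by (intros t _; now rewrite Cmod_ek, Cmod_1).
    rewrite nsq_const, Cmod_1.
    replace (mean (fun t => g t * Cconj (fc g j * ek j t)))%C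
      with (RtoC (Cmod (fc g j) ^ 2)).
    - simpl; ring.
    - rewrite Cmod2_conj.
      rewrite (Cmult_comm (fc g j)).
      unfold fc at 2; rewrite <- mean_scal by ccont_tac.
      apply mean_ext; intros t _; rewrite Cmult_conj, ek_conj; ring. }
  induction n as [|n IH].
  - rewrite sum_O, <- step by assumption.
    apply nsq_ext; intros t _; now rewrite sum_O.
  - rewrite sum_Sn; unfold plus; simpl.
    set (g := fun t => (f t - sum_n (fun k => fc f (sg k) * ek (sg k) t) n)%C) in IH.
    assert (Hg : ccont g).
    { unfold g; apply ccont_minus; [assumption|].
      apply (ccont_sum_n (fun k t => fc f (sg k) * ek (sg k) t)%C); intros k; ccont_tac. }
    assert (E : fc g (sg (S n)) = fc f (sg (S n))).
    { unfold g; rewrite fc_minus; [|assumption|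
        apply (ccont_sum_n (fun k t => fc f (sg k) * ek (sg k) t)%C); intros k; ccont_tac].
      rewrite (fc_sum_n (fun k t => fc f (sg k) * ek (sg k) t)%C) by (intros k; ccont_tac).
      rewrite sum_n_C_zero; [ring|].
      intros k Hk; rewrite fc_scal, fc_ek by ccont_tac.
      destruct (Z.eqb_spec (sg k) (sg (S n))) as [He|He]; [|ring].
      apply Hsg in He; lia. }
    assert (S1 := step g (sg (S n)) Hg); rewrite E in S1.
    transitivity (nsq g - Cmod (fc f (sg (S n))) ^ 2); [|rewrite IH; simpl; ring].
    rewrite <- S1; apply nsq_ext; intros t _.
    rewrite sum_n_C_S; unfold g; f_equal; ring.
Qed.

Lemma bessel_le (f : R -> C) (sg : nat -> Z) (n : nat) :
  ccont f -> (forall i j, sg i = sg j -> i = j) ->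
  sum_n (fun k => Cmod (fc f (sg k)) ^ 2) n <= nsq f.
Proof.
  intros Hf Hsg; generalize (bessel_eq f sg n Hf Hsg); intros E.
  assert (H : 0 <= nsq (fun t => f t - sum_n (fun k => fc f (sg k) * ek (sg k) t) n)%C).
  { apply nsq_ge_0, ccont_minus; [assumption|].
    apply (ccont_sum_n (fun k t => fc f (sg k) * ek (sg k) t)%C); intros k; ccont_tac. }
  lra.
Qed.

Lemma Cmod_fc_sqr_le (f : R -> C) (k : Z) : ccont f -> Cmod (fc f k) ^ 2 <= nsq f.
Proof.
  (* Any injective enumeration starting at [k] would do; only its first term is kept. *)
  intros Hf; generalize (bessel_le f (fun n => k + Z.of_nat n)%Z O Hf).
  rewrite sum_O; rewrite Z.add_0_r; intros H; apply H; intros i j; lia.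
Qed.

Lemma Cmod_fc_le (f : R -> C) (k : Z) (B : R) :
  ccont f -> 0 <= B -> (forall t, 0 <= t <= 2 * PI -> Cmod (f t) <= B) ->
  Cmod (fc f k) <= B.
Proof.
  intros Hf HB H; apply Rsqr_incr_0_var; [|assumption].
  rewrite !Rsqr_pow2.
  generalize (Cmod_fc_sqr_le f k Hf) (nsq_bound f B Hf HB H); lra.
Qed.

(** * Limits of sequences and of trigonometric sums *)

Definition Clim (u : nat -> C) (l : C) : Prop :=
  is_lim_seq (fun n => Cmod (u n - l)%C) 0.

(** Uniform convergence over one period, which is all that Fourier coefficients see. *)
Definition ulim (S : nat -> R -> C) (f : R -> C) : Prop :=
  exists e : nat -> R, is_lim_seq e 0 /\
    forall n t, 0 <= t <= 2 * PI -> Cmod (S n t - f t)%C <= e n.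

Lemma lim_squeeze_0 (u e : nat -> R) :
  (forall n, 0 <= u n <= e n) -> is_lim_seq e 0 -> is_lim_seq u 0.
Proof.
  intros H He; apply is_lim_seq_le_le with (fun _ => 0) e; auto.
  apply is_lim_seq_const.
Qed.

Lemma Clim_bound (u : nat -> C) (l : C) (e : nat -> R) :
  (forall n, Cmod (u n - l)%C <= e n) -> is_lim_seq e 0 -> Clim u l.
Proof.
  intros H He; apply lim_squeeze_0 with e; auto.
  intros n; split; auto; apply Cmod_ge_0.
Qed.

Lemma Clim_ext (u v : nat -> C) (l : C) :
  (forall n, u n = v n) -> Clim u l -> Clim v l.
Proof.
  intros H; unfold Clim; intros Hu; eapply is_lim_seq_ext; [|exact Hu].
  intros n; now rewrite <- H.
Qed.

Lemma Clim_ext_loc (u v : nat -> C) (l : C) (N : nat) :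
  (forall n, (N <= n)%nat -> u n = v n) -> Clim u l -> Clim v l.
Proof.
  intros H Hu; apply is_lim_seq_ext_loc with (fun n => Cmod (u n - l)%C); auto.
  exists N; intros n Hn; now rewrite H.
Qed.

Lemma Clim_const (l : C) : Clim (fun _ => l) l.
Proof.
  apply is_lim_seq_ext with (fun _ => 0); [|apply is_lim_seq_const].
  intros _; replace (l - l)%C with (RtoC 0) by ring; now rewrite Cmod_0.
Qed.

Lemma Cmod_minus_eq_0 (x y : C) : Cmod (x - y)%C = 0 -> x = y.
Proof.
  intros H; apply Cmod_eq_0 in H.
  replace x with (x - y + y)%C by ring; rewrite H; ring.
Qed.

Lemma Clim_scal (c : C) (u : nat -> C) (l : C) :
  Clim u l -> Clim (fun n => c * u n)%C (c * l)%C.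
Proof.
  intros Hu; apply Clim_bound with (fun n => Cmod c * Cmod (u n - l)%C).
  - intros n; rewrite <- Cmod_mult; right; f_equal; ring.
  - replace (Finite 0) with (Rbar_mult (Cmod c) 0) by (simpl; f_equal; ring).
    now apply is_lim_seq_scal_l.
Qed.

Lemma Clim_conj (u : nat -> C) (l : C) :
  Clim u l -> Clim (fun n => Cconj (u n)) (Cconj l).
Proof.
  intros Hu; eapply is_lim_seq_ext; [|exact Hu].
  intros n; simpl; now rewrite <- Cminus_conj, Cmod_conj.
Qed.

Lemma Clim_unique (u : nat -> C) (l m : C) : Clim u l -> Clim u m -> l = m.
Proof.
  intros Hl Hm; apply Cmod_minus_eq_0.
  assert (H : is_lim_seq (fun _ : nat => Cmod (l - m)%C) 0).
  { apply lim_squeeze_0 with (fun n => Cmod (u n - l)%C + Cmod (u n - m)%C).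
    - intros n; split; [apply Cmod_ge_0|].
      rewrite <- (Cmod_opp (u n - l)%C).
      eapply Rle_trans; [|apply Cmod_triangle]; right; f_equal; ring.
    - replace (Finite 0) with (Finite (0 + 0)) by (f_equal; ring).
      now apply is_lim_seq_plus'. }
  assert (H' := is_lim_seq_const (Cmod (l - m)%C)).
  apply is_lim_seq_unique in H; apply is_lim_seq_unique in H'.
  rewrite H in H'; now injection H'.
Qed.

Lemma Clim_Cmod_le (u : nat -> C) (l : C) (B : R) :
  (forall n, Cmod (u n) <= B) -> Clim u l -> Cmod l <= B.
Proof.
  intros HB Hu.
  assert (H : is_lim_seq (fun n => B + Cmod (u n - l)%C) (B + 0))
    by (apply is_lim_seq_plus'; [apply is_lim_seq_const|exact Hu]).
  rewrite Rplus_0_r in H.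
  apply (is_lim_seq_le (fun _ => Cmod l) (fun n => B + Cmod (u n - l)%C) (Cmod l) B);
    [|apply is_lim_seq_const|exact H].
  intros n; rewrite <- (Cmod_opp (u n - l)%C).
  apply Rle_trans with (Cmod (u n) + Cmod (- (u n - l))%C).
  - eapply Rle_trans; [|apply Cmod_triangle]; right; f_equal; ring.
  - generalize (HB n); lra.
Qed.

Lemma is_series_Clim (a : nat -> C) (l : C) :
  is_series (K := C_AbsRing) (V := C_NormedModule) a l -> Clim (sum_n a) l.
Proof.
  intros H; apply is_lim_seq_spec; intros eps.
  destruct (proj1 (filterlim_locally_ball_norm (K := C_AbsRing) (U := C_NormedModule) _ _) H eps)
    as [N HN].
  exists N; intros n Hn; specialize (HN n Hn).
  rewrite Rminus_0_r, Rabs_pos_eq by apply Cmod_ge_0; exact HN.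
Qed.

Lemma lim_scal_0 (c : R) (e : nat -> R) :
  is_lim_seq e 0 -> is_lim_seq (fun n => c * e n) 0.
Proof.
  intros H; replace (Finite 0) with (Rbar_mult c 0) by (simpl; f_equal; ring).
  now apply is_lim_seq_scal_l.
Qed.

Lemma ulim_bound_nonneg (S : nat -> R -> C) (f : R -> C) (e : nat -> R) (n : nat) :
  (forall n t, 0 <= t <= 2 * PI -> Cmod (S n t - f t)%C <= e n) -> 0 <= e n.
Proof.
  intros H; apply Rle_trans with (Cmod (S n 0 - f 0)%C); [apply Cmod_ge_0|].
  apply H; generalize two_PI_pos; lra.
Qed.

Lemma fc_ulim (S : nat -> R -> C) (f : R -> C) (k : Z) :
  (forall n, ccont (S n)) -> ccont f -> ulim S f -> Clim (fun n => fc (S n) k) (fc f k).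
Proof.
  intros HS Hf [e [He Hb]]; apply Clim_bound with e; auto.
  intros n; rewrite <- fc_minus by auto; apply Cmod_fc_le.
  - apply ccont_minus; auto.
  - eapply ulim_bound_nonneg; eauto.
  - intros t Ht; apply Hb; assumption.
Qed.

Lemma ccont_continuity_pt (f : R -> C) (t : R) :
  ccont f -> continuity_pt (fun t => Cmod (f t) ^ 2) t.
Proof.
  intros Hf; apply continuity_pt_filterlim.
  exact (continuous_Cmod_sqr f t Hf).
Qed.

Lemma ccont_bounded (f : R -> C) :
  ccont f -> exists B, 0 <= B /\ forall t, 0 <= t <= 2 * PI -> Cmod (f t) <= B.
Proof.
  intros Hf; assert (Hp := two_PI_pos).
  destruct (continuity_ab_maj (fun t => Cmod (f t) ^ 2) 0 (2 * PI)) as [M [HM _]];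
    [lra|intros; now apply ccont_continuity_pt|].
  exists (Cmod (f M)); split; [apply Cmod_ge_0|].
  intros t Ht; apply Rsqr_incr_0_var; [|apply Cmod_ge_0].
  rewrite !Rsqr_pow2; auto.
Qed.

Lemma ulim_mult (q : R -> C) (S : nat -> R -> C) (f : R -> C) :
  ccont q -> ulim S f -> ulim (fun n t => q t * S n t)%C (fun t => q t * f t)%C.
Proof.
  intros Hq [e [He Hb]]; destruct (ccont_bounded q Hq) as [B [HB HqB]].
  exists (fun n => B * e n); split; [now apply lim_scal_0|].
  intros n t Ht.
  replace (q t * S n t - q t * f t)%C with (q t * (S n t - f t))%C by ring.
  rewrite Cmod_mult; apply Rmult_le_compat; auto using Cmod_ge_0.
Qed.

(** The enumeration [sg] of frequencies lets series in nonnegative, nonpositive or strictly negative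
    frequencies share the same lemmas. *)
Definition psum (g : nat -> C) (sg : nat -> Z) (n : nat) (t : R) : C :=
  sum_n (fun k => g k * ek (sg k) t)%C n.

Lemma ccont_psum (g : nat -> C) (sg : nat -> Z) (n : nat) : ccont (psum g sg n).
Proof.
  apply (ccont_sum_n (fun k t => g k * ek (sg k) t)%C); intros k; ccont_tac.
Qed.

Lemma sum_n_C_mult_l (c : C) (u : nat -> C) (n : nat) :
  sum_n (fun k => c * u k)%C n = (c * sum_n u n)%C.
Proof.
  induction n as [|n IH]; [now rewrite !sum_O|].
  rewrite !sum_n_C_S, IH; Ceq; ring.
Qed.

Lemma fc_mult_psum (q : R -> C) (g : nat -> C) (sg : nat -> Z) (n : nat) (m : Z) :
  ccont q ->
  fc (fun t => q t * psum g sg n t)%C m = sum_n (fun k => g k * fc q (m - sg k))%C n.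
Proof.
  intros Hq; rewrite (fc_ext _ (fun t => sum_n (fun k => g k * (ek (sg k) t * q t)) n)%C).
  - rewrite (fc_sum_n (fun k t => g k * (ek (sg k) t * q t))%C) by (intros k; ccont_tac).
    apply sum_n_ext; intros k; rewrite fc_scal by ccont_tac; now rewrite fc_ek_mul.
  - intros t _; unfold psum; rewrite <- sum_n_C_mult_l; apply sum_n_ext; intros k; Ceq; ring.
Qed.

(** The convolution formula for coefficients of a product. One factor must be a uniformly convergent
    series, the other merely continuous; this asymmetry is what allows boundary functions as factors
    later. *)
Lemma fc_mult_series (q G : R -> C) (g : nat -> C) (sg : nat -> Z) (m : Z) :
  ccont q -> ccont G -> ulim (psum g sg) G ->
  Clim (sum_n (fun k => g k * fc q (m - sg k))%C) (fc (fun t => q t * G t)%C m).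
Proof.
  intros Hq HG HS.
  apply Clim_ext with (fun n => fc (fun t => q t * psum g sg n t)%C m).
  - intros n; now apply fc_mult_psum.
  - apply (fc_ulim (fun n t => q t * psum g sg n t)%C).
    + intros n; apply ccont_mult; [assumption|apply ccont_psum].
    + now apply ccont_mult.
    + now apply ulim_mult.
Qed.

(** * Poisson kernel and uniqueness of Fourier series *)

Lemma Cmod_le_Re_Im (z : C) : Cmod z <= Rabs (Re z) + Rabs (Im z).
Proof.
  replace z with (RtoC (Re z) + Ci * RtoC (Im z))%C at 1
    by (apply C_eq; unfold Re, Im; simpl; ring).
  eapply Rle_trans; [apply Cmod_triangle|].
  rewrite Cmod_mult, Cmod_Ci, !Cmod_R; lra.
Qed.

Lemma im_le_Cmod (z : C) : Rabs (Im z) <= Cmod z.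
Proof. eapply Rle_trans; [|apply Rmax_Cmod]; apply (Rmax_r (Rabs (fst z))). Qed.

Lemma Cmod_minus_sym (x y : C) : Cmod (x - y)%C = Cmod (y - x)%C.
Proof. rewrite <- Cmod_opp; f_equal; ring. Qed.

Lemma Cmod_minus_triangle (x y z : C) :
  Cmod (x - z)%C <= Cmod (x - y)%C + Cmod (y - z)%C.
Proof. eapply Rle_trans; [|apply Cmod_triangle]; right; f_equal; ring. Qed.

Lemma ccont_eps (f : R -> C) :
  ccont f <-> forall t eps, 0 < eps ->
    exists d, 0 < d /\ forall u, Rabs (u - t) < d -> Cmod (f u - f t)%C < eps.
Proof.
  split.
  - intros Hf t eps He; destruct (Hf t) as [H1 H2].
    assert (He2 : 0 < eps / 2) by lra.
    destruct (proj1 (filterlim_locally _ _) H1 (mkposreal _ He2)) as [d1 Hd1].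
    destruct (proj1 (filterlim_locally _ _) H2 (mkposreal _ He2)) as [d2 Hd2].
    exists (Rmin d1 d2); split; [apply Rmin_pos; apply cond_pos|].
    intros u Hu.
    assert (B1 := Hd1 u (Rlt_le_trans _ _ _ Hu (Rmin_l _ _))).
    assert (B2 := Hd2 u (Rlt_le_trans _ _ _ Hu (Rmin_r _ _))).
    change (Rabs (Re (f u) - Re (f t)) < eps / 2) in B1.
    change (Rabs (Im (f u) - Im (f t)) < eps / 2) in B2.
    eapply Rle_lt_trans; [apply Cmod_le_Re_Im|].
    change (Re (f u - f t)%C) with (Re (f u) - Re (f t)).
    change (Im (f u - f t)%C) with (Im (f u) - Im (f t)); lra.
  - intros H t; split; apply filterlim_locally; intros eps;
      destruct (H t eps (cond_pos eps)) as [d [Hd Hb]];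
      exists (mkposreal d Hd); intros u Hu; specialize (Hb u Hu);
      eapply Rle_lt_trans; [|exact Hb| |exact Hb].
    + apply (re_le_Cmod (f u - f t)%C).
    + apply (im_le_Cmod (f u - f t)%C).
Qed.

Lemma ccont_uniform (S : nat -> R -> C) (f : R -> C) (e : nat -> R) :
  (forall n, ccont (S n)) -> is_lim_seq e 0 ->
  (forall n t, Cmod (S n t - f t)%C <= e n) -> ccont f.
Proof.
  intros HS He Hb; apply ccont_eps; intros t eps Heps.
  assert (H3 : 0 < eps / 3) by lra.
  destruct (proj2 (is_lim_seq_spec _ _) He (mkposreal _ H3)) as [N HN].
  specialize (HN N (Nat.le_refl N)); simpl in HN; rewrite Rminus_0_r in HN.
  apply Rabs_lt_between in HN.
  destruct (proj1 (ccont_eps _) (HS N) t (eps / 3) H3) as [d [Hd Hc]].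
  exists d; split; [assumption|]; intros u Hu; specialize (Hc u Hu).
  assert (T1 := Cmod_minus_triangle (f u) (S N u) (f t)).
  assert (T2 := Cmod_minus_triangle (S N u) (S N t) (f t)).
  assert (B1 := Hb N u); assert (B2 := Hb N t).
  rewrite Cmod_minus_sym in B1; lra.
Qed.

(** * Absolutely summable trigonometric series *)

Definition csum (a : nat -> C) : C :=
  (Series (fun k => Re (a k)), Series (fun k => Im (a k))).

Lemma sum_n_Re_Im (a : nat -> C) (n : nat) :
  sum_n a n = ((sum_n (fun k => Re (a k)) n, sum_n (fun k => Im (a k)) n) : C).
Proof.
  induction n as [|n IH].
  - rewrite !sum_O; now destruct (a O).
  - rewrite sum_n_C_S, IH, !sum_Sn; reflexivity.
Qed.

Lemma csum_lim (a : nat -> C) (U : nat -> R) :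
  ex_series U -> (forall k, Cmod (a k) <= U k) -> Clim (sum_n a) (csum a).
Proof.
  intros HU Ha.
  assert (H1 : ex_series (fun k => Re (a k))).
  { apply (ex_series_le (V := R_CompleteNormedModule) _ U); [|assumption].
    intros k; eapply Rle_trans; [apply re_le_Cmod|apply Ha]. }
  assert (H2 : ex_series (fun k => Im (a k))).
  { apply (ex_series_le (V := R_CompleteNormedModule) _ U); [|assumption].
    intros k; eapply Rle_trans; [apply im_le_Cmod|apply Ha]. }
  apply Series_correct in H1; apply Series_correct in H2.
  assert (A1 : is_lim_seq (fun n => Rabs (sum_n (fun k => Re (a k)) n
      - Series (fun k => Re (a k)))) 0).
  { apply (proj1 (is_lim_seq_abs_0 _)).
    replace (Finite 0) with (Finite (Series (fun k => Re (a k)) - Series (fun k => Re (a k))))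
      by (f_equal; ring).
    apply is_lim_seq_minus'; [exact H1|apply is_lim_seq_const]. }
  assert (A2 : is_lim_seq (fun n => Rabs (sum_n (fun k => Im (a k)) n
      - Series (fun k => Im (a k)))) 0).
  { apply (proj1 (is_lim_seq_abs_0 _)).
    replace (Finite 0) with (Finite (Series (fun k => Im (a k)) - Series (fun k => Im (a k))))
      by (f_equal; ring).
    apply is_lim_seq_minus'; [exact H2|apply is_lim_seq_const]. }
  eapply Clim_bound; [|
    replace (Finite 0) with (Finite (0 + 0)) by (f_equal; ring);
    apply (is_lim_seq_plus' _ _ _ _ A1 A2)].
  intros n; rewrite sum_n_Re_Im.
  eapply Rle_trans; [apply Cmod_le_Re_Im|]; right; reflexivity.
Qed.

Lemma sum_n_tail_le (a : nat -> C) (U : nat -> R) (n p : nat) :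
  (forall k, Cmod (a k) <= U k) ->
  Cmod (sum_n a n - sum_n a (n + p))%C <= sum_n U (n + p) - sum_n U n.
Proof.
  intros Ha; induction p as [|p IH].
  - rewrite Nat.add_0_r; replace (sum_n a n - sum_n a n)%C with (RtoC 0) by (Ceq; ring).
    rewrite Cmod_0; right; Req; ring.
  - rewrite Nat.add_succ_r, sum_n_C_S, sum_Sn; unfold plus; simpl.
    eapply Rle_trans; [apply (Cmod_minus_triangle _ (sum_n a (n + p)))|].
    replace (sum_n a (n + p) - (sum_n a (n + p) + a (S (n + p))))%C
      with (- a (S (n + p)))%C by ring.
    rewrite Cmod_opp; generalize (Ha (S (n + p))) IH; simpl; lra.
Qed.

Lemma sum_n_le_Series (U : nat -> R) (n : nat) :
  (forall k, 0 <= U k) -> ex_series U -> sum_n U n <= Series U.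
Proof.
  intros HU H; apply Series_correct in H.
  apply (is_lim_seq_incr_compare (sum_n U)); [exact H|].
  intros k; rewrite sum_Sn; unfold plus; simpl; generalize (HU (S k)); lra.
Qed.

Lemma csum_tail (a : nat -> C) (U : nat -> R) (n : nat) :
  ex_series U -> (forall k, Cmod (a k) <= U k) ->
  Cmod (sum_n a n - csum a)%C <= Series U - sum_n U n.
Proof.
  intros HU Ha.
  assert (HU0 : forall k, 0 <= U k)
    by (intros k; eapply Rle_trans; [apply Cmod_ge_0|apply Ha]).
  rewrite Cmod_minus_sym.
  (* The bound for finite blocks of terms passes to the limit as [p] grows. *)
  apply Clim_Cmod_le with (fun p => sum_n a (n + p)%nat - sum_n a n)%C.
  - intros p; rewrite Cmod_minus_sym.
    generalize (sum_n_tail_le a U n p Ha) (sum_n_le_Series U (n + p) HU0 HU); lra.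
  - eapply is_lim_seq_ext; [|apply (proj1 (is_lim_seq_incr_n _ n _) (csum_lim a U HU Ha))].
    intros p; simpl; rewrite (Nat.add_comm p n); f_equal; ring.
Qed.

Lemma Series_tail_lim (U : nat -> R) :
  ex_series U -> is_lim_seq (fun n => Series U - sum_n U n) 0.
Proof.
  intros H; apply Series_correct in H.
  replace (Finite 0) with (Finite (Series U - Series U)) by (f_equal; ring).
  apply is_lim_seq_minus'; [apply is_lim_seq_const|exact H].
Qed.

Definition tsum (g : nat -> C) (sg : nat -> Z) (t : R) : C :=
  csum (fun k => g k * ek (sg k) t)%C.

Lemma tsum_tail (g : nat -> C) (sg : nat -> Z) (n : nat) (t : R) :
  ex_series (fun k => Cmod (g k)) ->
  Cmod (psum g sg n t - tsum g sg t)%C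
  <= Series (fun k => Cmod (g k)) - sum_n (fun k => Cmod (g k)) n.
Proof.
  intros H; apply csum_tail; [assumption|].
  intros k; rewrite Cmod_mult, Cmod_ek; lra.
Qed.

Lemma ulim_tsum (g : nat -> C) (sg : nat -> Z) :
  ex_series (fun k => Cmod (g k)) -> ulim (psum g sg) (tsum g sg).
Proof.
  intros H; exists (fun n => Series (fun k => Cmod (g k)) - sum_n (fun k => Cmod (g k)) n).
  split; [now apply Series_tail_lim|]; intros n t _; now apply tsum_tail.
Qed.

Lemma ccont_tsum (g : nat -> C) (sg : nat -> Z) :
  ex_series (fun k => Cmod (g k)) -> ccont (tsum g sg).
Proof.
  intros H.
  apply (ccont_uniform (psum g sg) _
    (fun n => Series (fun k => Cmod (g k)) - sum_n (fun k => Cmod (g k)) n)).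
  - intros n; apply ccont_psum.
  - now apply Series_tail_lim.
  - intros n t; now apply tsum_tail.
Qed.

Lemma tsum_periodic (g : nat -> C) (sg : nat -> Z) (t : R) :
  tsum g sg (t + 2 * PI) = tsum g sg t.
Proof.
  unfold tsum, csum; f_equal; apply Series_ext; intros k; now rewrite cis_2PI.
Qed.

Lemma sum_n_C_single (u : nat -> C) (n j : nat) :
  (j <= n)%nat -> (forall k, k <> j -> u k = RtoC 0) -> sum_n u n = u j.
Proof.
  intros Hj H; induction n as [|n IH].
  - rewrite sum_O; f_equal; lia.
  - rewrite sum_n_C_S; destruct (Nat.eq_dec j (S n)) as [->|Hn].
    + rewrite sum_n_C_zero; [Ceq; ring|]; intros k Hk; apply H; lia.
    + rewrite IH by lia; rewrite (H (S n)) by lia; Ceq; ring.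
Qed.

Lemma Clim_sum_single (u : nat -> C) (l : C) (j : nat) :
  (forall k, k <> j -> u k = RtoC 0) -> Clim (sum_n u) l -> l = u j.
Proof.
  intros H Hl; eapply Clim_unique; [exact Hl|].
  apply (Clim_ext_loc (fun _ => u j) _ _ j); [|apply Clim_const].
  intros n Hn; now rewrite (sum_n_C_single u n j).
Qed.

Lemma Clim_sum_zero (u : nat -> C) (l : C) :
  (forall k, u k = RtoC 0) -> Clim (sum_n u) l -> l = RtoC 0.
Proof. intros H Hl; rewrite <- (H O); now apply (Clim_sum_single u l O). Qed.

Lemma fc_const (c : C) (k : Z) : fc (fun _ => c) k = (if Z.eqb k 0 then c else RtoC 0).
Proof.
  rewrite (fc_ext _ (fun t => c * ek 0 t)%C) by (intros t _; rewrite ek_0; ring).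
  rewrite fc_scal, fc_ek by ccont_tac.
  destruct (Z.eqb_spec k 0), (Z.eqb_spec 0 k); try lia; ring.
Qed.

(** The convolution formula with the constant factor 1: its only nonzero coefficient sits at
    frequency 0, so at most one term survives. *)
Lemma fc_series_coef (G : R -> C) (g : nat -> C) (sg : nat -> Z) :
  ccont G -> ulim (psum g sg) G -> (forall i j, sg i = sg j -> i = j) ->
  (forall k, fc G (sg k) = g k) /\
  (forall m, (forall k, sg k <> m) -> fc G m = RtoC 0).
Proof.
  intros HG HS Hsg.
  assert (L : forall m, Clim (sum_n (fun k => g k * fc (fun _ => RtoC 1) (m - sg k))%C) (fc G m)).
  { intros m.
    rewrite (fc_ext G (fun t => RtoC 1 * G t)%C) by (intros t _; ring).
    apply fc_mult_series; ccont_tac. }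
  split.
  - intros k; rewrite (Clim_sum_single _ _ k) with (2 := L (sg k)).
    + rewrite fc_const, Z.sub_diag; simpl; ring.
    + intros j Hj; rewrite fc_const; destruct (Z.eqb_spec (sg k - sg j) 0) as [E|E]; [|ring].
      exfalso; apply Hj, Hsg; lia.
  - intros m Hm; apply Clim_sum_zero with (2 := L m); intros k; rewrite fc_const.
    destruct (Z.eqb_spec (m - sg k) 0) as [E|E]; [|ring].
    exfalso; apply (Hm k); lia.
Qed.

(** * The Herglotz and Poisson kernels *)

Definition herglotz (z : C) (t : R) : C := ((cis t + z) / (cis t - z))%C.

(** Taylor coefficients of (1 + y) / (1 - y) = 1 + 2 y + 2 y^2 + ... *)
Definition hg (k : nat) : C := match k with O => RtoC 1 | S _ => RtoC 2 end.

Lemma cis_minus_neq_0 (z : C) (t : R) : Cmod z <> 1 -> (cis t - z)%C <> RtoC 0.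
Proof.
  intros Hz E; apply Hz; rewrite <- (Cmod_cis t).
  f_equal; symmetry; apply Cmod_minus_eq_0; now rewrite E, Cmod_0.
Qed.

Lemma ccont_herglotz (z : C) : Cmod z <> 1 -> ccont (herglotz z).
Proof.
  intros Hz; unfold herglotz, Cdiv.
  assert (Hc : ccont cis) by (apply (ccont_ext (ek 1)); [apply ek_1|apply ccont_ek]).
  apply (ccont_mult (fun t => cis t + z)%C (fun t => / (cis t - z))%C).
  - ccont_tac.
  - apply (ccont_inv (fun t => cis t - z)%C); [ccont_tac|].
    intros t; now apply cis_minus_neq_0.
Qed.

Lemma geometric_sum (y : C) (n : nat) :
  ((1 - y) * sum_n (fun k => hg k * y ^ k) n)%C = (1 + y - 2 * y ^ S n)%C.
Proof.
  induction n as [|n IH].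
  - rewrite sum_O; simpl; ring.
  - rewrite sum_n_C_S, Cmult_plus_distr_l, IH.
    change (hg (S n)) with (RtoC 2); rewrite !Cpow_S; ring.
Qed.

Lemma herglotz_psum_bound (z : C) (n : nat) (t : R) :
  Cmod z < 1 ->
  Cmod (psum (fun k => hg k * z ^ k) (fun k => - Z.of_nat k)%Z n t - herglotz z t)%C
  <= 2 / (1 - Cmod z) * Cmod z ^ S n.
Proof.
  intros Hz.
  (* With y = z e^{-it} the kernel becomes (1 + y) / (1 - y), and its partial sums become geometric
     sums. *)
  set (y := (z * ek (- 1) t)%C).
  assert (Hy : Cmod y = Cmod z) by (unfold y; rewrite Cmod_mult, Cmod_ek; ring).
  assert (Ey : z = (y * cis t)%C).
  { unfold y; rewrite <- ek_1, <- Cmult_assoc, (ek_neg_l 1); ring. }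
  assert (E1 : psum (fun k => hg k * z ^ k)%C (fun k => - Z.of_nat k)%Z n t
    = sum_n (fun k => hg k * y ^ k)%C n).
  { unfold psum; apply sum_n_ext; intros k; unfold y.
    rewrite Cpow_mult_l, <- ek_conj, ek_nat.
    change (ek (-1) t) with (ek (- (1)) t); rewrite <- (ek_conj 1), ek_1, <- Cpow_conj.
    Ceq; ring. }
  assert (H1 : (1 - y)%C <> RtoC 0).
  { intros E; assert (E' : y = RtoC 1) by (symmetry; apply Cmod_minus_eq_0; now rewrite E, Cmod_0).
    rewrite E', Cmod_1 in Hy; lra. }
  assert (H2 := cis_neq_0 t).
  assert (H3 : (cis t - z)%C <> RtoC 0) by (apply cis_minus_neq_0; lra).
  assert (E2 : herglotz z t = ((1 + y) / (1 - y))%C).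
  { unfold herglotz; rewrite Ey in H3 |- *; field; split; assumption. }
  assert (E3 : (sum_n (fun k => hg k * y ^ k) n - herglotz z t)%C
     = (- (2 * y ^ S n) / (1 - y))%C).
  { rewrite E2.
    replace (sum_n (fun k => hg k * y ^ k)%C n)
      with (((1 - y) * sum_n (fun k => hg k * y ^ k) n) / (1 - y))%C by (Ceq; field; assumption).
    rewrite geometric_sum; field; assumption. }
  rewrite E1, E3, Cmod_div, Cmod_opp, Cmod_mult, Cmod_pow, Hy by assumption.
  rewrite Cmod_R, Rabs_pos_eq by lra.
  assert (H4 : 1 - Cmod z <= Cmod (1 - y)%C).
  { generalize (Cmod_triangle (1 - y)%C y); replace (1 - y + y)%C with (RtoC 1) by ring.
    rewrite Cmod_1, Hy; lra. }
  unfold Rdiv; rewrite Rmult_assoc, (Rmult_comm (Cmod z ^ S n)), <- Rmult_assoc.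
  apply Rmult_le_compat_r; [apply pow_le, Cmod_ge_0|].
  apply Rmult_le_compat_l; [lra|]; apply Rinv_le_contravar; lra.
Qed.

Lemma pow_S_lim (x : R) : 0 <= x < 1 -> is_lim_seq (fun n => x ^ S n) 0.
Proof.
  intros Hx; apply (is_lim_seq_incr_1 (fun n => x ^ n)).
  apply is_lim_seq_geom; rewrite Rabs_pos_eq; lra.
Qed.

Lemma ulim_herglotz (z : C) :
  Cmod z < 1 -> ulim (psum (fun k => hg k * z ^ k)%C (fun k => - Z.of_nat k)%Z) (herglotz z).
Proof.
  intros Hz; exists (fun n => 2 / (1 - Cmod z) * Cmod z ^ S n); split.
  - apply lim_scal_0, pow_S_lim; split; [apply Cmod_ge_0|assumption].
  - intros n t _; now apply herglotz_psum_bound.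
Qed.

(** The kernel is a series in the frequencies -k, so its pairing with [f] sees only the coefficients
    of index k >= 0. *)
Lemma herglotz_series (f : R -> C) (z : C) :
  ccont f -> Cmod z < 1 ->
  Clim (sum_n (fun k => hg k * z ^ k * fc f (Z.of_nat k))%C)
       (mean (fun t => f t * herglotz z t)%C).
Proof.
  intros Hf Hz; rewrite mean_fc.
  eapply Clim_ext; [|apply (fc_mult_series f (herglotz z)); [assumption| |now apply ulim_herglotz]].
  - intros n; apply sum_n_ext; intros k; simpl; f_equal; f_equal; lia.
  - apply ccont_herglotz; lra.
Qed.

(** The real part is the Poisson kernel (1 - |z|^2) / |e^{it} - z|^2. *)
Lemma Re_herglotz (z : C) (t : R) :
  Cmod z < 1 -> 0 <= Re (herglotz z t).
Proof.
  intros Hz; assert (H3 : (cis t - z)%C <> RtoC 0) by (apply cis_minus_neq_0; lra).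
  assert (E : herglotz z t
    = (RtoC (/ Cmod (cis t - z) ^ 2) * ((cis t + z) * Cconj (cis t - z)))%C).
  { unfold herglotz, Cdiv; rewrite RtoC_inv, Cmod2_conj.
    assert (H4 : Cconj (cis t - z)%C <> RtoC 0).
    { intros E; apply H3; apply Cmod_eq_0; now rewrite <- Cmod_conj, E, Cmod_0. }
    - field; split; assumption.
    - apply pow_nonzero; intros E; apply H3; now apply Cmod_eq_0. }
  rewrite E; destruct z as [a b].
  assert (Hab : a ^ 2 + b ^ 2 < 1).
  { assert (H0 := Cmod_ge_0 (a, b)).
    replace (a ^ 2 + b ^ 2) with (Cmod (a, b) ^ 2) by (rewrite Cmod2_alt; reflexivity).
    nra. }
  assert (Hcs := sin2_cos2 t); unfold Rsqr in Hcs.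
  replace (Re (RtoC (/ Cmod (cis t - (a, b)) ^ 2) * ((cis t + (a, b)) * Cconj (cis t - (a, b))))%C)
    with (/ Cmod (cis t - (a, b))%C ^ 2 * (1 - (a ^ 2 + b ^ 2))).
  - apply Rmult_le_pos; [|lra].
    apply Rlt_le, Rinv_0_lt_compat, pow_lt, Cmod_gt_0; assumption.
  - rewrite <- Hcs; unfold cis, Re; simpl; ring.
Qed.

Lemma ccont_RtoC (g : R -> R) :
  (forall t, continuous g t) -> ccont (fun t => RtoC (g t)).
Proof. intros Hg t; split; [apply Hg|apply continuous_const]. Qed.

Lemma Cmod_scis (s t : R) : 0 <= s -> Cmod (s * cis t)%C = s.
Proof. intros Hs; rewrite Cmod_mult, Cmod_cis, Cmod_R, Rabs_pos_eq by assumption; ring. Qed.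

Lemma cos_away (d u : R) :
  0 < d <= PI -> d <= Rabs u <= 2 * PI - d -> cos u <= cos d.
Proof.
  intros Hd Hu.
  assert (E : cos u = cos (Rabs u)).
  { unfold Rabs; destruct (Rcase_abs u); [now rewrite cos_neg|reflexivity]. }
  rewrite E; destruct (Rle_or_lt (Rabs u) PI) as [H|H].
  - apply cos_decr_1; lra.
  - replace (cos (Rabs u)) with (cos (2 * PI - Rabs u)).
    + apply cos_decr_1; lra.
    + rewrite cos_minus, cos_2PI, sin_2PI; ring.
Qed.

(* Korovkin's test function [1 - cos] controls the oscillation of [g] at [th]. *)
Lemma korovkin_bound (g : R -> R) (th eps : R) :
  (forall t, continuous g t) -> (forall t, g (t + 2 * PI) = g t) ->
  0 <= th <= 2 * PI -> 0 < eps ->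
  exists K, 0 <= K /\ forall t, 0 <= t <= 2 * PI ->
    Rabs (g t - g th) <= eps + K * (1 - cos (t - th)).
Proof.
  intros Hg Hper Hth Heps.
  destruct (ccont_bounded _ (ccont_RtoC g Hg)) as [M [HM HgM]].
  destruct (proj1 (ccont_eps _) (ccont_RtoC g Hg) th eps Heps) as [d0 [Hd0 Hc]].
  set (d := Rmin d0 (PI / 2)).
  assert (HPI := PI_RGT_0).
  assert (Hd1 : d <= d0) by apply Rmin_l.
  assert (Hd2 : d <= PI / 2) by apply Rmin_r.
  assert (Hd3 : 0 < d) by (apply Rmin_pos; lra).
  assert (Hcos : cos d < 1).
  { rewrite <- cos_0; apply cos_decreasing_1; lra. }
  assert (Hnear : forall u, Rabs (u - th) < d -> Rabs (g u - g th) < eps).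
  { intros u Hu; specialize (Hc u ltac:(lra)).
    now rewrite <- RtoC_minus, Cmod_R in Hc. }
  (* Away from [th] the oscillation is at most 2 M while 1 - cos is at least 1 - cos d; this
     constant balances the two. *)
  exists (2 * M / (1 - cos d)); split.
  { apply Rmult_le_pos; [lra|]; apply Rlt_le, Rinv_0_lt_compat; lra. }
  intros t Ht.
  assert (Hpos : 0 <= 2 * M / (1 - cos d) * (1 - cos (t - th))).
  { apply Rmult_le_pos.
    - apply Rmult_le_pos; [lra|]; apply Rlt_le, Rinv_0_lt_compat; lra.
    - generalize (COS_bound (t - th)); lra. }
  (* Closeness to [th] is modulo 2 pi: a point of the period can be near [th] directly or after a
     full turn in either direction. *)
  destruct (Rlt_or_le (Rabs (t - th)) d) as [H1|H1].
  { generalize (Hnear t H1); lra. }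
  destruct (Rlt_or_le (Rabs (t - 2 * PI - th)) d) as [H2|H2].
  { generalize (Hnear _ H2); rewrite <- (Hper (t - 2 * PI)).
    replace (t - 2 * PI + 2 * PI) with t by ring; lra. }
  destruct (Rlt_or_le (Rabs (t + 2 * PI - th)) d) as [H3|H3].
  { generalize (Hnear _ H3); rewrite Hper; lra. }
  assert (Hcc : cos (t - th) <= cos d).
  { apply cos_away; [lra|]; split; [assumption|].
    revert H2 H3; unfold Rabs; repeat destruct Rcase_abs; lra. }
  assert (Hb : Rabs (g t - g th) <= 2 * M).
  { assert (B1 := HgM t Ht); assert (B2 := HgM th Hth).
    rewrite Cmod_R in B1, B2.
    eapply Rle_trans; [apply Rabs_triang|]; rewrite Rabs_Ropp; lra. }
  apply Rle_trans with (2 * M / (1 - cos d) * (1 - cos d)).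
  - replace (2 * M / (1 - cos d) * (1 - cos d)) with (2 * M) by (field; lra); assumption.
  - apply Rle_trans with (2 * M / (1 - cos d) * (1 - cos (t - th))); [|lra].
    apply Rmult_le_compat_l; [|lra].
    apply Rmult_le_pos; [lra|]; apply Rlt_le, Rinv_0_lt_compat; lra.
Qed.

Lemma herglotz_mono (g h : R -> R) (z : C) :
  Cmod z < 1 -> (forall t, continuous g t) -> (forall t, continuous h t) ->
  (forall t, 0 <= t <= 2 * PI -> g t <= h t) ->
  Re (mean (fun t => RtoC (g t) * herglotz z t)%C)
  <= Re (mean (fun t => RtoC (h t) * herglotz z t)%C).
Proof.
  intros Hz Hg Hh H; assert (Hp := two_PI_pos).
  assert (HH := ccont_herglotz z (Rlt_not_eq _ _ Hz)).
  unfold mean; simpl; apply Rmult_le_compat_l; [apply Rlt_le; now apply Rinv_0_lt_compat|].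
  apply RInt_le; [lra| | |].
  - apply (ccont_Re_int (fun t => RtoC (g t) * herglotz z t)%C).
    apply ccont_mult; [now apply ccont_RtoC|assumption].
  - apply (ccont_Re_int (fun t => RtoC (h t) * herglotz z t)%C).
    apply ccont_mult; [now apply ccont_RtoC|assumption].
  - intros t Ht.
    assert (HR := Re_herglotz z t Hz); unfold Re in *; simpl.
    rewrite !Rmult_0_l, !Rminus_0_r; apply Rmult_le_compat_r; [exact HR|apply H; lra].
Qed.

Lemma mean_herglotz_const (c z : C) :
  Cmod z < 1 -> mean (fun t => c * herglotz z t)%C = c.
Proof.
  intros Hz; rewrite (Clim_sum_single _ _ O)
    with (2 := herglotz_series (fun _ => c) z (ccont_const c) Hz).
  - simpl; rewrite fc_const; simpl; ring.
  - intros k Hk; rewrite fc_const.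
    destruct (Z.eqb_spec (Z.of_nat k) 0); [lia|ring].
Qed.

Lemma mean_herglotz_ek1 (z : C) :
  Cmod z < 1 -> mean (fun t => ek 1 t * herglotz z t)%C = (2 * z)%C.
Proof.
  intros Hz; rewrite (Clim_sum_single _ _ 1%nat)
    with (2 := herglotz_series (ek 1) z (ccont_ek 1) Hz).
  - rewrite fc_ek; simpl; ring.
  - intros k Hk; rewrite fc_ek.
    destruct (Z.eqb_spec 1 (Z.of_nat k)); [lia|ring].
Qed.

Lemma mean_herglotz_ekm1 (z : C) :
  Cmod z < 1 -> mean (fun t => ek (-1) t * herglotz z t)%C = RtoC 0.
Proof.
  intros Hz; apply Clim_sum_zero with (2 := herglotz_series (ek (-1)) z (ccont_ek (-1)) Hz).
  intros k; rewrite fc_ek.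
  destruct (Z.eqb_spec (-1) (Z.of_nat k)); [lia|ring].
Qed.

Lemma RtoC_cos_minus (t th : R) :
  RtoC (cos (t - th)) = ((ek 1 t * cis (- th) + ek (-1) t * cis th) / 2)%C.
Proof.
  change (ek (-1) t) with (ek (- (1)) t); rewrite <- (ek_conj 1), ek_1.
  rewrite cos_minus; unfold cis; apply C_eq; unfold Re, Im; simpl;
    rewrite ?cos_neg, ?sin_neg; field.
Qed.

(** The harmonic extension of cos(t - th), evaluated at s e^{i th}. Hence the Poisson integral of
    Korovkin's function 1 - cos is 1 - s there. *)
Lemma mean_herglotz_cos (s th : R) :
  0 <= s < 1 ->
  Re (mean (fun t => RtoC (cos (t - th)) * herglotz (s * cis th) t)%C) = s.
Proof.
  intros Hs; assert (Hz : Cmod (s * cis th)%C < 1) by (rewrite Cmod_scis; lra).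
  assert (HH := ccont_herglotz _ (Rlt_not_eq _ _ Hz)).
  rewrite (mean_ext _ (fun t => (cis (- th) / 2) * (ek 1 t * herglotz (s * cis th) t)
      + (cis th / 2) * (ek (-1) t * herglotz (s * cis th) t))%C).
  - rewrite mean_plus by ccont_tac; rewrite !mean_scal by ccont_tac.
    rewrite mean_herglotz_ek1, mean_herglotz_ekm1 by assumption.
    replace (cis (- th) / 2 * (2 * (s * cis th)) + cis th / 2 * 0)%C with (RtoC s); [reflexivity|].
    transitivity (s * (cis (- th) * cis th))%C.
    + rewrite <- cis_add, Rplus_opp_l, cis_0; ring.
    + field; apply RtoC_neq_0; lra.
  - intros t _; rewrite RtoC_cos_minus; field; apply RtoC_neq_0; lra.
Qed.

(** Korovkin's argument: |g - g(th)| is dominated by eps + K (1 - cos(t - th)), the Poisson integral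
    is positive and reproduces constants, and the majorant is sent to eps + K (1 - s). *)
Lemma poisson_limit (g : R -> R) (th eps : R) :
  (forall t, continuous g t) -> (forall t, g (t + 2 * PI) = g t) ->
  0 <= th <= 2 * PI -> 0 < eps ->
  exists K, 0 <= K /\ forall s, 0 <= s < 1 ->
    Rabs (Re (mean (fun t => RtoC (g t) * herglotz (s * cis th) t)%C) - g th)
    <= eps + K * (1 - s).
Proof.
  intros Hg Hper Hth Heps.
  destruct (korovkin_bound g th eps Hg Hper Hth Heps) as [K [HK Hb]].
  exists K; split; [assumption|]; intros s Hs.
  assert (Hz : Cmod (s * cis th)%C < 1) by (rewrite Cmod_scis; lra).
  assert (HH := ccont_herglotz _ (Rlt_not_eq _ _ Hz)).
  assert (Hcg := ccont_RtoC g Hg).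
  assert (Hccos : forall t, continuous (fun t => cos (t - th)) t)
    by (intros t; apply (ex_derive_continuous (V := R_NormedModule)); auto_derive; exact I).
  assert (Hcc := ccont_RtoC _ Hccos).
  (* One formula covers every combination of g, 1 and cos(t - th); [U] and [L] below compare g -
     g(th) and its negative with the majorant. *)
  assert (aff : forall a b c : R,
    Re (mean (fun t => RtoC (a * g t + (b + c * cos (t - th))) * herglotz (s * cis th) t)%C)
    = a * Re (mean (fun t => RtoC (g t) * herglotz (s * cis th) t)%C) + (b + c * s)).
  { intros a b c.
    rewrite (mean_ext _ (fun t => RtoC a * (RtoC (g t) * herglotz (s * cis th) t)
       + (RtoC b * herglotz (s * cis th) t
          + RtoC c * (RtoC (cos (t - th)) * herglotz (s * cis th) t)))%C).
    - rewrite mean_plus by ccont_tac; rewrite mean_plus by ccont_tac.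
      rewrite !(mean_scal (RtoC a)), !(mean_scal (RtoC c)) by ccont_tac.
      rewrite mean_herglotz_const by assumption.
      replace (b + c * s) with (b + c *
          Re (mean (fun t => RtoC (cos (t - th)) * herglotz (s * cis th) t)%C))
        by (now rewrite mean_herglotz_cos by assumption).
      unfold Re; simpl; ring.
    - intros t _; rewrite !RtoC_plus, !RtoC_mult; ring. }
  assert (cnt : forall a b c t, continuous (fun t => a * g t + (b + c * cos (t - th))) t).
  { intros a b c t; apply (continuous_plus (fun t => a * g t) (fun t => b + c * cos (t - th))).
    - apply (continuous_mult (K := R_AbsRing)); [apply continuous_const|apply Hg].
    - apply (continuous_plus (fun t => b) (fun t => c * cos (t - th))); [apply continuous_const|].
      apply (continuous_mult (K := R_AbsRing)); [apply continuous_const|apply Hccos]. }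
  set (P := fun h : R -> R => Re (mean (fun t => RtoC (h t) * herglotz (s * cis th) t)%C)).
  assert (U : P (fun t => 1 * g t + (- g th + 0 * cos (t - th)))
     <= P (fun t => 0 * g t + ((eps + K) + - K * cos (t - th)))).
  { apply herglotz_mono; auto; intros t Ht; specialize (Hb t Ht).
    apply Rabs_le_between in Hb; lra. }
  assert (L : P (fun t => (-1) * g t + (g th + 0 * cos (t - th)))
     <= P (fun t => 0 * g t + ((eps + K) + - K * cos (t - th)))).
  { apply herglotz_mono; auto; intros t Ht; specialize (Hb t Ht).
    apply Rabs_le_between in Hb; lra. }
  unfold P in U, L.
  rewrite !aff in U; rewrite !aff in L.
  apply Rabs_le; lra.
Qed.

Lemma small_zero (x : R) :
  (forall eps, 0 < eps ->
    exists K, 0 <= K /\ forall s, 0 <= s < 1 -> Rabs x <= eps + K * (1 - s)) ->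
  x = 0.
Proof.
  intros H; destruct (Req_dec x 0) as [E|E]; [exact E|exfalso].
  assert (Hx := Rabs_pos_lt x E).
  destruct (H (Rabs x / 4)) as [K [HK Hs]]; [lra|].
  assert (H1 : 0 < Rabs x / 4 / (Rabs x / 4 + K + 1)).
  { apply Rdiv_lt_0_compat; lra. }
  assert (H2 : Rabs x / 4 / (Rabs x / 4 + K + 1) <= 1).
  { apply Rmult_le_reg_r with (Rabs x / 4 + K + 1); [lra|].
    replace (Rabs x / 4 / (Rabs x / 4 + K + 1) * (Rabs x / 4 + K + 1)) with (Rabs x / 4)
      by (field; lra); lra. }
  (* With e = |x| / 4, taking 1 - s = e / (e + K + 1) makes K (1 - s) <= e, so that |x| <= 2 e, a
     contradiction. *)
  specialize (Hs (1 - Rabs x / 4 / (Rabs x / 4 + K + 1)) ltac:(lra)).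
  assert (H3 : K * (1 - (1 - Rabs x / 4 / (Rabs x / 4 + K + 1))) <= Rabs x / 4).
  { replace (1 - (1 - Rabs x / 4 / (Rabs x / 4 + K + 1)))
      with (Rabs x / 4 / (Rabs x / 4 + K + 1)) by ring.
    apply Rmult_le_reg_r with (Rabs x / 4 + K + 1); [lra|].
    replace (K * (Rabs x / 4 / (Rabs x / 4 + K + 1)) * (Rabs x / 4 + K + 1))
      with (K * (Rabs x / 4)) by (field; lra); nra. }
  lra.
Qed.

Lemma periodic_reduce (P : R -> Prop) :
  (forall t, 0 <= t <= 2 * PI -> P t) -> (forall t, P t <-> P (t + 2 * PI)) -> forall t, P t.
Proof.
  intros H0 Hper.
  assert (Hp := two_PI_pos).
  assert (up : forall n t, 0 <= t <= 2 * PI + INR n * (2 * PI) -> P t).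
  { induction n as [|n IH]; intros t Ht.
    - apply H0; simpl in Ht; lra.
    - rewrite S_INR in Ht; destruct (Rle_or_lt t (2 * PI)) as [H|H].
      + apply H0; lra.
      + replace t with (t - 2 * PI + 2 * PI) by ring; apply (Hper (t - 2 * PI)).
        apply IH; lra. }
  assert (up' : forall t, 0 <= t -> P t).
  { intros t Ht; destruct (INR_unbounded (t / (2 * PI))) as [n Hn].
    apply (up n); split; [assumption|].
    apply Rmult_lt_compat_r with (r := 2 * PI) in Hn; [|assumption].
    replace (t / (2 * PI) * (2 * PI)) with t in Hn by (field; lra); lra. }
  assert (dn : forall n t, - (INR n * (2 * PI)) <= t -> P t).
  { induction n as [|n IH]; intros t Ht.
    - apply up'; simpl in Ht; lra.
    - apply Hper, IH; rewrite S_INR in Ht; lra. }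
  intros t; destruct (INR_unbounded (- t / (2 * PI))) as [n Hn].
  apply (dn n); apply Rmult_lt_compat_r with (r := 2 * PI) in Hn; [|assumption].
  replace (- t / (2 * PI) * (2 * PI)) with (- t) in Hn by (field; lra); lra.
Qed.

(** All Poisson integrals of [g] vanish, being built from its coefficients, and they converge
    radially to [g]. The function must be real since only the real part of the Herglotz integral is
    controlled. *)
Lemma fourier_unique_R (g : R -> R) (t : R) :
  (forall t, continuous g t) -> (forall t, g (t + 2 * PI) = g t) ->
  (forall k, fc (fun t => RtoC (g t)) k = RtoC 0) -> g t = 0.
Proof.
  intros Hg Hper H0; revert t; apply periodic_reduce; [|intros t; now rewrite Hper].
  intros th Hth; apply small_zero; intros eps Heps.
  destruct (poisson_limit g th eps Hg Hper Hth Heps) as [K [HK Hb]].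
  exists K; split; [assumption|]; intros s Hs; specialize (Hb s Hs).
  replace (mean (fun t => RtoC (g t) * herglotz (s * cis th) t)%C) with (RtoC 0) in Hb.
  - simpl in Hb; rewrite Rminus_0_l, Rabs_Ropp in Hb; exact Hb.
  - symmetry; eapply Clim_sum_zero;
      [|apply herglotz_series; [now apply ccont_RtoC|rewrite Cmod_scis; lra]].
    intros k; simpl; rewrite H0; ring.
Qed.

Lemma fourier_unique (f g : R -> C) :
  ccont f -> ccont g ->
  (forall t, f (t + 2 * PI) = f t) -> (forall t, g (t + 2 * PI) = g t) ->
  (forall k, fc f k = fc g k) -> forall t, f t = g t.
Proof.
  intros Hf Hg Pf Pg H.
  set (h := fun t => (f t - g t)%C).
  assert (Hh : ccont h) by (unfold h; ccont_tac).
  assert (Hh0 : forall k, fc h k = RtoC 0)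
    by (intros k; unfold h; rewrite fc_minus, H by assumption; ring).
  assert (Hcj : forall k, fc (fun t => Cconj (h t)) k = RtoC 0).
  { intros k; rewrite fc_conj, Hh0 by assumption; apply C_eq; simpl; ring. }
  assert (HR : forall t, Re (h t) = 0).
  { intros t; apply fourier_unique_R with (g := fun t => Re (h t)).
    - intros u; exact (proj1 (Hh u)).
    - intros u; unfold h; now rewrite Pf, Pg.
    - intros k; rewrite (fc_ext _ (fun t => (/ 2) * (h t + Cconj (h t)))%C).
      + rewrite fc_scal, fc_plus, Hh0, Hcj by ccont_tac; ring.
      + intros u _; rewrite re_alt; field; apply RtoC_neq_0; lra. }
  assert (HI : forall t, Im (h t) = 0).
  { intros t; apply fourier_unique_R with (g := fun t => Im (h t)).
    - intros u; exact (proj2 (Hh u)).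
    - intros u; unfold h; now rewrite Pf, Pg.
    - intros k; rewrite (fc_ext _ (fun t => (/ (2 * Ci)) * (h t - Cconj (h t)))%C).
      + rewrite fc_scal, fc_minus, Hh0, Hcj by ccont_tac; ring.
      + intros u _; rewrite im_alt; field.
        intros E; apply (f_equal Im) in E; unfold Im in E; simpl in E; lra. }
  intros t; apply Cmod_minus_eq_0; change (f t - g t)%C with (h t).
  replace (h t) with (RtoC 0); [apply Cmod_0|].
  symmetry; apply C_eq; [apply HR|apply HI].
Qed.

(** The sum of the series is continuous with the same coefficients as [f], so uniqueness identifies
    the two; absolute summability gives uniform convergence. *)
Lemma fourier_series (f : R -> C) (sg : nat -> Z) :
  ccont f -> (forall t, f (t + 2 * PI) = f t) ->
  (forall i j, sg i = sg j -> i = j) ->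
  (forall m, (forall k, sg k <> m) -> fc f m = RtoC 0) ->
  ex_series (fun k => Cmod (fc f (sg k))) ->
  (forall t, f t = tsum (fun k => fc f (sg k)) sg t) /\
  ulim (psum (fun k => fc f (sg k)) sg) f.
Proof.
  intros Hf Pf Hsg H0 Hs.
  assert (E : forall t, f t = tsum (fun k => fc f (sg k)) sg t).
  { apply fourier_unique; auto.
    - now apply ccont_tsum.
    - intros t; apply tsum_periodic.
    - intros m.
      destruct (fc_series_coef _ _ sg (ccont_tsum _ sg Hs) (ulim_tsum _ sg Hs) Hsg) as [H1 H2].
      destruct (classic (exists k, sg k = m)) as [[k <-]|Hn].
      + now rewrite H1.
      + rewrite H0, H2; auto; intros k Hk; apply Hn; now exists k. }
  split; [exact E|].
  destruct (ulim_tsum _ sg Hs) as [e [He Hb]].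
  exists e; split; [assumption|]; intros n t Ht; rewrite E; auto.
Qed.

(** In the Bessel identity the remainder tends to zero uniformly, hence in mean square. *)
Lemma parseval (f : R -> C) (sg : nat -> Z) :
  ccont f -> (forall i j, sg i = sg j -> i = j) ->
  ulim (psum (fun k => fc f (sg k)) sg) f ->
  is_lim_seq (sum_n (fun k => Cmod (fc f (sg k)) ^ 2)) (nsq f).
Proof.
  intros Hf Hsg [e [He Hb]].
  assert (H : is_lim_seq (fun n => nsq (fun t => f t - psum (fun k => fc f (sg k)) sg n t)%C) 0).
  { apply lim_squeeze_0 with (fun n => e n * e n).
    - intros n; assert (He0 := ulim_bound_nonneg _ _ _ n Hb).
      assert (Hc : ccont (fun t => f t - psum (fun k => fc f (sg k)) sg n t)%C)
        by (apply ccont_minus; [assumption|apply ccont_psum]).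
      split; [now apply nsq_ge_0|].
      replace (e n * e n) with (e n ^ 2) by ring.
      apply nsq_bound; auto; intros t Ht; rewrite Cmod_minus_sym; auto.
    - replace (Finite 0) with (Finite (0 * 0)) by (f_equal; ring).
      now apply is_lim_seq_mult'. }
  apply is_lim_seq_ext with
    (fun n => nsq f - nsq (fun t => f t - psum (fun k => fc f (sg k)) sg n t)%C).
  - intros n; rewrite <- (Rplus_0_r (sum_n _ n)).
    unfold psum; rewrite (bessel_eq f sg n Hf Hsg); simpl; ring.
  - replace (Finite (nsq f)) with (Finite (nsq f - 0)) by (f_equal; ring).
    apply is_lim_seq_minus'; [apply is_lim_seq_const|exact H].
Qed.

(** * Functions analytic in the disc, and their exponentials *)

Definition polar (G : C -> C) (s t : R) : C := G (s * cis t)%C.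

(** A substitute for holomorphy on the circles whose radii satisfy [P]: [g] does not depend on the
    radius, so it plays the role of the Laurent coefficients. *)
Definition laurent_on (P : R -> Prop) (G : C -> C) (g : Z -> C) : Prop :=
  forall s, P s -> ccont (polar G s) /\
    forall m, fc (polar G s) m = (RtoC (powerRZ s m) * g m)%C.

Definition disc_analytic (G : C -> C) (g : Z -> C) : Prop :=
  laurent_on (fun s => 0 < s < 1) G g /\ forall m, (m < 0)%Z -> g m = RtoC 0.

Lemma polar_periodic (G : C -> C) (s t : R) : polar G s (t + 2 * PI) = polar G s t.
Proof. unfold polar; rewrite <- !ek_1; now rewrite cis_2PI. Qed.

Lemma powerRZ_pos (s : R) (m : Z) : 0 < s -> 0 < powerRZ s m.
Proof. intros Hs; now apply powerRZ_lt. Qed.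

Lemma ex_series_geom_bound (u : nat -> C) (B q : R) :
  0 <= q < 1 -> (forall k, Cmod (u k) <= B * q ^ k) -> ex_series (fun k => Cmod (u k)).
Proof.
  intros Hq H; apply (ex_series_le (V := R_CompleteNormedModule) _ (fun k => B * q ^ k)).
  - intros k; change (norm (Cmod (u k))) with (Rabs (Cmod (u k))).
    rewrite Rabs_pos_eq by apply Cmod_ge_0; apply H.
  - apply (ex_series_scal_l (K := R_AbsRing) B (fun k => q ^ k)), ex_series_geom.
    rewrite Rabs_pos_eq; lra.
Qed.

(** Abel's lemma: bounded terms at radius [y] give geometric decay with ratio x / y at a smaller
    radius [x]. *)
Lemma ex_series_root (u : nat -> C) (x y B : R) :
  0 < x < y -> (forall k, y ^ k * Cmod (u k) <= B) ->
  ex_series (fun k => Cmod (RtoC (x ^ k) * u k)%C).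
Proof.
  intros Hxy H; apply (ex_series_geom_bound _ B (x / y)).
  - split; [apply Rlt_le, Rdiv_lt_0_compat; lra|].
    apply Rmult_lt_reg_r with y; [lra|]; replace (x / y * y) with x by (field; lra); lra.
  - intros k; rewrite Cmod_mult, Cmod_R, Rabs_pos_eq by (apply pow_le; lra).
    unfold Rdiv; rewrite Rpow_mult_distr, pow_inv.
    assert (Hp : 0 < y ^ k) by (apply pow_lt; lra).
    replace (x ^ k * Cmod (u k)) with (x ^ k * / y ^ k * (y ^ k * Cmod (u k))) by (field; lra).
    rewrite (Rmult_comm B); apply Rmult_le_compat_l; [|apply H].
    apply Rmult_le_pos; [apply pow_le|apply Rlt_le, Rinv_0_lt_compat]; lra.
Qed.

(** Cauchy's estimate, read off from the maximum on the circle. *)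
Lemma laurent_coef_bound (P : R -> Prop) (G : C -> C) (g : Z -> C) (s : R) :
  laurent_on P G g -> P s -> 0 < s ->
  exists B, 0 <= B /\ forall m, powerRZ s m * Cmod (g m) <= B.
Proof.
  intros HG Ps Hs; destruct (HG s Ps) as [Hc Hf].
  destruct (ccont_bounded _ Hc) as [B [HB Hb]]; exists B; split; [assumption|].
  intros m; replace (powerRZ s m * Cmod (g m)) with (Cmod (fc (polar G s) m)).
  - now apply Cmod_fc_le.
  - rewrite Hf, Cmod_mult, Cmod_R, Rabs_pos_eq; [reflexivity|].
    now apply Rlt_le, powerRZ_pos.
Qed.

Lemma disc_summable (G : C -> C) (g : Z -> C) (s : R) :
  disc_analytic G g -> 0 < s < 1 ->
  ex_series (fun k => Cmod (RtoC (s ^ k) * g (Z.of_nat k))%C).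
Proof.
  intros [HG _] Hs; set (s' := (1 + s) / 2).
  assert (Hs' : 0 < s' < 1) by (unfold s'; lra).
  destruct (laurent_coef_bound _ _ _ s' HG Hs' (proj1 Hs')) as [B [HB Hb]].
  apply (ex_series_root _ s s' B); [unfold s'; lra|].
  intros k; specialize (Hb (Z.of_nat k)); now rewrite <- pow_powerRZ in Hb.
Qed.

Lemma disc_series (G : C -> C) (g : Z -> C) (s : R) :
  disc_analytic G g -> 0 < s < 1 ->
  ulim (psum (fun k => RtoC (s ^ k) * g (Z.of_nat k))%C Z.of_nat) (polar G s).
Proof.
  intros HG Hs; assert (Hsum := disc_summable G g s HG Hs).
  destruct HG as [HG HG0]; destruct (HG s Hs) as [Hc Hf].
  assert (E : forall k, fc (polar G s) (Z.of_nat k) = (RtoC (s ^ k) * g (Z.of_nat k))%C)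
    by (intros k; now rewrite Hf, <- pow_powerRZ).
  destruct (fourier_series (polar G s) Z.of_nat) as [_ [e [He Hb]]]; auto.
  - intros t; apply polar_periodic.
  - intros i j; lia.
  - intros m Hm; rewrite Hf, HG0; [ring|].
    destruct (Z_lt_le_dec m 0) as [H|H]; [assumption|].
    exfalso; apply (Hm (Z.to_nat m)); lia.
  - eapply ex_series_ext; [|exact Hsum]; intros k; simpl; now rewrite E.
  - exists e; split; [assumption|]; intros n t Ht.
    rewrite <- (Hb n t Ht) at 1; right; f_equal; f_equal.
    unfold psum; apply sum_n_ext; intros k; now rewrite E.
Qed.

Lemma laurent_ext (P : R -> Prop) (G H : C -> C) (g : Z -> C) :
  (forall s t, P s -> G (s * cis t)%C = H (s * cis t)%C) -> laurent_on P G g -> laurent_on P H g.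
Proof.
  intros E HG s Ps; destruct (HG s Ps) as [H1 H2].
  assert (E' : forall t, polar G s t = polar H s t) by (intros t; now apply E).
  split; [now apply (ccont_ext (polar G s))|].
  intros m; rewrite <- H2; apply fc_ext; intros t _; now rewrite E'.
Qed.

Lemma powerRZ_minus_C (s : R) (m k : Z) : s <> 0 ->
  (RtoC (powerRZ s k) * RtoC (powerRZ s (m - k)))%C = RtoC (powerRZ s m).
Proof.
  intros Hs; rewrite <- RtoC_mult, <- powerRZ_add by assumption; do 2 f_equal; lia.
Qed.

(** The radii cancel in the convolution, because s^k s^{m-k} = s^m. The resulting sum is free of s,
    so coefficients computed at the reference radius [s0] are valid at all others. *)
Lemma laurent_mult (P : R -> Prop) (s0 : R) (G H : C -> C) (g h : Z -> C) :
  (forall s, P s -> 0 < s < 1) -> P s0 -> laurent_on P G g -> disc_analytic H h ->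
  exists z, laurent_on P (fun x => G x * H x)%C z /\
    forall m, Clim (sum_n (fun k => h (Z.of_nat k) * g (m - Z.of_nat k)%Z)%C) (z m).
Proof.
  intros HP Ps0 HG HH.
  (* After division by s^m the limit is one and the same sequence for every radius. *)
  assert (L : forall s m, P s ->
    Clim (sum_n (fun k => h (Z.of_nat k) * g (m - Z.of_nat k)%Z)%C)
      (RtoC (/ powerRZ s m) * fc (polar (fun x => G x * H x) s) m)%C).
  { intros s m Ps; destruct (HP s Ps) as [Hs0 Hs1]; destruct (HG s Ps) as [Hc Hf].
    assert (Hne : powerRZ s m <> 0) by (apply Rgt_not_eq, powerRZ_pos; lra).
    eapply Clim_ext; [|apply Clim_scal;
      apply (fc_mult_series (polar G s) (polar H s)
        (fun k => RtoC (s ^ k) * h (Z.of_nat k))%C Z.of_nat m Hc);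
      [apply HH; lra|apply disc_series; [exact HH|lra]]].
    intros n; simpl; rewrite <- sum_n_C_mult_l; apply sum_n_ext; intros k; Ceq.
    rewrite Hf.
    transitivity (RtoC (/ powerRZ s m) * (RtoC (s ^ k) * RtoC (powerRZ s (m - Z.of_nat k)))
      * (h (Z.of_nat k) * g (m - Z.of_nat k)%Z))%C; [ring|].
    rewrite pow_powerRZ, powerRZ_minus_C by lra.
    rewrite <- RtoC_mult, Rinv_l by assumption; ring. }
  exists (fun m => RtoC (/ powerRZ s0 m) * fc (polar (fun x => G x * H x) s0) m)%C.
  split; [|intros m; now apply L].
  intros s Ps; split.
  - apply (ccont_mult (polar G s) (polar H s)); [now apply HG|apply HH, HP, Ps].
  - intros m; rewrite (Clim_unique _ _ _ (L s0 m Ps0) (L s m Ps)).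
    rewrite Cmult_assoc, <- RtoC_mult, Rinv_r; [ring|].
    apply Rgt_not_eq, powerRZ_pos, (HP s Ps).
Qed.

Lemma disc_mult (G H : C -> C) (g h : Z -> C) :
  disc_analytic G g -> disc_analytic H h ->
  exists z, disc_analytic (fun x => G x * H x)%C z /\ z 0%Z = (g 0%Z * h 0%Z)%C.
Proof.
  intros [HG HG0] HH.
  destruct (laurent_mult (fun s => 0 < s < 1) (1 / 2) G H g h) as [z [Hz Lz]]; auto; [lra|].
  exists z; split; [split; [exact Hz|]|].
  - intros m Hm; apply Clim_sum_zero with (2 := Lz m); intros k.
    rewrite (HG0 (m - _)%Z) by lia; ring.
  - rewrite (Clim_sum_single _ _ O) with (2 := Lz 0%Z); [simpl; ring|].
    intros k Hk; rewrite (HG0 (0 - _)%Z) by lia; ring.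
Qed.

Lemma disc_const (c : C) :
  disc_analytic (fun _ => c) (fun m => if Z.eqb m 0 then c else RtoC 0).
Proof.
  split.
  - intros s Hs; split; [apply ccont_const|].
    intros m; unfold polar; rewrite fc_const.
    destruct (Z.eqb_spec m 0) as [->|]; simpl; ring.
  - intros m Hm; destruct (Z.eqb_spec m 0); [lia|reflexivity].
Qed.

Lemma disc_affine (c d : C) (G : C -> C) (g : Z -> C) :
  disc_analytic G g ->
  disc_analytic (fun x => c + d * G x)%C
    (fun m => (if Z.eqb m 0 then c else RtoC 0) + d * g m)%C.
Proof.
  intros [HG HG0]; split.
  - intros s Hs; destruct (HG s Hs) as [Hc Hf].
    assert (Hcd : ccont (fun t => c + d * polar G s t)%C) by ccont_tac.
    split; [exact Hcd|]; intros m.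
    change (polar (fun x => c + d * G x)%C s) with (fun t => c + d * polar G s t)%C.
    rewrite (fc_plus (fun _ => c)), fc_scal, Hf, fc_const by ccont_tac.
    destruct (Z.eqb_spec m 0) as [->|]; simpl; ring.
  - intros m Hm; rewrite HG0 by assumption.
    destruct (Z.eqb_spec m 0); [lia|ring].
Qed.

Lemma disc_pow (G : C -> C) (g : Z -> C) (n : nat) :
  disc_analytic G g ->
  exists z, disc_analytic (fun x => G x ^ n)%C z /\ z 0%Z = (g 0%Z ^ n)%C.
Proof.
  intros HG; induction n as [|n [z [Hz Ez]]].
  - eexists; split; [apply (disc_const (RtoC 1))|reflexivity].
  - destruct (disc_mult _ _ _ _ HG Hz) as [z' [Hz' Ez']].
    exists z'; split; [exact Hz'|]; rewrite Ez', Ez, Cpow_S; reflexivity.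
Qed.

(** * The complex exponential and Euler's limit *)

Lemma exp_monotone (x y : R) : x <= y -> exp x <= exp y.
Proof. intros [H|H]; [now apply Rlt_le, exp_increasing|rewrite H; apply Rle_refl]. Qed.

Lemma Cexp_add (x y : C) : Cexp (x + y)%C = (Cexp x * Cexp y)%C.
Proof.
  unfold Cexp; change (Re (x + y)%C) with (Re x + Re y); change (Im (x + y)%C) with (Im x + Im y).
  rewrite exp_plus, cis_add, RtoC_mult; ring.
Qed.

Lemma Cexp_0 : Cexp (RtoC 0) = RtoC 1.
Proof. unfold Cexp; simpl; rewrite exp_0, cis_0; ring. Qed.

Lemma Cexp_opp (z : C) : (Cexp (- z) * Cexp z)%C = RtoC 1.
Proof. rewrite <- Cexp_add, <- Cexp_0; f_equal; ring. Qed.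

Lemma Cexp_neq_0 (z : C) : Cexp z <> RtoC 0.
Proof.
  intros E; generalize (Cexp_opp z); rewrite E, Cmult_0_r; intros H.
  apply RtoC_inj in H; lra.
Qed.

Lemma Cexp_conj (z : C) : Cexp (Cconj z) = Cconj (Cexp z).
Proof.
  unfold Cexp; rewrite Cmult_conj, cis_conj, re_conj, im_conj; f_equal.
  apply C_eq; simpl; ring.
Qed.

Lemma Cmod_Cexp (z : C) : Cmod (Cexp z) = exp (Re z).
Proof.
  unfold Cexp; rewrite Cmod_mult, Cmod_cis, Cmod_R, Rabs_pos_eq; [ring|].
  apply Rlt_le, exp_pos.
Qed.

Lemma Cexp_pow (z : C) (n : nat) : (Cexp z ^ n)%C = Cexp (RtoC (INR n) * z)%C.
Proof.
  induction n as [|n IH].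
  - simpl; rewrite <- Cexp_0; f_equal; ring.
  - rewrite Cpow_S, IH, <- Cexp_add, S_INR, RtoC_plus; f_equal; ring.
Qed.

(** Both sides come from 1 + x <= exp x, applied at x and at -x. *)
Lemma exp_taylor1 (x : R) : Rabs x <= 1 / 2 -> Rabs (exp x - 1 - x) <= 2 * x ^ 2.
Proof.
  intros Hx; apply Rabs_le_between in Hx.
  assert (H1 := exp_ineq1_le x); assert (H2 := exp_ineq1_le (- x)).
  rewrite exp_Ropp in H2.
  assert (Hp := exp_pos x).
  apply Rmult_le_compat_r with (r := exp x) in H2; [|lra].
  rewrite Rinv_l in H2 by lra.
  rewrite Rabs_pos_eq by lra; nra.
Qed.

Lemma cos_taylor1 (y : R) : Rabs (cos y - 1) <= y ^ 2 / 2.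
Proof.
  replace (cos y) with (cos (2 * (y / 2))) by (f_equal; field).
  rewrite cos_2a_sin.
  replace (1 - 2 * sin (y / 2) * sin (y / 2) - 1) with (- (2 * (sin (y / 2)) ^ 2)) by ring.
  rewrite Rabs_Ropp, Rabs_pos_eq by nra.
  destruct (MVT_gen sin 0 (y / 2) cos) as [x [_ Ex]].
  - intros x _; auto_derive; [exact I|ring].
  - intros x _; apply continuity_sin.
  - rewrite sin_0, !Rminus_0_r in Ex; rewrite Ex, Rpow_mult_distr.
    assert (Hc := COS_bound x); assert (H : cos x ^ 2 <= 1) by nra.
    assert (Hy := pow2_ge_0 (y / 2)); nra.
Qed.

Lemma sin_taylor1 (y : R) : Rabs y <= 1 / 2 -> Rabs (sin y - y) <= y ^ 2.
Proof.
  intros Hy.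
  destruct (MVT_gen (fun u => sin u - u) 0 y (fun u => cos u - 1)) as [c [Hc Ec]].
  - intros x _; auto_derive; [exact I|ring].
  - intros x _; apply continuity_pt_filterlim.
    apply (ex_derive_continuous (V := R_NormedModule) (fun u => sin u - u)).
    auto_derive; exact I.
  - rewrite sin_0, !Rminus_0_r in Ec; rewrite Ec, Rabs_mult.
    assert (Hcy : Rabs c <= Rabs y).
    { revert Hc; unfold Rmin, Rmax; destruct (Rle_dec 0 y); intros Hc;
        unfold Rabs; repeat destruct Rcase_abs; lra. }
    assert (H := cos_taylor1 c).
    assert (H2 : c ^ 2 <= y ^ 2).
    { rewrite <- !Rsqr_pow2; now apply Rsqr_le_abs_1. }
    assert (H3 : y ^ 2 = Rabs y ^ 2) by (now rewrite pow2_abs).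
    assert (H4 := Rabs_pos y); rewrite H3 in *; nra.
Qed.

Lemma Cexp_taylor1 (z : C) : Cmod z <= 1 / 2 -> Cmod (Cexp z - 1 - z)%C <= 4 * Cmod z ^ 2.
Proof.
  intros Hz; destruct z as [x y].
  assert (Hx : Rabs x <= 1 / 2).
  { eapply Rle_trans; [apply (re_le_Cmod (x, y))|exact Hz]. }
  assert (Hy : Rabs y <= 1 / 2).
  { eapply Rle_trans; [apply (im_le_Cmod (x, y))|exact Hz]. }
  rewrite Cmod2_alt; eapply Rle_trans; [apply Cmod_le_Re_Im|].
  unfold Cexp, cis, Re, Im; simpl fst; simpl snd.
  assert (E := exp_taylor1 x Hx); assert (Cs := cos_taylor1 y); assert (Sn := sin_taylor1 y Hy).
  replace (exp x * cos y - 0 * sin y + - (1) + - x)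
    with ((exp x - 1 - x) * cos y + (1 + x) * (cos y - 1)) by ring.
  replace (exp x * sin y + 0 * cos y + - 0 + - y)
    with ((exp x - 1 - x) * sin y + (x * sin y + (sin y - y))) by ring.
  assert (Hcos : Rabs (cos y) <= 1) by (apply Rabs_le, COS_bound).
  assert (Hsin : Rabs (sin y) <= 3 / 2 * Rabs y).
  { replace (sin y) with (sin y - y + y) by ring.
    eapply Rle_trans; [apply Rabs_triang|].
    assert (y ^ 2 = Rabs y ^ 2) by (now rewrite pow2_abs); assert (H4 := Rabs_pos y); nra. }
  assert (H1x : Rabs (1 + x) <= 3 / 2).
  { apply Rabs_le_between in Hx; apply Rabs_le; lra. }
  assert (A : Rabs ((exp x - 1 - x) * cos y + (1 + x) * (cos y - 1)) <= 2 * x ^ 2 + 3 / 4 * y ^ 2).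
  { eapply Rle_trans; [apply Rabs_triang|]; rewrite !Rabs_mult.
    assert (P1 := Rabs_pos (exp x - 1 - x)); assert (P2 := Rabs_pos (cos y - 1)).
    assert (P3 := Rabs_pos (cos y)); assert (P4 := Rabs_pos (1 + x)); nra. }
  assert (B : Rabs ((exp x - 1 - x) * sin y + (x * sin y + (sin y - y)))
     <= 2 * x ^ 2 * (3 / 4) + (Rabs x * (3 / 2 * Rabs y) + y ^ 2)).
  { eapply Rle_trans; [apply Rabs_triang|]; apply Rplus_le_compat.
    - rewrite Rabs_mult; apply Rmult_le_compat; try apply Rabs_pos; [assumption|lra].
    - eapply Rle_trans; [apply Rabs_triang|]; apply Rplus_le_compat; [|assumption].
      rewrite Rabs_mult; apply Rmult_le_compat_l; [apply Rabs_pos|assumption]. }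
  eapply Rle_trans; [apply Rplus_le_compat; [exact A|exact B]|].
  rewrite <- (pow2_abs x), <- (pow2_abs y).
  assert (P1 := Rabs_pos x); assert (P2 := Rabs_pos y).
  assert (P3 := pow2_ge_0 (Rabs x - Rabs y)); nra.
Qed.

Lemma Cpow_diff_bound (a b : C) (M : R) (n : nat) :
  0 <= M -> Cmod a <= M -> Cmod b <= M ->
  Cmod (a ^ S n - b ^ S n)%C <= INR (S n) * Cmod (a - b)%C * M ^ n.
Proof.
  intros HM Ha Hb; induction n as [|n IH].
  - simpl; rewrite !Cmult_1_r; lra.
  - replace (a ^ S (S n) - b ^ S (S n))%C
      with (a * (a ^ S n - b ^ S n) + (a - b) * b ^ S n)%C by (rewrite !Cpow_S; ring).
    eapply Rle_trans; [apply Cmod_triangle|]; rewrite !Cmod_mult, Cmod_pow.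
    rewrite (S_INR (S n)).
    assert (H1 : Cmod b ^ S n <= M ^ S n) by (apply pow_incr; split; [apply Cmod_ge_0|assumption]).
    assert (H2 : Cmod a * Cmod (a ^ S n - b ^ S n)%C
       <= M * (INR (S n) * Cmod (a - b)%C * M ^ n))
      by (apply Rmult_le_compat; auto using Cmod_ge_0).
    assert (H3 : Cmod (a - b)%C * Cmod b ^ S n <= Cmod (a - b)%C * M ^ S n)
      by (apply Rmult_le_compat_l; auto using Cmod_ge_0).
    replace ((INR (S n) + 1) * Cmod (a - b)%C * M ^ S n)
      with (M * (INR (S n) * Cmod (a - b)%C * M ^ n) + Cmod (a - b)%C * M ^ S n)
      by (simpl pow; ring).
    lra.
Qed.

Lemma exp_INR_mult (x : R) (n : nat) : exp (INR n * x) = exp x ^ n.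
Proof.
  induction n as [|n IH]; [simpl; rewrite Rmult_0_l; apply exp_0|].
  rewrite S_INR, Rmult_plus_distr_r, exp_plus, IH, Rmult_1_l; simpl; ring.
Qed.

(** Write exp z as the N-th power of exp(z / N). The bases 1 + z / N and exp(z / N) differ by O(1 /
    N^2), and telescoping the N-th powers costs a factor N. *)
Lemma euler_bound (z : C) (K : R) (n : nat) :
  Cmod z <= K -> 2 * K <= INR (S n) ->
  Cmod ((1 + / RtoC (INR (S n)) * z) ^ S n - Cexp z)%C <= 4 * K ^ 2 * exp K / INR (S n).
Proof.
  intros Hz HN; set (N := INR (S n)) in *.
  assert (HN0 : 0 < N) by (apply lt_0_INR; lia).
  assert (HK : 0 <= K) by (eapply Rle_trans; [apply Cmod_ge_0|exact Hz]).
  assert (HNC : RtoC N <> RtoC 0) by (apply RtoC_neq_0; lra).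
  set (u := (/ RtoC N * z)%C).
  assert (Hu : Cmod u <= K / N).
  { unfold u; rewrite Cmod_mult, Cmod_inv, Cmod_R, Rabs_pos_eq by (lra || assumption).
    rewrite Rmult_comm; apply Rmult_le_compat_r; [apply Rlt_le; now apply Rinv_0_lt_compat|lra]. }
  assert (Hu2 : Cmod u <= 1 / 2).
  { eapply Rle_trans; [exact Hu|]; apply Rmult_le_reg_r with N; [assumption|].
    replace (K / N * N) with K by (field; lra); lra. }
  replace (Cexp z) with (Cexp u ^ S n)%C.
  2:{ rewrite Cexp_pow; f_equal; unfold u; fold N; field; assumption. }
  rewrite Cmod_minus_sym.
  assert (Ma : Cmod (Cexp u) <= exp (K / N)).
  { rewrite Cmod_Cexp; apply exp_monotone.
    eapply Rle_trans; [|exact Hu]; eapply Rle_trans; [apply Rle_abs|apply re_le_Cmod]. }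
  assert (Mb : Cmod (1 + u)%C <= exp (K / N)).
  { eapply Rle_trans; [apply Cmod_triangle|]; rewrite Cmod_1.
    eapply Rle_trans; [|apply exp_ineq1_le]; lra. }
  eapply Rle_trans; [apply (Cpow_diff_bound _ _ (exp (K / N))); auto; apply Rlt_le, exp_pos|].
  fold N.
  assert (H1 : Cmod (Cexp u - (1 + u))%C <= 4 * (K / N) ^ 2).
  { replace (Cexp u - (1 + u))%C with (Cexp u - 1 - u)%C by ring.
    eapply Rle_trans; [now apply Cexp_taylor1|].
    apply Rmult_le_compat_l; [lra|]; apply pow_incr; split; [apply Cmod_ge_0|assumption]. }
  assert (H2 : exp (K / N) ^ n <= exp K).
  { rewrite <- exp_INR_mult; apply exp_monotone.
    apply Rmult_le_reg_r with N; [assumption|].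
    replace (INR n * (K / N) * N) with (K * INR n) by (field; lra).
    apply Rmult_le_compat_l; [assumption|]; unfold N; rewrite S_INR; lra. }
  replace (4 * K ^ 2 * exp K / N) with (N * (4 * (K / N) ^ 2) * exp K) by (field; lra).
  apply Rmult_le_compat; auto.
  - apply Rmult_le_pos; [lra|apply Cmod_ge_0].
  - apply pow_le, Rlt_le, exp_pos.
  - apply Rmult_le_compat_l; lra.
Qed.

Lemma lim_div_INR (c : R) : is_lim_seq (fun n => c / INR (S n)) 0.
Proof.
  apply lim_scal_0; apply (is_lim_seq_incr_1 (fun n => / INR n)).
  replace (Finite 0) with (Rbar_inv p_infty) by reflexivity.
  apply is_lim_seq_inv; [apply is_lim_seq_INR|discriminate].
Qed.

Lemma ccont_Cexp (f : R -> C) : ccont f -> ccont (fun t => Cexp (f t)).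
Proof.
  intros Hf t; destruct (Hf t) as [H1 H2].
  assert (E : continuous (fun u => exp (Re (f u))) t).
  { apply (continuous_comp (fun u => Re (f u)) exp); [exact H1|].
    apply (ex_derive_continuous (V := R_NormedModule)); auto_derive; exact I. }
  assert (Cs : continuous (fun u => cos (Im (f u))) t).
  { apply (continuous_comp (fun u => Im (f u)) cos); [exact H2|apply continuous_cos]. }
  assert (Sn : continuous (fun u => sin (Im (f u))) t).
  { apply (continuous_comp (fun u => Im (f u)) sin); [exact H2|apply continuous_sin]. }
  split.
  - apply (continuous_ext (fun u => exp (Re (f u)) * cos (Im (f u)))).
    + intros x; unfold Cexp, cis, Re, Im; simpl; ring.
    + exact (continuous_mult (K := R_AbsRing) _ _ _ E Cs).
  - apply (continuous_ext (fun u => exp (Re (f u)) * sin (Im (f u)))).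
    + intros x; unfold Cexp, cis, Re, Im; simpl; ring.
    + exact (continuous_mult (K := R_AbsRing) _ _ _ E Sn).
Qed.

Lemma ccont_pow (f : R -> C) (n : nat) : ccont f -> ccont (fun t => f t ^ n)%C.
Proof.
  intros Hf; induction n as [|n IH].
  - apply (ccont_const (RtoC 1)).
  - exact (ccont_mult f (fun t => f t ^ n)%C Hf IH).
Qed.

Lemma Clim_incr_n (u : nat -> C) (l : C) (N : nat) :
  Clim (fun n => u (n + N)%nat) l -> Clim u l.
Proof. intros H; exact (proj2 (is_lim_seq_incr_n (fun n => Cmod (u n - l)%C) N 0) H). Qed.

Lemma fc_Cexp_lim (f : R -> C) (m : Z) :
  ccont f ->
  Clim (fun n => fc (fun t => (1 + / RtoC (INR (S n)) * f t) ^ S n)%C m)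
       (fc (fun t => Cexp (f t)) m).
Proof.
  intros Hf; destruct (ccont_bounded f Hf) as [K [HK Hb]].
  (* Euler's estimate requires 2 K <= n + 1, so the first [N] indices are skipped. *)
  destruct (INR_unbounded (2 * K)) as [N HN].
  apply (Clim_incr_n _ _ N).
  apply (fc_ulim (fun n t => (1 + / RtoC (INR (S (n + N))) * f t) ^ S (n + N))%C).
  - intros n; apply (ccont_pow (fun t => 1 + / RtoC (INR (S (n + N))) * f t)%C); ccont_tac.
  - now apply ccont_Cexp.
  - exists (fun n => 4 * K ^ 2 * exp K / INR (S (n + N))); split.
    + apply (is_lim_seq_incr_n (fun n => 4 * K ^ 2 * exp K / INR (S n)) N 0), lim_div_INR.
    + intros n t Ht; apply euler_bound; [now apply Hb|].
      apply Rlt_le, Rlt_le_trans with (INR N); [assumption|apply le_INR; lia].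
Qed.

(** Exp of an analytic function is the uniform limit on circles of the polynomials (1 + G / N)^N,
    whose coefficients scale correctly by closure under products. Scaling, vanishing at negative
    indices and the value at index 0 all pass to the limit. *)
Lemma disc_exp (G : C -> C) (g : Z -> C) :
  disc_analytic G g ->
  exists z, disc_analytic (fun x => Cexp (G x)) z /\ z 0%Z = Cexp (g 0%Z).
Proof.
  intros HG.
  assert (L : forall s m, 0 < s < 1 ->
    Clim (fun n => fc (fun t => (1 + / RtoC (INR (S n)) * polar G s t) ^ S n)%C m)
       (fc (polar (fun x => Cexp (G x)) s) m)).
  { intros s m Hs; apply (fc_Cexp_lim (polar G s)); now apply HG. }
  assert (Q : forall n, exists z,
    disc_analytic (fun x => (1 + / RtoC (INR (S n)) * G x) ^ S n)%C z /\
    z 0%Z = ((1 + / RtoC (INR (S n)) * g 0%Z) ^ S n)%C).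
  { intros n; exact (disc_pow _ _ (S n) (disc_affine (RtoC 1) (/ RtoC (INR (S n))) G g HG)). }
  (* The radius 1/2 is arbitrary; the first goal shows that the coefficients do not depend on it. *)
  set (z := fun m => (RtoC (/ powerRZ (1 / 2) m)
              * fc (polar (fun x => Cexp (G x)) (1 / 2)) m)%C).
  assert (Hh : 0 < 1 / 2 < 1) by lra.
  exists z; split; [split|].
  - intros s Hs; split; [apply ccont_Cexp; now apply HG|].
    intros m; eapply Clim_unique; [now apply L|].
    unfold z; rewrite Cmult_assoc; eapply Clim_ext; [|apply Clim_scal, L, Hh].
    intros n; destruct (Q n) as [y [[Hy _] _]]; simpl.
    destruct (Hy _ Hs) as [_ F1]; destruct (Hy _ Hh) as [_ F2].
    unfold polar in F1, F2; unfold polar; rewrite F1, F2.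
    Ceq; rewrite RtoC_inv by (apply Rgt_not_eq, powerRZ_pos; lra); field.
    apply RtoC_neq_0, Rgt_not_eq, powerRZ_pos; lra.
  - intros m Hm; unfold z.
    replace (fc (polar (fun x => Cexp (G x)) (1 / 2)) m) with (RtoC 0); [ring|].
    eapply Clim_unique; [|now apply L].
    apply (Clim_ext (fun _ => RtoC 0)); [|apply Clim_const].
    intros n; destruct (Q n) as [y [[Hy Hy0] _]]; destruct (Hy _ Hh) as [_ F2].
    unfold polar in F2; unfold polar; rewrite F2, Hy0 by assumption; ring.
  - unfold z.
    replace (fc (polar (fun x => Cexp (G x)) (1 / 2)) 0) with (Cexp (g 0%Z)).
    + simpl; rewrite Rinv_1; ring.
    + eapply Clim_unique; [|now apply L].
      apply (Clim_ext (fun n => (1 + / RtoC (INR (S n)) * g 0%Z) ^ S n)%C).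
      * intros n; destruct (Q n) as [y [[Hy _] Hy0]]; destruct (Hy _ Hh) as [_ F2].
        unfold polar in F2; unfold polar; rewrite F2, Hy0; simpl powerRZ.
        rewrite Cmult_1_l; reflexivity.
      (* Euler's limit for the number g_0 is the same lemma applied to a constant function. *)
      * assert (F := fc_Cexp_lim (fun _ => g 0%Z) 0 (ccont_const _)).
        cbv beta in F; rewrite fc_const in F; eapply Clim_ext; [|exact F].
        intros n; cbv beta; rewrite fc_const; reflexivity.
Qed.

(** * Herglotz transforms, the exponents of the Szego functions *)

Definition herglotz_transform (g : R -> R) (z : C) : C :=
  (/ 2 * mean (fun t => RtoC (g t) * herglotz z t))%C.

(** The factor 1/2 turns the 1 / (2 pi) of [mean] into the 1 / (4 pi) of the Szego integral. It
    halves the constant term; for m > 0 it cancels the 2 in [hg]. *)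
Definition herglotz_coef (g : R -> R) (m : Z) : C :=
  if Z.ltb m 0 then RtoC 0
  else (/ 2 * hg (Z.to_nat m) * fc (fun t => RtoC (g t)) m)%C.

(** Integrating the partial sums of the kernel against [g] gives the partial sums of a power series
    in z; the kernel error depends on |z| only, so convergence is uniform on each circle. *)
Lemma disc_herglotz (g : R -> R) :
  (forall t, continuous g t) ->
  disc_analytic (herglotz_transform g) (herglotz_coef g).
Proof.
  intros Hg; assert (Hcg := ccont_RtoC g Hg).
  split.
  2:{ intros m Hm; unfold herglotz_coef; destruct (Z.ltb_spec m 0); [reflexivity|lia]. }
  intros s Hs.
  destruct (ccont_bounded _ Hcg) as [B [HB Hb]].
  set (u := fun k => (RtoC (s ^ k) * herglotz_coef g (Z.of_nat k))%C).
  assert (Hbd : forall n th, Cmod (psum u Z.of_nat n th - polar (herglotz_transform g) s th)%C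
     <= / 2 * (B * (2 / (1 - s))) * s ^ S n).
  { intros n th.
    assert (Hz : Cmod (s * cis th)%C < 1) by (rewrite Cmod_scis; lra).
    assert (HH := ccont_herglotz _ (Rlt_not_eq _ _ Hz)).
    assert (Hps := ccont_psum (fun k => hg k * (s * cis th) ^ k)%C (fun k => (- Z.of_nat k)%Z) n).
    replace (psum u Z.of_nat n th) with (/ 2 * fc (fun t => RtoC (g t) *
      psum (fun k => hg k * (s * cis th) ^ k)%C (fun k => (- Z.of_nat k)%Z) n t)%C 0)%C.
    - unfold polar, herglotz_transform; rewrite mean_fc.
      replace (/ 2 * fc (fun t => RtoC (g t) *
            psum (fun k => hg k * (s * cis th) ^ k)%C (fun k => (- Z.of_nat k)%Z) n t)%C 0
          - / 2 * fc (fun t => RtoC (g t) * herglotz (s * cis th) t)%C 0)%C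
        with (/ 2 * (fc (fun t => RtoC (g t) *
            psum (fun k => hg k * (s * cis th) ^ k)%C (fun k => (- Z.of_nat k)%Z) n t)%C 0
          - fc (fun t => RtoC (g t) * herglotz (s * cis th) t)%C 0))%C by ring.
      rewrite <- fc_minus by (apply ccont_mult; assumption).
      rewrite Cmod_mult, <- RtoC_inv, Cmod_R, (Rabs_pos_eq (/ 2)), !Rmult_assoc by lra.
      apply Rmult_le_compat_l; [lra|].
      apply Cmod_fc_le.
      + apply ccont_minus; apply ccont_mult; assumption.
      + apply Rmult_le_pos; [assumption|]; apply Rmult_le_pos; [|apply pow_le; lra].
        apply Rlt_le, Rdiv_lt_0_compat; lra.
      + intros t Ht.
        match goal with |- Cmod ?x <= _ => replace x with (RtoC (g t) *
         (psum (fun k => hg k * (s * cis th) ^ k)%C (fun k => (- Z.of_nat k)%Z) n t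
           - herglotz (s * cis th) t))%C by ring end.
        rewrite Cmod_mult; apply Rmult_le_compat; auto using Cmod_ge_0.
        assert (X := herglotz_psum_bound (s * cis th)%C n t Hz).
        rewrite Cmod_scis in X by lra; exact X.
    - rewrite fc_mult_psum by assumption.
      rewrite <- sum_n_C_mult_l; unfold psum; apply sum_n_ext; intros k; unfold u.
      replace (0 - - Z.of_nat k)%Z with (Z.of_nat k) by lia.
      unfold herglotz_coef; destruct (Z.ltb_spec (Z.of_nat k) 0); [lia|].
      rewrite Nat2Z.id, ek_nat, Cpow_mult_l, <- RtoC_pow; Ceq; ring. }
  assert (Hlim : is_lim_seq (fun n => / 2 * (B * (2 / (1 - s))) * s ^ S n) 0)
    by (apply lim_scal_0, pow_S_lim; lra).
  assert (Hc : ccont (polar (herglotz_transform g) s)).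
  { eapply ccont_uniform; [|exact Hlim|exact Hbd]; intros n; apply ccont_psum. }
  split; [exact Hc|].
  assert (HU : ulim (psum u Z.of_nat) (polar (herglotz_transform g) s))
    by (eexists; split; [exact Hlim|]; intros n t _; apply Hbd).
  destruct (fc_series_coef _ u Z.of_nat Hc HU) as [H1 H2]; [intros i j; lia|].
  intros m; destruct (Z_lt_le_dec m 0) as [Hm|Hm].
  - rewrite H2 by (intros k; lia).
    unfold herglotz_coef; destruct (Z.ltb_spec m 0); [ring|lia].
  - rewrite <- (Z2Nat.id m Hm), H1, <- pow_powerRZ; reflexivity.
Qed.

(** The kernel at the reflected point 1 / conj z is minus the conjugate of the kernel at z, and [g]
    is real. *)
Lemma herglotz_reflect (g : R -> R) (s th : R) :
  (forall t, continuous g t) -> 0 < s < 1 ->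
  herglotz_transform g (RtoC (/ s) * cis th)%C
  = (- Cconj (herglotz_transform g (RtoC s * cis th)))%C.
Proof.
  intros Hg Hs; assert (Hcg := ccont_RtoC g Hg).
  assert (Hz : Cmod (s * cis th)%C < 1) by (rewrite Cmod_scis; lra).
  assert (HH := ccont_herglotz _ (Rlt_not_eq _ _ Hz)).
  unfold herglotz_transform.
  rewrite Cmult_conj, <- mean_conj by ccont_tac.
  rewrite (mean_ext (fun t => RtoC (g t) * herglotz (RtoC (/ s) * cis th) t)%C
     (fun t => - Cconj (RtoC (g t) * herglotz (s * cis th) t))%C).
  - rewrite mean_opp by ccont_tac.
    replace (Cconj (/ 2)) with (/ 2)%C; [ring|].
    rewrite <- RtoC_inv by lra; apply C_eq; simpl; ring.
  - intros t _; rewrite Cmult_conj.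
    replace (Cconj (RtoC (g t))) with (RtoC (g t)) by (apply C_eq; simpl; ring).
    replace (herglotz (RtoC (/ s) * cis th) t) with (- Cconj (herglotz (RtoC s * cis th) t))%C;
      [ring|].
    assert (N1 : (cis t - s * cis th)%C <> RtoC 0) by (apply cis_minus_neq_0; lra).
    unfold herglotz; rewrite Cdiv_conj by exact N1.
    rewrite Cplus_conj, Cminus_conj, !Cmult_conj, !cis_conj.
    replace (Cconj (RtoC s)) with (RtoC s) by (apply C_eq; simpl; ring).
    assert (N2 : (cis t - / s * cis th)%C <> RtoC 0).
    { apply (cis_minus_neq_0 (/ s * cis th)%C); rewrite <- RtoC_inv, Cmod_scis by
        (lra || (apply Rlt_le, Rinv_0_lt_compat; lra)).
      intros E; assert (s = 1) by (rewrite <- (Rinv_inv s), E; apply Rinv_1); lra. }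
    rewrite !cis_opp, RtoC_inv by lra.
    assert (Ns : RtoC s <> RtoC 0) by (apply RtoC_neq_0; lra).
    assert (N3 : (s * cis t - cis th)%C <> RtoC 0).
    { intros E; apply N2.
      replace (cis t - / s * cis th)%C with (/ s * (s * cis t - cis th))%C by (field; exact Ns).
      rewrite E; ring. }
    assert (N4 := cis_neq_0 t); assert (N5 := cis_neq_0 th).
    field; repeat split; try assumption; intros E; apply N3; [rewrite <- E; ring|].
    replace (s * cis t - cis th)%C with (- (cis th - s * cis t))%C by ring.
    rewrite E; ring.
Qed.

(** * Szego functions *)

Lemma ex_derive_eps (f : C -> C) (z : C) (eps : R) :
  ex_derive (K := C_AbsRing) (V := C_NormedModule) f z -> 0 < eps ->
  exists d, 0 < d /\ forall y, Cmod (y - z)%C < d -> Cmod (f y - f z)%C < eps.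
Proof.
  intros Hd He.
  apply ex_derive_continuous in Hd.
  destruct (proj1 (filterlim_locally_ball_norm (K := C_AbsRing) (U := C_NormedModule) _ _) Hd
    (mkposreal eps He)) as [d Hb].
  exists d; split; [apply cond_pos|]; intros y Hy; exact (Hb y Hy).
Qed.

Lemma cis_lipschitz (t u : R) : Cmod (cis u - cis t)%C <= Rabs (u - t).
Proof.
  apply Rsqr_incr_0_var; [|apply Rabs_pos].
  rewrite <- Rsqr_abs, !Rsqr_pow2, Cmod2_alt.
  replace (Re (cis u - cis t)%C ^ 2 + Im (cis u - cis t)%C ^ 2)
    with (2 * (1 - cos (u - t))).
  - assert (H := cos_taylor1 (u - t)); apply Rabs_le_between in H; lra.
  - rewrite cos_minus; unfold cis, Re, Im; simpl.
    assert (A := sin2_cos2 u); assert (B := sin2_cos2 t); unfold Rsqr in *.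
    replace 2 with ((sin u * sin u + cos u * cos u) + (sin t * sin t + cos t * cos t)) at 1 by lra.
    transitivity ((sin u * sin u + cos u * cos u) + (sin t * sin t + cos t * cos t)
       - 2 * (cos u * cos t + sin u * sin t)); [rewrite A, B; ring|ring].
Qed.

Lemma polar_lipschitz (s s' t u : R) :
  0 <= s -> Cmod (s' * cis u - s * cis t)%C <= Rabs (s' - s) + s * Rabs (u - t).
Proof.
  intros Hs.
  replace (s' * cis u - s * cis t)%C with ((RtoC s' - RtoC s) * cis u + s * (cis u - cis t))%C by ring.
  eapply Rle_trans; [apply Cmod_triangle|].
  rewrite !Cmod_mult, Cmod_cis, <- RtoC_minus, !Cmod_R, (Rabs_pos_eq s) by assumption.
  assert (H := cis_lipschitz t u); nra.
Qed.

Lemma weight_pos (w : C -> R) (t : R) : positive_analytic_weight w -> 0 < w (cis t).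
Proof. intros [H _]; apply H, Cmod_cis. Qed.

Lemma weight_continuous (w : C -> R) :
  positive_analytic_weight w -> forall t, continuous (fun t => w (cis t)) t.
Proof.
  intros [_ [U [W [_ [HU [HW [_ HWw]]]]]]].
  assert (H : ccont (fun t => RtoC (w (cis t)))).
  { apply ccont_eps; intros t eps He.
    destruct (ex_derive_eps W (cis t) eps (HW _ (HU _ (Cmod_cis t))) He) as [d [Hd Hb]].
    exists d; split; [assumption|]; intros u Hu.
    rewrite <- !HWw by apply Cmod_cis; apply Hb.
    eapply Rle_lt_trans; [apply cis_lipschitz|assumption]. }
  intros t; exact (proj1 (H t)).
Qed.

Definition logw (w : C -> R) (t : R) : R := ln (w (cis t)).

Lemma logw_continuous (w : C -> R) :
  positive_analytic_weight w -> forall t, continuous (logw w) t.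
Proof.
  intros Hw t; apply (continuous_comp (fun t => w (cis t)) ln).
  - now apply weight_continuous.
  - apply (ex_derive_continuous (V := R_NormedModule)); auto_derive; now apply weight_pos.
Qed.

Lemma cis_periodic (t : R) : cis (t + 2 * PI) = cis t.
Proof. rewrite <- !ek_1; apply cis_2PI. Qed.

Lemma szego_herglotz (w : C -> R) (z : C) :
  positive_analytic_weight w -> Cmod z <> 1 ->
  szego w z = Cexp (herglotz_transform (logw w) z).
Proof.
  intros Hw Hz; assert (Hp := PI_RGT_0).
  unfold szego; f_equal.
  change (fun t => (RtoC (ln (w (cis t))) * ((cis t + z) / (cis t - z)))%C)
    with (fun t => (RtoC (logw w t) * herglotz z t)%C).
  rewrite CInt_mean.
  - unfold herglotz_transform; rewrite Cmult_assoc, <- RtoC_mult; f_equal.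
    rewrite <- RtoC_inv by lra; f_equal; field; lra.
  - apply ccont_mult; [apply ccont_RtoC; now apply logw_continuous|now apply ccont_herglotz].
Qed.

Lemma herglotz_transform_0 (w : C -> R) :
  positive_analytic_weight w ->
  herglotz_coef (logw w) 0 = RtoC (/ (4 * PI) * RInt (logw w) 0 (2 * PI)).
Proof.
  intros Hw; assert (Hp := PI_RGT_0).
  unfold herglotz_coef; simpl Z.ltb; cbv iota; rewrite <- mean_fc.
  unfold mean; simpl hg.
  rewrite (RInt_ext (fun t => Im (RtoC (logw w t))) (fun _ => 0)) by reflexivity.
  change (RInt (fun t => Re (RtoC (logw w t))) 0 (2 * PI)) with (RInt (logw w) 0 (2 * PI)).
  rewrite RInt_const.
  apply C_eq; rewrite <- RtoC_inv by lra; unfold Re, Im, RtoC, scal; simpl; unfold mult; simpl;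
    Req; field; lra.
Qed.

(** The constant term is exp of half the mean of log w, which is 1 / [tau]. *)
Lemma szego_disc (w : C -> R) :
  positive_analytic_weight w ->
  exists d, disc_analytic (szego w) d /\ d 0%Z = RtoC (/ tau w).
Proof.
  intros Hw.
  destruct (disc_exp _ _ (disc_herglotz (logw w) (logw_continuous w Hw))) as [d [[H1 H2] H3]].
  exists d; split; [split; [|assumption]|].
  - eapply laurent_ext; [|exact H1]; intros s t Hs; simpl.
    rewrite szego_herglotz; [reflexivity|assumption|rewrite Cmod_scis; lra].
  - rewrite H3, herglotz_transform_0 by assumption.
    set (X := / (4 * PI) * RInt (logw w) 0 (2 * PI)).
    assert (E : exp X = / tau w) by (unfold tau; rewrite exp_Ropp, Rinv_inv; reflexivity).
    unfold Cexp; change (Re (RtoC X)) with X; change (Im (RtoC X)) with 0.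
    rewrite cis_0, E; ring.
Qed.

Lemma szego_inv_disc (w : C -> R) :
  positive_analytic_weight w ->
  exists e, disc_analytic (fun z => / szego w z)%C e /\ e 0%Z = RtoC (tau w).
Proof.
  intros Hw.
  assert (HJ := disc_affine (RtoC 0) (RtoC (-1)) _ _ (disc_herglotz (logw w) (logw_continuous w Hw))).
  destruct (disc_exp _ _ HJ) as [d [[H1 H2] H3]].
  exists d; split; [split; [|assumption]|].
  - eapply laurent_ext; [|exact H1]; intros s t Hs; simpl.
    rewrite szego_herglotz; [|assumption|rewrite Cmod_scis; lra].
    set (J := herglotz_transform (logw w) (s * cis t)%C).
    replace (RtoC 0 + RtoC (-1) * J)%C with (- J)%C by ring.
    rewrite <- (Cmult_1_r (Cexp (- J))), <- (Cinv_r (Cexp J)) by apply Cexp_neq_0.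
    rewrite Cmult_assoc, Cexp_opp; ring.
  - rewrite H3; simpl; rewrite herglotz_transform_0 by assumption.
    set (X := / (4 * PI) * RInt (logw w) 0 (2 * PI)).
    assert (E : exp (- X) = tau w) by reflexivity.
    replace (RtoC 0 + RtoC (-1) * RtoC X)%C with (RtoC (- X)) by (rewrite RtoC_opp; ring).
    unfold Cexp; change (Re (RtoC (- X))) with (- X); change (Im (RtoC (- X))) with 0.
    rewrite cis_0, E; ring.
Qed.

Lemma inv_unit_interval (s : R) : 1 < s -> 0 < / s < 1.
Proof.
  intros Hs; split; [apply Rinv_0_lt_compat; lra|].
  rewrite <- Rinv_1; apply Rinv_lt_contravar; lra.
Qed.

(** D_e(z) = conj(1 / D_i(1 / conj z)): the reflection of the exponent, exponentiated. It determines
    D_e outside the circle from 1 / D_i inside. *)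
Lemma szego_reflect (w : C -> R) (s t : R) :
  positive_analytic_weight w -> 1 < s ->
  szego w (s * cis t)%C = Cconj (/ szego w (RtoC (/ s) * cis t))%C.
Proof.
  intros Hw Hs.
  assert (Hs' := inv_unit_interval s Hs).
  rewrite !szego_herglotz; try assumption; [|rewrite Cmod_scis; lra|rewrite Cmod_scis; lra].
  assert (R := herglotz_reflect (logw w) (/ s) t (logw_continuous w Hw) Hs').
  rewrite Rinv_inv in R; rewrite R.
  set (J := herglotz_transform (logw w) (RtoC (/ s) * cis t)%C).
  rewrite <- Copp_conj, Cexp_conj; f_equal.
  rewrite <- (Cmult_1_r (Cexp (- J))), <- (Cinv_r (Cexp J)) by apply Cexp_neq_0.
  rewrite Cmult_assoc, Cexp_opp; ring.
Qed.

Lemma szego_neq_0 (w : C -> R) (z : C) :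
  positive_analytic_weight w -> Cmod z <> 1 -> szego w z <> RtoC 0.
Proof. intros Hw Hz; rewrite szego_herglotz by assumption; apply Cexp_neq_0. Qed.

(** |D_i|^2 is exp of the Poisson integral of log w, which tends radially to log w. *)
Lemma szego_modulus_limit (w : C -> R) (t : R) (s : nat -> R) :
  positive_analytic_weight w -> 0 <= t <= 2 * PI ->
  (forall n, 0 <= s n < 1) -> is_lim_seq s 1 ->
  is_lim_seq (fun n => Cmod (szego w (s n * cis t)%C) ^ 2) (w (cis t)).
Proof.
  intros Hw Ht Hs Hl.
  assert (Hg := logw_continuous w Hw).
  assert (Hper : forall t, logw w (t + 2 * PI) = logw w t)
    by (intros u; unfold logw; now rewrite cis_periodic).
  set (v := fun n => Re (mean (fun u => RtoC (logw w u) * herglotz (s n * cis t) u)%C)).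
  assert (L : is_lim_seq v (logw w t)).
  { apply is_lim_seq_spec; intros eps.
    assert (He : 0 < eps / 2) by (destruct eps as [e He]; simpl; lra).
    destruct (poisson_limit (logw w) t (eps / 2) Hg Hper Ht He) as [K [HK Hb]].
    assert (He' : 0 < eps / 2 / (K + 1)) by (apply Rdiv_lt_0_compat; lra).
    destruct (proj2 (is_lim_seq_spec _ _) Hl (mkposreal _ He')) as [N HN].
    exists N; intros n Hn; specialize (HN n Hn); specialize (Hb (s n) (Hs n)).
    simpl in HN; apply Rabs_lt_between in HN.
    eapply Rle_lt_trans; [exact Hb|].
    assert (H1 : (K + 1) * (1 - s n) < eps / 2).
    { apply Rmult_lt_reg_r with (/ (K + 1)); [apply Rinv_0_lt_compat; lra|].
      replace ((K + 1) * (1 - s n) * / (K + 1)) with (1 - s n) by (field; lra).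
      change (eps / 2 * / (K + 1)) with (eps / 2 / (K + 1)); lra. }
    assert (H2 := Hs n); nra. }
  apply is_lim_seq_ext with (fun n => exp (v n)).
  - intros n; rewrite szego_herglotz, Cmod_Cexp; [|assumption|rewrite Cmod_scis; [|apply Hs];
      generalize (Hs n); lra].
    rewrite <- exp_INR_mult; f_equal; unfold herglotz_transform, v.
    rewrite <- RtoC_inv by lra; unfold Re; simpl; field; apply PI_neq0.
  - replace (w (cis t)) with (exp (logw w t)) by (apply exp_ln; now apply weight_pos).
    apply (is_lim_seq_continuous exp v (logw w t)); [|exact L].
    apply derivable_continuous_pt, derivable_pt_exp.
Qed.

(** * Laurent expansions and boundary values *)

Lemma Clim_sum_bounded (a : nat -> C) (l : C) :
  Clim (sum_n a) l -> exists B, forall k, Cmod (a k) <= B.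
Proof.
  intros H.
  destruct (filterlim_bounded (K := R_AbsRing) (V := R_NormedModule)
    (fun n => Cmod (sum_n a n - l)%C)) as [M HM].
  { exists 0; exact H. }
  assert (HM' : forall n, Cmod (sum_n a n - l)%C <= M).
  { intros n; eapply Rle_trans; [|exact (HM n)]; apply Rle_abs. }
  exists (2 * M + Cmod l); intros [|k].
  - assert (X := HM' O); rewrite sum_O in X.
    assert (T := Cmod_triangle (a O - l) l).
    replace (a O - l + l)%C with (a O) in T by ring.
    assert (Y := Cmod_ge_0 (a O - l)%C); lra.
  - replace (a (S k)) with ((sum_n a (S k) - l) - (sum_n a k - l))%C
      by (rewrite sum_n_C_S; Ceq; ring).
    eapply Rle_trans; [apply (Cmod_minus_triangle _ (RtoC 0))|].
    replace (sum_n a (S k) - l - 0)%C with (sum_n a (S k) - l)%C by (Ceq; ring).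
    replace (0 - (sum_n a k - l))%C with (- (sum_n a k - l))%C by (Ceq; ring).
    rewrite Cmod_opp; generalize (HM' (S k)) (HM' k) (Cmod_ge_0 l); lra.
Qed.

(** Pointwise convergence at a neighbouring radius bounds the terms there: a larger radius serves
    the nonnegative exponents, a smaller one the negative exponents. Both halves then converge
    absolutely on the circle in between and the coefficients can be read off. *)
Lemma laurent_expansion_on (G : C -> C) (c : Z -> C) (r0 : R) :
  0 <= r0 -> laurent_expansion (annulus r0 1) G c ->
  laurent_on (fun s => r0 < s < 1) G c.
Proof.
  intros Hr0 HL s Hs.
  assert (conv : forall s t, r0 < s < 1 -> exists p q,
     Clim (sum_n (fun k => c (Z.of_nat k) * (s * cis t) ^ k)%C) p /\
     Clim (sum_n (fun k => c (- Z.of_nat (S k))%Z / (s * cis t) ^ (S k))%C) q /\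
     G (s * cis t)%C = (p + q)%C).
  { intros s' t Hs'.
    destruct (HL (s' * cis t)%C) as [p [q [Hp [Hq E]]]].
    { unfold annulus; rewrite Cmod_scis; lra. }
    exists p, q; split; [now apply is_series_Clim|split; [now apply is_series_Clim|exact E]]. }
  set (gp := fun k => (RtoC (s ^ k) * c (Z.of_nat k))%C).
  set (gq := fun k => (RtoC ((/ s) ^ S k) * c (- Z.of_nat (S k))%Z)%C).
  set (sgp := Z.of_nat); set (sgq := fun k => (- Z.of_nat (S k))%Z).
  assert (Sp : ex_series (fun k => Cmod (gp k))).
  { set (s' := (1 + s) / 2); assert (Hs' : s < s' < 1) by (unfold s'; lra).
    destruct (conv s' 0) as [p [q [Hp _]]]; [lra|].
    destruct (Clim_sum_bounded _ _ Hp) as [B HB].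
    apply (ex_series_root _ s s' B); [lra|]; intros k; specialize (HB k).
    rewrite Cmod_mult, Cmod_pow, Cmod_scis in HB by lra; lra. }
  assert (Sq : ex_series (fun k => Cmod (gq k))).
  { set (s' := (r0 + s) / 2); assert (Hs' : r0 < s' < s) by (unfold s'; lra).
    destruct (conv s' 0) as [p [q [_ [Hq _]]]]; [lra|].
    destruct (Clim_sum_bounded _ _ Hq) as [B HB].
    (* The series over the exponents S k is completed by a term at k = 0 so that the comparison
       lemma applies; this extra term is why the bound is a maximum with |c_0|. *)
    apply (ex_series_incr_1 (fun k => Cmod (RtoC ((/ s) ^ k) * c (- Z.of_nat k)%Z)%C)).
    apply (ex_series_root _ (/ s) (/ s') (Rmax (Cmod (c 0%Z)) B)).
    { split; [apply Rinv_0_lt_compat; lra|apply Rinv_lt_contravar; nra]. }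
    intros [|k]; [simpl; rewrite Rmult_1_l; apply Rmax_l|].
    eapply Rle_trans; [|apply Rmax_r]; specialize (HB k).
    rewrite Cmod_div, Cmod_pow, Cmod_scis in HB by
      (lra || (apply Cpow_nz; intros E; apply (f_equal Cmod) in E;
         rewrite Cmod_scis, Cmod_0 in E; lra)).
    rewrite pow_inv, Rmult_comm; exact HB. }
  assert (E : forall t, (tsum gp sgp t + tsum gq sgq t)%C = polar G s t).
  { intros t; destruct (conv s t Hs) as [p [q [Hp [Hq Eg]]]]; unfold polar; rewrite Eg; f_equal.
    - eapply Clim_unique; [|exact Hp].
      eapply Clim_ext; [|apply (csum_lim _ _ Sp)].
      + intros n; apply sum_n_ext; intros k; unfold gp, sgp.
        rewrite ek_nat, Cpow_mult_l, <- RtoC_pow; Ceq; ring.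
      + intros k; rewrite Cmod_mult, Cmod_ek; lra.
    - eapply Clim_unique; [|exact Hq].
      eapply Clim_ext; [|apply (csum_lim _ _ Sq)].
      + intros n; apply sum_n_ext; intros k; unfold gq, sgq.
        rewrite <- ek_conj, ek_nat, Cpow_mult_l, <- RtoC_pow.
        assert (H1 := Cpow_nz _ (S k) (cis_neq_0 t)).
        assert (H2 : RtoC (s ^ S k) <> RtoC 0) by (apply RtoC_neq_0, pow_nonzero; lra).
        assert (H3 : (cis t ^ S k * Cconj (cis t ^ S k))%C = RtoC 1).
        { rewrite <- Cmod2_conj, Cmod_pow, Cmod_cis, pow1; f_equal; ring. }
        rewrite pow_inv, RtoC_inv by (apply pow_nonzero; lra); Ceq.
        transitivity (c (- Z.of_nat (S k))%Z * (/ RtoC (s ^ S k)) *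
          (cis t ^ S k * Cconj (cis t ^ S k)) / cis t ^ S k)%C;
          [field; split; assumption|rewrite H3; field; split; assumption].
      + intros k; rewrite Cmod_mult, Cmod_ek; lra. }
  split; [apply (ccont_ext (fun t => tsum gp sgp t + tsum gq sgq t)%C); [exact E|];
    apply ccont_plus; now apply ccont_tsum|].
  intros m; rewrite <- (fc_ext _ _ m (fun t _ => E t)), fc_plus by (now apply ccont_tsum).
  destruct (fc_series_coef _ gp sgp (ccont_tsum _ _ Sp) (ulim_tsum _ _ Sp)) as [P1 P2];
    [unfold sgp; intros i j; lia|].
  destruct (fc_series_coef _ gq sgq (ccont_tsum _ _ Sq) (ulim_tsum _ _ Sq)) as [Q1 Q2];
    [unfold sgq; intros i j; lia|].
  destruct (Z_lt_le_dec m 0) as [Hm|Hm].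
  - rewrite P2 by (unfold sgp; intros k; lia).
    replace m with (sgq (Z.to_nat (- m - 1))) at 1 by (unfold sgq; lia).
    rewrite Q1; unfold gq.
    replace (- Z.of_nat (S (Z.to_nat (- m - 1))))%Z with m by lia.
    replace ((/ s) ^ S (Z.to_nat (- m - 1))) with (powerRZ s m); [ring|].
    rewrite pow_inv, pow_powerRZ, <- powerRZ_neg' by lra; f_equal; lia.
  - rewrite Q2 by (unfold sgq; intros k; lia).
    replace m with (sgp (Z.to_nat m)) at 1 by (unfold sgp; lia).
    rewrite P1; unfold gp; rewrite pow_powerRZ, Z2Nat.id by assumption; ring.
Qed.

(** Continuity across the unit circle is uniform in the angle, by compactness of a period. *)
Lemma holomorphic_polar_uniform (G : C -> C) (r0 : R) :
  r0 < 1 -> holomorphic (outside r0) G -> forall eps, 0 < eps ->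
  exists d, 0 < d /\ forall s t, Rabs (s - 1) < d -> 0 <= t <= 2 * PI ->
    Cmod (polar G s t - polar G 1 t)%C < eps.
Proof.
  intros Hr0 HG eps He.
  (* Stated for any 1-Lipschitz [f] in order to serve both Re and Im. *)
  assert (loc : forall (f : C -> R), (forall x y : C, Rabs (f x - f y) <= Cmod (x - y)%C) ->
    forall t, continuity_2d_pt (fun t s => f (polar G s t)) t 1).
  { intros f Hf t e.
    destruct (ex_derive_eps G (1 * cis t)%C e) as [d [Hd Hb]].
    - apply HG; unfold outside; rewrite Cmod_scis; lra.
    - apply cond_pos.
    - assert (Hd2 : 0 < d / 2) by lra.
      exists (mkposreal _ Hd2); intros u v Hu Hv; simpl in Hu, Hv.
      eapply Rle_lt_trans; [apply Hf|]; apply Hb.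
      eapply Rle_lt_trans; [apply polar_lipschitz; lra|]; lra. }
  assert (He2 : 0 < eps / 2) by lra.
  assert (HRe : forall x y : C, Rabs (Re x - Re y) <= Cmod (x - y)%C).
  { intros x y; apply (re_le_Cmod (x - y)%C). }
  assert (HIm : forall x y : C, Rabs (Im x - Im y) <= Cmod (x - y)%C).
  { intros x y; apply (im_le_Cmod (x - y)%C). }
  destruct (uniform_continuity_2d_1d (fun t s => Re (polar G s t)) 0 (2 * PI) 1
    (fun t _ => loc Re HRe t) (mkposreal _ He2)) as [d1 H1].
  destruct (uniform_continuity_2d_1d (fun t s => Im (polar G s t)) 0 (2 * PI) 1
    (fun t _ => loc Im HIm t) (mkposreal _ He2)) as [d2 H2].
  exists (Rmin d1 d2); split; [apply Rmin_pos; apply cond_pos|].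
  intros s t Hs Ht.
  assert (A1 := Rlt_le_trans _ _ _ Hs (Rmin_l _ _)).
  assert (A2 := Rlt_le_trans _ _ _ Hs (Rmin_r _ _)).
  apply Rabs_lt_between in A1; apply Rabs_lt_between in A2.
  specialize (H1 t 1 t s Ht); specialize (H2 t 1 t s Ht); simpl in H1, H2.
  rewrite Rminus_diag, Rabs_R0 in H1, H2.
  assert (B1 := H1 ltac:(generalize (cond_pos d1); lra) Ht ltac:(lra) (cond_pos d1)).
  assert (B2 := H2 ltac:(generalize (cond_pos d2); lra) Ht ltac:(lra) (cond_pos d2)).
  eapply Rle_lt_trans; [apply Cmod_le_Re_Im|].
  change (Re (polar G s t - polar G 1 t)%C) with (Re (polar G s t) - Re (polar G 1 t)).
  change (Im (polar G s t - polar G 1 t)%C) with (Im (polar G s t) - Im (polar G 1 t)).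
  lra.
Qed.

Lemma holomorphic_polar_ccont (G : C -> C) (r0 s : R) :
  holomorphic (outside r0) G -> 0 <= r0 < s -> ccont (polar G s).
Proof.
  intros HG Hs; apply ccont_eps; intros t eps He.
  destruct (ex_derive_eps G (s * cis t)%C eps) as [d [Hd Hb]]; [|assumption|].
  - apply HG; unfold outside; rewrite Cmod_scis; lra.
  - exists (d / s); split; [apply Rdiv_lt_0_compat; lra|]; intros u Hu; apply Hb.
    eapply Rle_lt_trans; [apply polar_lipschitz; lra|].
    rewrite Rminus_diag, Rabs_R0, Rplus_0_l.
    apply Rmult_lt_reg_r with (/ s); [apply Rinv_0_lt_compat; lra|].
    replace (s * Rabs (u - t) * / s) with (Rabs (u - t)) by (field; lra); exact Hu.
Qed.

Definition radial_limit (f : R -> R -> C) (f1 : R -> C) : Prop :=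
  forall eps, 0 < eps ->
  exists d, 0 < d /\ forall s t, Rabs (s - 1) < d -> 0 <= t <= 2 * PI ->
    Cmod (f s t - f1 t)%C < eps.

Lemma radial_limit_fc (f : R -> R -> C) (f1 : R -> C) (s : nat -> R) (m : Z) :
  radial_limit f f1 -> is_lim_seq s 1 -> (forall n, ccont (f (s n))) -> ccont f1 ->
  Clim (fun n => fc (f (s n)) m) (fc f1 m).
Proof.
  intros HL Hs Hf Hf1; apply is_lim_seq_spec; intros eps.
  assert (He : 0 < eps / 2) by (destruct eps as [e He]; simpl; lra).
  destruct (HL _ He) as [d [Hd Hb]].
  destruct (proj2 (is_lim_seq_spec _ _) Hs (mkposreal d Hd)) as [N HN].
  exists N; intros n Hn; specialize (HN n Hn); simpl in HN.
  rewrite Rminus_0_r, Rabs_pos_eq by apply Cmod_ge_0.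
  rewrite <- fc_minus by auto.
  apply Rle_lt_trans with (eps / 2); [|lra].
  apply Cmod_fc_le; [apply ccont_minus; auto|lra|].
  intros t Ht; apply Rlt_le; now apply Hb.
Qed.

Lemma lim_pow_1 (x : nat -> R) (n : nat) :
  is_lim_seq x 1 -> is_lim_seq (fun k => x k ^ n) 1.
Proof.
  intros H; induction n as [|n IH]; simpl; [apply is_lim_seq_const|].
  replace (Finite 1) with (Finite (1 * 1)) by (f_equal; ring).
  now apply is_lim_seq_mult'.
Qed.

Lemma lim_powerRZ_1 (x : nat -> R) (m : Z) :
  is_lim_seq x 1 -> is_lim_seq (fun n => powerRZ (x n) m) 1.
Proof.
  intros H; destruct m as [|p|p]; simpl.
  - apply is_lim_seq_const.
  - now apply lim_pow_1.
  - replace (Finite 1) with (Rbar_inv (Finite 1)) by (simpl; f_equal; apply Rinv_1).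
    apply is_lim_seq_inv; [now apply lim_pow_1|].
    intros E; injection E; lra.
Qed.

Lemma Clim_powerRZ (x : nat -> R) (m : Z) (a : C) :
  is_lim_seq x 1 -> Clim (fun n => RtoC (powerRZ (x n) m) * a)%C a.
Proof.
  intros H; apply (Clim_bound _ _ (fun n => Cmod a * Rabs (powerRZ (x n) m - 1))).
  - intros n; right.
    replace (RtoC (powerRZ (x n) m) * a - a)%C with (a * (RtoC (powerRZ (x n) m) - RtoC 1))%C by ring.
    now rewrite Cmod_mult, <- RtoC_minus, Cmod_R.
  - apply lim_scal_0, (proj1 (is_lim_seq_abs_0 _)).
    replace (Finite 0) with (Finite (1 - 1)) by (f_equal; ring).
    apply is_lim_seq_minus'; [now apply lim_powerRZ_1|apply is_lim_seq_const].
Qed.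

Lemma lim_one_plus : is_lim_seq (fun n => 1 + 1 / INR (S n)) 1.
Proof.
  replace (Finite 1) with (Finite (1 + 0)) by (f_equal; ring).
  apply is_lim_seq_plus'; [apply is_lim_seq_const|apply lim_div_INR].
Qed.

Lemma lim_one_minus (a : R) : is_lim_seq (fun n => 1 - a / INR (S n)) 1.
Proof.
  replace (Finite 1) with (Finite (1 - 0)) by (f_equal; ring).
  apply is_lim_seq_minus'; [apply is_lim_seq_const|apply lim_div_INR].
Qed.

Lemma div_INR_S_bound (a : R) (n : nat) : 0 < a -> 0 < a / INR (S n) <= a.
Proof.
  intros Ha; assert (H : 1 <= INR (S n)) by (rewrite S_INR; generalize (pos_INR n); lra).
  split; [apply Rdiv_lt_0_compat; lra|].
  apply Rmult_le_reg_r with (INR (S n)); [lra|].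
  replace (a / INR (S n) * INR (S n)) with a by (field; lra); nra.
Qed.

Lemma lim_inv_1 (x : nat -> R) : is_lim_seq x 1 -> is_lim_seq (fun n => / x n) 1.
Proof.
  intros H; replace (Finite 1) with (Rbar_inv (Finite 1)) by (simpl; f_equal; apply Rinv_1).
  apply is_lim_seq_inv; [assumption|]; intros E; injection E; lra.
Qed.

Lemma radial_limit_conj_inv (f : R -> R -> C) (f1 : R -> C) (mu : R) :
  0 < mu -> (forall t, 0 <= t <= 2 * PI -> mu <= Cmod (f1 t)) ->
  radial_limit f f1 ->
  radial_limit (fun s t => / Cconj (f s t))%C (fun t => / Cconj (f1 t))%C.
Proof.
  intros Hmu Hlow HL eps He.
  (* The first bound keeps |f| above mu / 2; the second beats the denominator |f| |f1|, which is
     then at least mu^2 / 4. *)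
  assert (He' : 0 < Rmin (mu / 2) (eps * mu ^ 2 / 4)).
  { apply Rmin_pos; [lra|]; apply Rmult_lt_0_compat; [|lra].
    apply Rmult_lt_0_compat; [assumption|now apply pow_lt]. }
  destruct (HL _ He') as [d [Hd Hb]]; exists d; split; [assumption|].
  intros s t Hs Ht; specialize (Hb s t Hs Ht); specialize (Hlow t Ht).
  assert (B1 := Rlt_le_trans _ _ _ Hb (Rmin_l _ _)).
  assert (B2 := Rlt_le_trans _ _ _ Hb (Rmin_r _ _)).
  assert (T := Cmod_minus_triangle (f1 t) (f s t) (RtoC 0)).
  replace (f1 t - 0)%C with (f1 t) in T by ring.
  replace (f s t - 0)%C with (f s t) in T by ring.
  rewrite Cmod_minus_sym in T.
  assert (L2 : mu / 2 <= Cmod (f s t)) by lra.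
  assert (N1 : Cconj (f s t) <> RtoC 0).
  { intros E; apply (f_equal Cmod) in E; rewrite Cmod_conj, Cmod_0 in E; lra. }
  assert (N2 : Cconj (f1 t) <> RtoC 0).
  { intros E; apply (f_equal Cmod) in E; rewrite Cmod_conj, Cmod_0 in E; lra. }
  replace (/ Cconj (f s t) - / Cconj (f1 t))%C
    with (Cconj (f1 t - f s t) / (Cconj (f s t) * Cconj (f1 t)))%C
    by (rewrite Cminus_conj; field; split; assumption).
  rewrite Cmod_div, Cmod_mult, !Cmod_conj by (now apply Cmult_neq_0).
  rewrite Cmod_minus_sym.
  assert (Hpos : 0 < Cmod (f s t) * Cmod (f1 t)) by (apply Rmult_lt_0_compat; lra).
  apply Rmult_lt_reg_r with (Cmod (f s t) * Cmod (f1 t)); [assumption|].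
  unfold Rdiv; rewrite Rmult_assoc, Rinv_l, Rmult_1_r by lra.
  eapply Rlt_le_trans; [exact B2|].
  replace (eps * mu ^ 2 / 4) with (eps * (mu / 2 * (mu / 2))) by field.
  apply Rmult_le_compat_l; [lra|]; apply Rmult_le_compat; lra.
Qed.

(* [e] and [dl] are the Taylor coefficients of [1 / D_i] and [D_i]; on the unit
   circle [D_i] is represented by [1 / conj D_e]. *)
Record szego_data w De c r0 e dl : Prop := {
  sd_inv : disc_analytic (fun z => / szego w z)%C e;
  sd_inv_0 : e 0%Z = RtoC (tau w);
  sd_disc : disc_analytic (szego w) dl;
  sd_dl_0 : dl 0%Z = RtoC (/ tau w);
  sd_ext : laurent_on (fun s => r0 < s) De (fun m => Cconj (e (- m)%Z));
  sd_scat : laurent_on (fun s => r0 < s < 1) (scattering w De) c;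
  sd_weight : forall t, (De (cis t) * Cconj (De (cis t)) * RtoC (w (cis t)))%C = RtoC 1;
  sd_int : forall m, fc (fun t => / Cconj (De (cis t)))%C m = dl m;
  sd_refl : forall s t, 0 < s < 1 ->
    De (RtoC (/ s) * cis t)%C = Cconj (/ szego w (RtoC s * cis t))%C
}.

Arguments sd_inv {w De c r0 e dl} _.
Arguments sd_inv_0 {w De c r0 e dl} _.
Arguments sd_disc {w De c r0 e dl} _.
Arguments sd_dl_0 {w De c r0 e dl} _.
Arguments sd_ext {w De c r0 e dl} _.
Arguments sd_scat {w De c r0 e dl} _.
Arguments sd_weight {w De c r0 e dl} _.
Arguments sd_int {w De c r0 e dl} _.
Arguments sd_refl {w De c r0 e dl} _.

Lemma polar_1 (G : C -> C) (t : R) : polar G 1 t = G (cis t).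
Proof. unfold polar; now rewrite Cmult_1_l. Qed.

(** D_e continues inside to radius r0 and has only nonpositive frequencies; the estimate at a radius
    between r0 and s gives absolute convergence at s. *)
Lemma ext_series (De : C -> C) (r0 s : R) (e : Z -> C) :
  0 <= r0 < s -> laurent_on (fun s => r0 < s) De (fun m => Cconj (e (- m)%Z)) ->
  (forall m, (m < 0)%Z -> e m = RtoC 0) ->
  ulim (psum (fun k => RtoC (powerRZ s (- Z.of_nat k)) * Cconj (e (Z.of_nat k)))%C
        (fun k => (- Z.of_nat k)%Z)) (polar De s).
Proof.
  intros Hs HL He0.
  set (sg := fun k => (- Z.of_nat k)%Z).
  set (s' := (r0 + s) / 2); assert (Hs' : r0 < s' < s) by (unfold s'; lra).
  destruct (HL s ltac:(lra)) as [Hc Hf].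
  destruct (laurent_coef_bound _ _ _ s' HL ltac:(lra) ltac:(lra)) as [B [HB Hb]].
  assert (E : forall k, fc (polar De s) (sg k)
    = (RtoC (powerRZ s (- Z.of_nat k)) * Cconj (e (Z.of_nat k)))%C).
  { intros k; rewrite Hf; unfold sg; now rewrite Z.opp_involutive. }
  destruct (fourier_series (polar De s) sg) as [_ [x [Hx Hbx]]]; auto.
  - intros t; apply polar_periodic.
  - unfold sg; intros i j; lia.
  - intros m Hm; rewrite Hf, He0; [apply C_eq; simpl; ring|].
    destruct (Z_lt_le_dec (- m) 0) as [H|H]; [assumption|].
    exfalso; apply (Hm (Z.to_nat (- m))); unfold sg; lia.
  - apply (ex_series_ext (fun k => Cmod (RtoC ((/ s) ^ k) * Cconj (e (Z.of_nat k)))%C)).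
    + intros k; now rewrite E, powerRZ_neg', <- pow_powerRZ, pow_inv by lra.
    + apply (ex_series_root _ (/ s) (/ s') B).
      * split; [apply Rinv_0_lt_compat; lra|apply Rinv_lt_contravar; nra].
      * intros k; specialize (Hb (sg k)); unfold sg in Hb.
        now rewrite Z.opp_involutive, powerRZ_neg', <- pow_powerRZ, <- pow_inv in Hb by lra.
  - exists x; split; [assumption|]; intros n t Ht.
    rewrite <- (Hbx n t Ht) at 1; right; f_equal; f_equal.
    unfold psum; apply sum_n_ext; intros k; now rewrite E.
Qed.

(** The coefficients of [De] come from reflection for s > 1, from a radial limit at s = 1 and from F
    / D_i for s < 1; continuity across the circle forces all three to agree. The identities on the
    circle are limits of the reflection formula. *)
Lemma szego_data_exists (w : C -> R) (De : C -> C) (c : Z -> C) (r0 : R) :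
  positive_analytic_weight w -> 0 <= r0 < 1 ->
  ext_szego_extension w r0 De ->
  laurent_expansion (annulus r0 1) (scattering w De) c ->
  exists e dl, szego_data w De c r0 e dl.
Proof.
  intros Hw Hr0 [HDe HDe1] HL.
  destruct (szego_inv_disc w Hw) as [e [[He1 He0] Hetau]].
  destruct (szego_disc w Hw) as [dl [[Hdl1 Hdl0] Hdltau]].
  exists e, dl.
  assert (HF := laurent_expansion_on _ c r0 (proj1 Hr0) HL).
  assert (Hcc : forall s, r0 < s -> ccont (polar De s))
    by (intros s Hs; eapply holomorphic_polar_ccont; [exact HDe|lra]).
  assert (Hrad : radial_limit (polar De) (polar De 1))
    by (exact (holomorphic_polar_uniform De r0 (proj2 Hr0) HDe)).
  assert (refl : forall s t, 0 < s < 1 ->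
    De (RtoC (/ s) * cis t)%C = Cconj (/ szego w (RtoC s * cis t))%C).
  { intros s t Hs.
    assert (Hi : 1 < / s) by (rewrite <- Rinv_1; apply Rinv_lt_contravar; lra).
    rewrite HDe1 by (unfold outside; rewrite Cmod_scis; lra).
    rewrite szego_reflect, Rinv_inv by assumption; reflexivity. }
  assert (Hout : forall s m, 1 < s ->
    fc (polar De s) m = (RtoC (powerRZ s m) * Cconj (e (- m)%Z))%C).
  { intros s m Hs.
    assert (Hi := inv_unit_interval s Hs).
    destruct (He1 (/ s) Hi) as [Hec Hef].
    rewrite (fc_ext _ (fun t => Cconj (polar (fun z => / szego w z)%C (/ s) t))).
    - rewrite fc_conj, Hef, Cmult_conj by assumption.
      rewrite powerRZ_inv', <- powerRZ_neg', Z.opp_involutive by lra.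
      f_equal; apply C_eq; simpl; ring.
    - intros t _; unfold polar; rewrite <- refl by assumption; now rewrite Rinv_inv. }
  set (sn := fun n => 1 + 1 / INR (S n)).
  assert (Hsn : forall n, 1 < sn n)
    by (intros n; unfold sn; generalize (div_INR_S_bound 1 n); lra).
  assert (Hsnl : is_lim_seq sn 1) by apply lim_one_plus.
  assert (Hone : forall m, fc (polar De 1) m = Cconj (e (- m)%Z)).
  { intros m; eapply Clim_unique.
    - apply (radial_limit_fc _ _ sn m Hrad Hsnl); [|apply Hcc; lra].
      intros n; apply Hcc; generalize (Hsn n); lra.
    - eapply Clim_ext; [|apply (Clim_powerRZ sn m _ Hsnl)].
      intros n; now rewrite Hout by apply Hsn. }
  (* Inside the circle the coefficients come from the Laurent series of [scattering w De], so
     that no Cauchy theorem is needed; letting [s -> 1] they agree with those found outside. *)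
  destruct (laurent_mult (fun s => r0 < s < 1) ((1 + r0) / 2) (scattering w De)
    (fun z => / szego w z)%C c e) as [z [Hz _]]; auto; [intros s; lra|lra|split; assumption|].
  assert (HzDe : laurent_on (fun s => r0 < s < 1) De z).
  { eapply laurent_ext; [|exact Hz]; intros s t Hs; unfold scattering.
    field; apply szego_neq_0; [assumption|rewrite Cmod_scis; lra]. }
  (* Radii increasing to 1; the factor (1 - r0) / 2 keeps all of them above r0. *)
  set (tn := fun n => 1 - (1 - r0) / 2 / INR (S n)).
  assert (Htn : forall n, r0 < tn n < 1)
    by (intros n; unfold tn; generalize (div_INR_S_bound ((1 - r0) / 2) n); lra).
  assert (Htnl : is_lim_seq tn 1) by apply lim_one_minus.
  assert (Hze : forall m, z m = Cconj (e (- m)%Z)).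
  { intros m; rewrite <- Hone; eapply Clim_unique.
    - apply (Clim_powerRZ tn m _ Htnl).
    - eapply Clim_ext; [|apply (radial_limit_fc _ _ tn m Hrad Htnl); [|apply Hcc; lra]].
      + intros n; simpl; apply HzDe, Htn.
      + intros n; apply Hcc; apply Htn. }
  assert (Hext : laurent_on (fun s => r0 < s) De (fun m => Cconj (e (- m)%Z))).
  { intros s Hs; split; [now apply Hcc|]; intros m.
    destruct (Rtotal_order s 1) as [H|[->|H]].
    - rewrite <- Hze; apply HzDe; lra.
    - rewrite Hone, powerRZ_R1; ring.
    - now apply Hout. }
  (* By reflection |D_e| at radius s times |D_i| at radius 1/s equals 1; squaring and letting s
     decrease to 1 gives |D_e|^2 w = 1. *)
  assert (Hwt0 : forall t, 0 <= t <= 2 * PI -> Cmod (De (cis t)) ^ 2 * w (cis t) = 1).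
  { intros t Ht.
    assert (Hin := fun n => inv_unit_interval (sn n) (Hsn n)).
    assert (L1 : is_lim_seq (fun n => Cmod (szego w (RtoC (/ sn n) * cis t)%C) ^ 2) (w (cis t))).
    { apply (szego_modulus_limit w t (fun n => / sn n)); auto.
      - intros n; generalize (Hin n); lra.
      - now apply lim_inv_1. }
    assert (L2 : is_lim_seq (fun n => Cmod (polar De (sn n) t)) (Cmod (De (cis t)))).
    { apply is_lim_seq_spec; intros eps.
      destruct (Hrad eps (cond_pos eps)) as [d [Hd Hb]].
      destruct (proj2 (is_lim_seq_spec _ _) Hsnl (mkposreal d Hd)) as [N HN].
      exists N; intros n Hn; specialize (Hb (sn n) t (HN n Hn) Ht); rewrite polar_1 in Hb.
      eapply Rle_lt_trans; [|exact Hb].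
      assert (T1 := Cmod_minus_triangle (polar De (sn n) t) (De (cis t)) (RtoC 0)).
      assert (T2 := Cmod_minus_triangle (De (cis t)) (polar De (sn n) t) (RtoC 0)).
      rewrite (Cmod_minus_sym (De (cis t)) (polar De (sn n) t)) in T2.
      replace (polar De (sn n) t - 0)%C with (polar De (sn n) t) in * by ring.
      replace (De (cis t) - 0)%C with (De (cis t)) in * by ring.
      apply Rabs_le; lra. }
    assert (L3 := is_lim_seq_mult' _ _ _ _ (is_lim_seq_mult' _ _ _ _ L2 L2) L1).
    apply is_lim_seq_ext with (v := fun _ => 1) in L3.
    - apply is_lim_seq_unique in L3; rewrite Lim_seq_const in L3.
      injection L3; intros E; rewrite E; simpl; ring.
    - intros n; rewrite <- (Rinv_inv (sn n)) at 1 2; unfold polar.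
      assert (HA := refl (/ sn n) t (Hin n)).
      assert (N0 : szego w (RtoC (/ sn n) * cis t)%C <> RtoC 0).
      { apply szego_neq_0; [assumption|]; rewrite Cmod_scis; generalize (Hin n); lra. }
      rewrite HA, Cmod_conj, Cmod_inv by assumption; field.
      intros E; now apply N0, Cmod_eq_0. }
  assert (Hwt : forall t, Cmod (De (cis t)) ^ 2 * w (cis t) = 1)
    by (apply periodic_reduce; [exact Hwt0|intros t; now rewrite cis_periodic]).
  assert (HnzDe : forall t, De (cis t) <> RtoC 0).
  { intros t E; generalize (Hwt t); rewrite E, Cmod_0; intros X; ring_simplify in X; lra. }
  (* A lower bound for |D_e| on the circle, obtained from an upper bound for its continuous
     reciprocal; B + 1 is positive even when B = 0. *)
  assert (Hlow : exists mu, 0 < mu /\ forall t, 0 <= t <= 2 * PI -> mu <= Cmod (polar De 1 t)).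
  { destruct (ccont_bounded _ (ccont_inv _ (Hcc 1 (proj2 Hr0))
      ltac:(intros t; rewrite polar_1; apply HnzDe))) as [B [HB Hb]].
    assert (HB' : 0 < B + 1) by lra.
    exists (/ (B + 1)); split; [now apply Rinv_0_lt_compat|]; intros t Ht; specialize (Hb t Ht).
    assert (HN : polar De 1 t <> RtoC 0) by (rewrite polar_1; apply HnzDe).
    rewrite Cmod_inv in Hb by assumption.
    rewrite <- (Rinv_inv (Cmod (polar De 1 t))).
    apply Rinv_le_contravar; [apply Rinv_0_lt_compat; now apply Cmod_gt_0|lra]. }
  destruct Hlow as [mu [Hmu Hlow]].
  assert (Hcinv : ccont (fun t => / Cconj (polar De 1 t))%C).
  { apply (ccont_inv (fun t => Cconj (polar De 1 t))).
    - apply ccont_conj, Hcc; lra.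
    - intros t E; apply (HnzDe t); rewrite <- (polar_1 De t).
      apply Cmod_eq_0; now rewrite <- Cmod_conj, E, Cmod_0. }
  (* For s > 1 the function 1 / conj D_e at radius s is D_i at radius 1/s, with coefficients dl_m
     s^{-m}; let s decrease to 1. *)
  assert (Hint : forall m, fc (fun t => / Cconj (De (cis t)))%C m = dl m).
  { intros m.
    rewrite (fc_ext _ (fun t => / Cconj (polar De 1 t))%C) by (intros t _; now rewrite polar_1).
    assert (Hin := fun n => inv_unit_interval (sn n) (Hsn n)).
    assert (Eq : forall n t, (/ Cconj (polar De (sn n) t))%C = polar (szego w) (/ sn n) t).
    { intros n t; unfold polar; rewrite <- (Rinv_inv (sn n)) at 1.
      rewrite refl, Cconj_conj by apply Hin.
      field; apply szego_neq_0; [assumption|].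
      rewrite Cmod_scis; generalize (Hin n); lra. }
    eapply Clim_unique.
    - apply (radial_limit_fc _ _ sn m (radial_limit_conj_inv _ _ mu Hmu Hlow Hrad) Hsnl);
        [|exact Hcinv].
      intros n; apply (ccont_ext (polar (szego w) (/ sn n))); [intros t; now rewrite Eq|].
      apply Hdl1, Hin.
    - eapply Clim_ext; [|apply (Clim_powerRZ (fun n => / sn n) m _ (lim_inv_1 _ Hsnl))].
      intros n; simpl.
      rewrite (fc_ext _ (polar (szego w) (/ sn n))) by (intros t _; apply Eq).
      symmetry; apply Hdl1, Hin. }
  constructor; try assumption.
  - split; assumption.
  - split; assumption.
  - intros t; rewrite <- Cmod2_conj, <- RtoC_mult, Hwt; reflexivity.
Qed.

(** * Continuously differentiable functions on the circle *)

Lemma ccont_ext_boundary (De : C -> C) (r0 : R) (g : Z -> C) :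
  r0 < 1 -> laurent_on (fun s => r0 < s) De g -> ccont (fun t => De (cis t)).
Proof.
  intros Hr HL; apply (ccont_ext (polar De 1)); [apply polar_1|now apply HL].
Qed.

Lemma sd_nonzero w De c r0 e dl (t : R) :
  szego_data w De c r0 e dl -> De (cis t) <> RtoC 0.
Proof.
  intros [_ _ _ _ _ _ Hw _ _] E; specialize (Hw t); rewrite E in Hw.
  apply R1_neq_R0, RtoC_inj; rewrite <- Hw; ring.
Qed.

Lemma conj_neq_0 (z : C) : z <> RtoC 0 -> Cconj z <> RtoC 0.
Proof. intros H E; apply H, Cmod_eq_0; now rewrite <- Cmod_conj, E, Cmod_0. Qed.

Lemma ext_series_1 w De c r0 e dl :
  0 <= r0 < 1 -> szego_data w De c r0 e dl ->
  ulim (psum (fun k => Cconj (e (Z.of_nat k))) (fun k => (- Z.of_nat k)%Z))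
    (fun t => De (cis t)).
Proof.
  intros Hr0 HD.
  destruct (ext_series De r0 1 e Hr0 (sd_ext HD) (proj2 (sd_inv HD)))
    as [x [Hx Hb]].
  exists x; split; [assumption|]; intros n t Ht; rewrite <- polar_1, <- (Hb n t Ht).
  right; f_equal; f_equal; unfold psum; apply sum_n_ext; intros k.
  rewrite powerRZ_R1; Ceq; ring.
Qed.

(** Inside the annulus and on the unit circle the convolution gives the same radius-free sum of
    conj(e_k) dl_{m+k}. Thus the coefficients of F survive at |z| = 1, where [scattering] itself is
    not meaningful. *)
Lemma scattering_boundary w De c r0 e dl (m : Z) :
  0 <= r0 < 1 -> szego_data w De c r0 e dl ->
  fc (fun t => / Cconj (De (cis t)) * De (cis t))%C m = c m.
Proof.
  intros Hr0 HD.
  assert (HDb := ccont_ext_boundary De r0 _ (proj2 Hr0) (sd_ext HD)).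
  assert (Hi : ccont (fun t => / Cconj (De (cis t)))%C).
  { apply (ccont_inv (fun t => Cconj (De (cis t)))); [now apply ccont_conj|].
    intros t; eapply conj_neq_0, sd_nonzero, HD. }
  set (s := (1 + r0) / 2); assert (Hs : r0 < s < 1) by (unfold s; lra).
  assert (Hs01 : 0 < s < 1) by lra.
  destruct (sd_scat HD s Hs) as [HcF HfF].
  destruct (proj1 (sd_disc HD) s Hs01) as [HcS HfS].
  destruct (sd_ext HD s (proj1 Hs)) as [HcD _].
  assert (Hp : powerRZ s m <> 0) by (apply Rgt_not_eq, powerRZ_pos; lra).
  assert (L1 := fc_mult_series _ _ _ _ m HcS HcD (ext_series De r0 s e
    ltac:(lra) (sd_ext HD) (proj2 (sd_inv HD)))).
  assert (L2 := fc_mult_series _ _ _ _ m Hi HDb (ext_series_1 _ _ _ _ _ _ Hr0 HD)).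
  assert (E : fc (fun t => polar (szego w) s t * polar De s t)%C m
     = (RtoC (powerRZ s m) * c m)%C) by exact (HfF m).
  rewrite E in L1.
  eapply Clim_unique; [exact L2|].
  replace (c m) with (RtoC (/ powerRZ s m) * (RtoC (powerRZ s m) * c m))%C
    by (rewrite Cmult_assoc, <- RtoC_mult, Rinv_l by assumption; ring).
  eapply Clim_ext; [|apply Clim_scal, L1].
  intros n; simpl; rewrite <- sum_n_C_mult_l; apply sum_n_ext; intros k.
  rewrite (sd_int HD), HfS.
  transitivity (RtoC (/ powerRZ s m) * (RtoC (powerRZ s (- Z.of_nat k))
    * RtoC (powerRZ s (m - - Z.of_nat k)))
    * (Cconj (e (Z.of_nat k)) * dl (m - - Z.of_nat k)%Z))%C; [Ceq; ring|].
  rewrite powerRZ_minus_C, <- RtoC_mult, Rinv_l by lra; Ceq; ring.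
Qed.

Definition cderiv (f f' : R -> C) : Prop :=
  forall t, is_derive (fun u => Re (f u)) t (Re (f' t)) /\
            is_derive (fun u => Im (f u)) t (Im (f' t)).

Lemma cderiv_ext (f g f' g' : R -> C) :
  (forall t, f t = g t) -> (forall t, f' t = g' t) -> cderiv f f' -> cderiv g g'.
Proof.
  intros E E' H t; destruct (H t) as [H1 H2]; split.
  - rewrite <- E'; apply (is_derive_ext (fun u => Re (f u))); [intros u; now rewrite E|exact H1].
  - rewrite <- E'; apply (is_derive_ext (fun u => Im (f u))); [intros u; now rewrite E|exact H2].
Qed.

Lemma cderiv_plus (f g f' g' : R -> C) :
  cderiv f f' -> cderiv g g' -> cderiv (fun t => f t + g t)%C (fun t => f' t + g' t)%C.
Proof.
  intros Hf Hg t; destruct (Hf t) as [H1 H2], (Hg t) as [H3 H4]; split.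
  - exact (is_derive_plus _ _ _ _ _ H1 H3).
  - exact (is_derive_plus _ _ _ _ _ H2 H4).
Qed.

Lemma cderiv_mult (f g f' g' : R -> C) :
  cderiv f f' -> cderiv g g' ->
  cderiv (fun t => f t * g t)%C (fun t => f' t * g t + f t * g' t)%C.
Proof.
  intros Hf Hg t; destruct (Hf t) as [H1 H2], (Hg t) as [H3 H4]; split.
  - assert (A := is_derive_mult _ _ _ _ _ H1 H3 Rmult_comm).
    assert (B := is_derive_mult _ _ _ _ _ H2 H4 Rmult_comm).
    assert (D := is_derive_minus _ _ _ _ _ A B).
    match type of D with is_derive _ _ ?x =>
      replace (Re (f' t * g t + f t * g' t)%C) with x end; [exact D|].
    unfold Re, Im, plus, minus, opp, mult; simpl; unfold plus, mult; simpl; ring.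
  - assert (A := is_derive_mult _ _ _ _ _ H1 H4 Rmult_comm).
    assert (B := is_derive_mult _ _ _ _ _ H2 H3 Rmult_comm).
    assert (D := is_derive_plus _ _ _ _ _ A B).
    match type of D with is_derive _ _ ?x =>
      replace (Im (f' t * g t + f t * g' t)%C) with x end; [exact D|].
    unfold Re, Im, plus, minus, opp, mult; simpl; unfold plus, mult; simpl; ring.
Qed.

Lemma cderiv_const (c : C) : cderiv (fun _ => c) (fun _ => RtoC 0).
Proof. intros t; split; apply (is_derive_const (K := R_AbsRing) (V := R_NormedModule)). Qed.

Lemma cderiv_ek (k : Z) : cderiv (ek k) (fun t => Ci * RtoC (IZR k) * ek k t)%C.
Proof.
  intros t; split; unfold ek, cis, Re, Im; simpl.
  - auto_derive; [exact I|]; ring.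
  - auto_derive; [exact I|]; ring.
Qed.

Lemma cderiv_psum (g : nat -> C) (sg : nat -> Z) (n : nat) :
  cderiv (psum g sg n) (psum (fun k => Ci * RtoC (IZR (sg k)) * g k)%C sg n).
Proof.
  assert (H : forall c k, cderiv (fun t => c * ek k t)%C
    (fun t => Ci * RtoC (IZR k) * c * ek k t)%C).
  { intros c k; eapply cderiv_ext; [| |exact (cderiv_mult _ _ _ _ (cderiv_const c) (cderiv_ek k))].
    - reflexivity.
    - intros t; simpl; ring. }
  unfold psum; induction n as [|n IH].
  - eapply cderiv_ext; [| |apply (H (g O) (sg O))]; intros t; now rewrite sum_O.
  - eapply cderiv_ext; [| |apply (cderiv_plus _ _ _ _ IH (H (g (S n)) (sg (S n))))];
      intros t; now rewrite sum_n_C_S.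
Qed.

(** Recasts [CVU_Derive], which speaks of [Lim_seq], in terms of named limits and explicit uniform
    rates. *)
Lemma termwise_derive (F G : nat -> R -> R) (f g : R -> R) (x y : nat -> R) :
  (forall n t, is_derive (F n) t (G n t)) -> (forall n t, continuous (G n) t) ->
  is_lim_seq x 0 -> is_lim_seq y 0 ->
  (forall n t, Rabs (F n t - f t) <= x n) -> (forall n t, Rabs (G n t - g t) <= y n) ->
  forall t, is_derive f t (g t).
Proof.
  intros HD HC Hx Hy HF HG t.
  assert (lim : forall (U : nat -> R -> R) u (z : nat -> R), is_lim_seq z 0 ->
     (forall n t, Rabs (U n t - u t) <= z n) -> forall t, is_lim_seq (fun n => U n t) (u t)).
  { intros U u z Hz HU s.
    apply is_lim_seq_ext with (fun n => (U n s - u s) + u s); [intros n; ring|].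
    replace (Finite (u s)) with (Finite (0 + u s)) by (f_equal; ring).
    apply is_lim_seq_plus'; [|apply is_lim_seq_const].
    apply (proj2 (is_lim_seq_abs_0 _)), lim_squeeze_0 with z; [|assumption].
    intros n; split; [apply Rabs_pos|apply HU]. }
  assert (EG : forall n t, Derive (F n) t = G n t) by (intros n s; now apply is_derive_unique).
  assert (LF : forall t, real (Lim_seq (fun n => F n t)) = f t).
  { intros s; now rewrite (is_lim_seq_unique _ _ (lim F f x Hx HF s)). }
  assert (LG : forall t, real (Lim_seq (fun n => Derive (F n) t)) = g t).
  { intros s; rewrite (Lim_seq_ext _ (fun n => G n s)) by (intros n; apply EG).
    now rewrite (is_lim_seq_unique _ _ (lim G g y Hy HG s)). }
  assert (cvu : forall (U : nat -> R -> R) (u : R -> R) (z : nat -> R), is_lim_seq z 0 ->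
     (forall n t, Rabs (U n t - u t) <= z n) -> (forall t, real (Lim_seq (fun n => U n t)) = u t) ->
     CVU_dom U (fun _ => True)).
  { intros U u z Hz HU HL eps.
    destruct (proj2 (is_lim_seq_spec _ _) Hz eps) as [N HN].
    exists N; intros n Hn s _; rewrite HL; specialize (HN n Hn).
    rewrite Rminus_0_r in HN; apply Rabs_lt_between in HN.
    generalize (HU n s); lra. }
  assert (HGd : forall n t, Rabs (Derive (F n) t - g t) <= y n)
    by (intros n s; rewrite EG; apply HG).
  assert (R := CVU_Derive F (fun _ => True) open_true
    ltac:(intros a b s _ _ _; exact I) (cvu F f x Hx HF LF)
    ltac:(intros n s _; eexists; apply HD)
    ltac:(intros n s _; apply continuity_pt_filterlim;
          apply (continuous_ext (G n)); [intros v; symmetry; apply EG|apply HC])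
    (cvu (fun n => Derive (F n)) g y Hy HGd LG) t I).
  rewrite LG in R; eapply is_derive_ext; [|exact R]; intros s; simpl; apply LF.
Qed.

Lemma cderiv_tsum (g : nat -> C) (sg : nat -> Z) :
  ex_series (fun k => Cmod (g k)) ->
  ex_series (fun k => Cmod (Ci * RtoC (IZR (sg k)) * g k)%C) ->
  cderiv (tsum g sg) (tsum (fun k => Ci * RtoC (IZR (sg k)) * g k)%C sg).
Proof.
  intros H1 H2.
  set (g' := fun k => (Ci * RtoC (IZR (sg k)) * g k)%C) in *.
  intros t; split.
  - refine (termwise_derive (fun n t => Re (psum g sg n t)) (fun n t => Re (psum g' sg n t))
      (fun t => Re (tsum g sg t)) (fun t => Re (tsum g' sg t)) _ _ _ _
      (Series_tail_lim _ H1) (Series_tail_lim _ H2) _ _ t).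
    + intros n s; exact (proj1 (cderiv_psum g sg n s)).
    + intros n s; exact (proj1 (ccont_psum g' sg n s)).
    + intros n s; eapply Rle_trans; [|apply (tsum_tail g sg n s H1)].
      eapply Rle_trans; [|apply re_le_Cmod]; right; reflexivity.
    + intros n s; eapply Rle_trans; [|apply (tsum_tail g' sg n s H2)].
      eapply Rle_trans; [|apply re_le_Cmod]; right; reflexivity.
  - refine (termwise_derive (fun n t => Im (psum g sg n t)) (fun n t => Im (psum g' sg n t))
      (fun t => Im (tsum g sg t)) (fun t => Im (tsum g' sg t)) _ _ _ _
      (Series_tail_lim _ H1) (Series_tail_lim _ H2) _ _ t).
    + intros n s; exact (proj2 (cderiv_psum g sg n s)).
    + intros n s; exact (proj2 (ccont_psum g' sg n s)).
    + intros n s; eapply Rle_trans; [|apply (tsum_tail g sg n s H1)].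
      eapply Rle_trans; [|apply im_le_Cmod]; right; reflexivity.
    + intros n s; eapply Rle_trans; [|apply (tsum_tail g' sg n s H2)].
      eapply Rle_trans; [|apply im_le_Cmod]; right; reflexivity.
Qed.

Lemma mean_cderiv_0 (f f' : R -> C) :
  cderiv f f' -> ccont f' -> f (2 * PI) = f 0 -> mean f' = RtoC 0.
Proof.
  intros Hd Hc Hp; unfold mean.
  assert (A : is_RInt (fun t => Re (f' t)) 0 (2 * PI) (minus (Re (f (2 * PI))) (Re (f 0)))).
  { apply (is_RInt_derive (V := R_CompleteNormedModule) (fun t => Re (f t)));
      intros t _; [apply Hd|exact (proj1 (Hc t))]. }
  assert (B : is_RInt (fun t => Im (f' t)) 0 (2 * PI) (minus (Im (f (2 * PI))) (Im (f 0)))).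
  { apply (is_RInt_derive (V := R_CompleteNormedModule) (fun t => Im (f t)));
      intros t _; [apply Hd|exact (proj2 (Hc t))]. }
  rewrite (is_RInt_unique _ _ _ _ A), (is_RInt_unique _ _ _ _ B), Hp.
  apply C_eq; unfold Re, Im, minus, plus, opp; simpl; Req; ring.
Qed.

(** Integration by parts: the derivative of f e^{-ikt} has mean zero by periodicity. *)
Lemma fc_cderiv (f f' : R -> C) (k : Z) :
  cderiv f f' -> ccont f -> ccont f' -> (forall t, f (t + 2 * PI) = f t) ->
  fc f' k = (Ci * RtoC (IZR k) * fc f k)%C.
Proof.
  intros Hd Hc Hc' Hp.
  assert (H := cderiv_mult _ _ _ _ Hd (cderiv_ek (- k))).
  apply mean_cderiv_0 in H.
  - rewrite mean_plus in H by ccont_tac.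
    rewrite (mean_ext (fun t => f t * (Ci * RtoC (IZR (- k)) * ek (- k) t))%C
      (fun t => (Ci * RtoC (IZR (- k))) * (f t * ek (- k) t))%C) in H
      by (intros t _; ring).
    rewrite mean_scal in H by ccont_tac.
    fold (fc f' k) in H; fold (fc f k) in H.
    rewrite opp_IZR, RtoC_opp in H.
    replace (fc f' k) with (fc f' k + Ci * - IZR k * fc f k + Ci * IZR k * fc f k)%C by ring.
    rewrite H; ring.
  - ccont_tac.
  - generalize (Hp 0); rewrite Rplus_0_l; intros ->.
    rewrite <- (cis_2PI 0 (- k)), Rplus_0_l; reflexivity.
Qed.

Lemma ex_series_bounded (u : nat -> R) (M : R) :
  (forall n, 0 <= u n) -> (forall n, sum_n u n <= M) -> ex_series u.
Proof.
  intros H0 HM.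
  destruct (ex_finite_lim_seq_incr (sum_n u) M) as [l Hl]; [|exact HM|exists l; exact Hl].
  intros n; rewrite sum_Sn; unfold plus; simpl; generalize (H0 (S n)); lra.
Qed.

(** Telescoping with 1 / (x + 1)^2 <= 1 / x - 1 / (x + 1); the subtracted term makes the induction
    close. *)
Lemma sum_inv_sqr_bound (n : nat) :
  sum_n (fun k => / INR (S k) ^ 2) n <= 2 - / INR (S n).
Proof.
  induction n as [|n IH].
  - rewrite sum_O; simpl; lra.
  - rewrite sum_Sn; unfold plus; simpl AbelianMonoid.plus.
    apply Rle_trans with (2 - / INR (S n) + / INR (S (S n)) ^ 2);
      [apply Rplus_le_compat_r; exact IH|].
    rewrite (S_INR (S n)); assert (H : 0 < INR (S n)) by (apply lt_0_INR; lia).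
    set (x := INR (S n)) in *.
    assert (E : / x - / (x + 1) - / (x + 1) ^ 2 = / (x * (x + 1) ^ 2)) by (field; lra).
    assert (P : 0 < / (x * (x + 1) ^ 2)).
    { apply Rinv_0_lt_compat, Rmult_lt_0_compat; [lra|apply pow_lt; lra]. }
    lra.
Qed.

(** The coefficient of f at -j has modulus 1/j times that of f', hence at most half of 1/j^2 plus
    the squared coefficient of f'; Bessel's inequality sums the latter. *)
Lemma c1_summable (f f' : R -> C) :
  cderiv f f' -> ccont f -> ccont f' -> (forall t, f (t + 2 * PI) = f t) ->
  ex_series (fun k => Cmod (fc f (- Z.of_nat (S k)))).
Proof.
  intros Hd Hc Hc' Hp.
  apply (ex_series_le (V := R_CompleteNormedModule) _
    (fun k => / 2 * (/ INR (S k) ^ 2 + Cmod (fc f' (- Z.of_nat (S k))) ^ 2))).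
  - intros k; change (norm (Cmod (fc f (- Z.of_nat (S k)))))
      with (Rabs (Cmod (fc f (- Z.of_nat (S k))))).
    rewrite Rabs_pos_eq by apply Cmod_ge_0.
    rewrite (fc_cderiv f f' _ Hd Hc Hc' Hp), !Cmod_mult, Cmod_Ci, Cmod_R.
    rewrite opp_IZR, Rabs_Ropp, <- INR_IZR_INZ, Rabs_pos_eq, Rmult_1_l by apply pos_INR.
    set (x := INR (S k)); set (y := Cmod _).
    assert (Hx : 0 < x) by (apply lt_0_INR; lia).
    assert (Sq := pow2_ge_0 (/ x - x * y)).
    replace ((/ x - x * y) ^ 2) with (/ x ^ 2 + (x * y) ^ 2 - 2 * y) in Sq by (field; lra); lra.
  - apply (ex_series_scal_l (K := R_AbsRing) (/ 2)
      (fun k => / INR (S k) ^ 2 + Cmod (fc f' (- Z.of_nat (S k))) ^ 2)).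
    apply (ex_series_plus (K := R_AbsRing) (V := R_NormedModule)
      (fun k => / INR (S k) ^ 2) (fun k => Cmod (fc f' (- Z.of_nat (S k))) ^ 2)).
    + apply (ex_series_bounded _ 2).
      * intros n; apply Rlt_le, Rinv_0_lt_compat, pow_lt, lt_0_INR; lia.
      * intros n; eapply Rle_trans; [apply sum_inv_sqr_bound|].
        assert (0 < / INR (S n)) by (apply Rinv_0_lt_compat, lt_0_INR; lia); lra.
    + apply (ex_series_bounded _ (nsq f')).
      * intros n; apply pow2_ge_0.
      * intros n; apply (bessel_le f' (fun k => (- Z.of_nat (S k))%Z)); [assumption|].
        intros i j; lia.
Qed.

(** * The orthonormal polynomials *)

Lemma sum_n_C_last (u : nat -> C) (n : nat) :
  (forall k, (k < n)%nat -> u k = RtoC 0) -> sum_n u n = u n.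
Proof.
  intros H; destruct n as [|n]; [apply sum_O|].
  rewrite sum_n_C_S, sum_n_C_zero; [Ceq; ring|]; intros k Hk; apply H; lia.
Qed.

Lemma psum_conj (g : nat -> C) (sg : nat -> Z) (n : nat) (t : R) :
  Cconj (psum g sg n t) = psum (fun k => Cconj (g k)) (fun k => (- sg k)%Z) n t.
Proof.
  unfold psum; induction n as [|n IH].
  - rewrite !sum_O, Cmult_conj, ek_conj; reflexivity.
  - rewrite !sum_n_C_S, Cplus_conj, IH, Cmult_conj, ek_conj; reflexivity.
Qed.

Lemma ek_mult_psum (g : nat -> C) (sg : nat -> Z) (j : Z) (n : nat) (t : R) :
  (ek j t * psum g sg n t)%C = psum g (fun k => (j + sg k)%Z) n t.
Proof.
  unfold psum; rewrite <- sum_n_C_mult_l; apply sum_n_ext; intros k.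
  rewrite ek_add; Ceq; ring.
Qed.

(** Bernoulli's inequality for the k-th power of 1/q. *)
Lemma INR_geom_bound (q : R) (k : nat) :
  0 < q < 1 -> INR k * q ^ k <= q / (1 - q).
Proof.
  intros Hq; assert (H : 0 < 1 / q - 1).
  { assert (1 < / q) by (rewrite <- Rinv_1; apply Rinv_lt_contravar; lra); lra. }
  assert (P := poly k (1 / q - 1) H).
  replace (1 + (1 / q - 1)) with (/ q) in P by (field; lra).
  assert (Hk : 0 < q ^ k) by (apply pow_lt; lra).
  rewrite pow_inv in P.
  apply Rmult_le_compat_r with (r := q ^ k) in P; [|lra].
  rewrite Rinv_l in P by lra.
  apply Rmult_le_reg_r with (1 / q - 1); [assumption|].
  replace (q / (1 - q) * (1 / q - 1)) with 1 by (field; lra); nra.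
Qed.

Lemma laurent_neg_coef_bound (f : R -> C) (g : Z -> C) (r B : R) (k : nat) :
  ccont f -> 0 < r -> 0 <= B -> (forall t, 0 <= t <= 2 * PI -> Cmod (f t) <= B) ->
  (forall m, fc f m = (RtoC (powerRZ r m) * g m)%C) ->
  Cmod (g (- Z.of_nat k)%Z) <= B * r ^ k.
Proof.
  intros Hc Hr HB Hb Hf.
  assert (X := Cmod_fc_le f (- Z.of_nat k) B Hc HB Hb).
  assert (H : 0 < r ^ k) by now apply pow_lt.
  rewrite Hf, Cmod_mult, powerRZ_neg', <- pow_powerRZ, Cmod_R in X by lra.
  rewrite Rabs_pos_eq, Rmult_comm in X by (apply Rlt_le; now apply Rinv_0_lt_compat).
  now apply Rle_div_l in X.
Qed.

(** The e_k are conjugates of the coefficients of D_e at -k, so continuation of D_e down to radius s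
    makes them decay like s^k. *)
Lemma szego_coef_bound w De c r0 e dl (s : R) :
  0 <= r0 -> r0 < s -> szego_data w De c r0 e dl ->
  exists B, 0 <= B /\ forall k, Cmod (e (Z.of_nat k)) <= B * s ^ k.
Proof.
  intros Hr0 Hs HD; destruct (sd_ext HD s Hs) as [Hc Hf].
  destruct (ccont_bounded _ Hc) as [B [HB Hb]]; exists B; split; [assumption|]; intros k.
  assert (X := laurent_neg_coef_bound _ _ s B k Hc ltac:(lra) HB Hb Hf).
  cbv beta in X; now rewrite Z.opp_involutive, Cmod_conj in X.
Qed.

Lemma ext_boundary_C1 w De c r0 e dl :
  0 <= r0 < 1 -> szego_data w De c r0 e dl ->
  exists D', ccont D' /\ cderiv (fun t => De (cis t)) D'.
Proof.
  intros Hr0 HD.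
  set (g := fun k => Cconj (e (Z.of_nat k))); set (sg := fun k => (- Z.of_nat k)%Z).
  set (s := (r0 + 1) / 2); assert (Hs : r0 < s < 1) by (unfold s; lra).
  (* The gap between s and q absorbs the factor k produced by differentiation, since k (s / q)^k is
     bounded. *)
  set (q := (s + 1) / 2); assert (Hq : s < q < 1) by (unfold q; lra).
  destruct (szego_coef_bound w De c r0 e dl s (proj1 Hr0) (proj1 Hs) HD) as [B [HB Hb]].
  assert (S1 : ex_series (fun k => Cmod (g k))).
  { apply (ex_series_geom_bound _ B s); [lra|].
    intros k; unfold g; rewrite Cmod_conj; apply Hb. }
  assert (S2 : ex_series (fun k => Cmod (Ci * RtoC (IZR (sg k)) * g k)%C)).
  { apply (ex_series_geom_bound _ (B * (s / q / (1 - s / q))) q); [lra|].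
    intros k; unfold g, sg; rewrite !Cmod_mult, Cmod_Ci, Cmod_R, Cmod_conj.
    rewrite opp_IZR, Rabs_Ropp, <- INR_IZR_INZ, Rabs_pos_eq, Rmult_1_l by apply pos_INR.
    assert (Hsq : 0 < s / q < 1).
    { split; [apply Rdiv_lt_0_compat; lra|].
      apply Rmult_lt_reg_r with q; [lra|]; replace (s / q * q) with s by (field; lra); lra. }
    assert (X := INR_geom_bound (s / q) k Hsq).
    assert (Hqk : 0 < q ^ k) by (apply pow_lt; lra).
    apply Rle_trans with (INR k * (B * s ^ k)).
    - apply Rmult_le_compat_l; [apply pos_INR|apply Hb].
    - replace (INR k * (B * s ^ k)) with (B * (INR k * (s / q) ^ k) * q ^ k)
        by (unfold Rdiv; rewrite Rpow_mult_distr, pow_inv; field; lra).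
      apply Rmult_le_compat_r; [lra|]; now apply Rmult_le_compat_l. }
  assert (E : forall t, tsum g sg t = De (cis t)).
  { apply periodic_reduce.
    - intros t Ht; eapply Clim_unique with (u := fun n => psum g sg n t).
      + destruct (ulim_tsum g sg S1) as [x [Hx Hbx]].
        eapply Clim_bound; [|exact Hx]; intros n; now apply Hbx.
      + destruct (ext_series_1 _ _ _ _ _ _ Hr0 HD) as [x [Hx Hbx]].
        eapply Clim_bound; [|exact Hx]; intros n; exact (Hbx n t Ht).
    - intros t; now rewrite tsum_periodic, cis_periodic. }
  exists (tsum (fun k => Ci * RtoC (IZR (sg k)) * g k)%C sg); split; [now apply ccont_tsum|].
  eapply cderiv_ext; [exact E|reflexivity|now apply cderiv_tsum].
Qed.

(** On the circle w = 1 / |D_e|^2. The smoothness is wanted so that the negative part of phi_n w is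
    absolutely summable. *)
Lemma weight_C1 w De c r0 e dl :
  positive_analytic_weight w -> 0 <= r0 < 1 -> szego_data w De c r0 e dl ->
  exists W', ccont W' /\ cderiv (fun t => RtoC (w (cis t))) W'.
Proof.
  intros Hw Hr0 HD.
  destruct (ext_boundary_C1 w De c r0 e dl Hr0 HD) as [D' [Hc' Hd]].
  assert (Hc := ccont_ext_boundary De r0 _ (proj2 Hr0) (sd_ext HD)).
  assert (HW := ccont_RtoC _ (weight_continuous w Hw)).
  set (D := fun t => De (cis t)) in *.
  set (N := fun t => Re (D t) ^ 2 + Im (D t) ^ 2).
  assert (HN : forall t, w (cis t) = / N t).
  { intros t; assert (X := sd_weight HD t).
    rewrite <- Cmod2_conj, <- RtoC_mult in X; apply RtoC_inj in X.
    rewrite Cmod2_alt in X; change (N t * w (cis t) = 1) in X.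
    assert (N t <> 0) by (intros E; rewrite E in X; lra).
    apply Rmult_eq_reg_l with (N t); [|assumption]; rewrite Rinv_r by assumption; exact X. }
  assert (HN0 : forall t, N t <> 0).
  { intros t E; generalize (weight_pos w t Hw); rewrite HN, E, Rinv_0; lra. }
  exists (fun t => RtoC (- (Re (D' t * Cconj (D t) + D t * Cconj (D' t))%C
            * (w (cis t) * w (cis t))))); split.
  - apply (ccont_ext (fun t => - (RtoC (Re (D' t * Cconj (D t) + D t * Cconj (D' t))%C)
            * (RtoC (w (cis t)) * RtoC (w (cis t)))))%C);
      [intros t; now rewrite RtoC_opp, !RtoC_mult|].
    assert (HR : ccont (fun t => RtoC (Re (D' t * Cconj (D t) + D t * Cconj (D' t))%C))).
    { assert (X : ccont (fun t => D' t * Cconj (D t) + D t * Cconj (D' t))%C) by ccont_tac.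
      intros t; split; [exact (proj1 (X t))|apply continuous_const]. }
    ccont_tac.
  - intros t; split; [|exact (is_derive_const (K := R_AbsRing) (V := R_NormedModule) 0 t)].
    apply (is_derive_ext (fun u => / N u)); [intros u; symmetry; exact (HN u)|].
    destruct (Hd t) as [H1 H2].
    assert (A1 := is_derive_pow _ 2 _ _ H1); assert (A2 := is_derive_pow _ 2 _ _ H2).
    assert (A3 := is_derive_inv _ _ _ (is_derive_plus _ _ _ _ _ A1 A2) (HN0 t)).
    match type of A3 with is_derive _ _ ?x =>
      replace (Re (RtoC (- (Re (D' t * Cconj (D t) + D t * Cconj (D' t))%C
            * (w (cis t) * w (cis t)))))) with x end; [exact A3|].
    rewrite HN; unfold N.
    specialize (HN0 t); unfold N in HN0.
    unfold Re, Im, plus in *; simpl in *; unfold plus in *; simpl in *; field.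
    intros E; apply HN0; rewrite <- E; ring.
Qed.

Definition pcirc (a : nat -> nat -> C) (n : nat) : R -> C := psum (a n) Z.of_nat n.

Lemma pcirc_eval (a : nat -> nat -> C) (n : nat) (t : R) :
  pcirc a n t = poly_eval a n (1 * cis t)%C.
Proof.
  unfold pcirc, psum, poly_eval; apply sum_n_ext; intros k; now rewrite ek_nat, Cmult_1_l.
Qed.

Lemma orthonormal_mean (w : C -> R) (a : nat -> nat -> C) (kappa : nat -> R) (n m : nat) :
  positive_analytic_weight w -> orthonormal_polynomials w a kappa ->
  mean (fun t => pcirc a n t * RtoC (w (cis t)) * Cconj (pcirc a m t))%C
  = RtoC (if Nat.eqb n m then / (2 * PI) else 0).
Proof.
  intros Hw [_ Ho]; assert (Hp := two_PI_pos).
  specialize (Ho n m); unfold arclength_int in Ho.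
  assert (HW := ccont_RtoC _ (weight_continuous w Hw)).
  assert (Hn := ccont_psum (a n) Z.of_nat n); assert (Hm := ccont_psum (a m) Z.of_nat m).
  fold (pcirc a n) in Hn; fold (pcirc a m) in Hm.
  set (F := fun t => (pcirc a n t * RtoC (w (cis t)) * Cconj (pcirc a m t))%C).
  assert (HF : ccont F) by (unfold F; ccont_tac).
  assert (E : forall t, F t = (poly_eval a n (RtoC 1 * cis t) *
     Cconj (poly_eval a m (RtoC 1 * cis t)) * RtoC (w (RtoC 1 * cis t)%C) * RtoC 1)%C).
  { intros t; unfold F; rewrite !pcirc_eval, (Cmult_1_l (cis t)); ring. }
  rewrite CInt_mean in Ho by (exact (ccont_ext F _ E HF)).
  rewrite <- (mean_ext F) in Ho by (intros t _; apply E).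
  replace (mean F) with (RtoC (/ (2 * PI)) * (RtoC (2 * PI) * mean F))%C.
  - rewrite Ho, <- RtoC_mult; f_equal; destruct (Nat.eqb n m); ring.
  - rewrite Cmult_assoc, <- RtoC_mult, Rinv_l by lra; ring.
Qed.

(** Orthogonality to the polynomials phi_j is a triangular system for the coefficients of phi_n w,
    with nonzero diagonal kappa_j. The value at n follows from kappa_n times it being 1 / (2 pi). *)
Lemma orthonormal_fc (w : C -> R) (a : nat -> nat -> C) (kappa : nat -> R) (n : nat) :
  positive_analytic_weight w -> orthonormal_polynomials w a kappa ->
  (forall j, (j < n)%nat -> fc (fun t => pcirc a n t * RtoC (w (cis t)))%C (Z.of_nat j) = RtoC 0) /\
  fc (fun t => pcirc a n t * RtoC (w (cis t)))%C (Z.of_nat n) = RtoC (/ (2 * PI * kappa n)).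
Proof.
  intros Hw Ho; assert (Hp := two_PI_pos).
  assert (HW := ccont_RtoC _ (weight_continuous w Hw)).
  assert (Hn := ccont_psum (a n) Z.of_nat n); fold (pcirc a n) in Hn.
  set (psi := fun t => (pcirc a n t * RtoC (w (cis t)))%C).
  assert (Hpsi : ccont psi) by (unfold psi; ccont_tac).
  assert (E : forall m, sum_n (fun k => Cconj (a m k) * fc psi (Z.of_nat k))%C m
     = RtoC (if Nat.eqb n m then / (2 * PI) else 0)).
  { intros m; rewrite <- (orthonormal_mean w a kappa n m Hw Ho), mean_fc.
    rewrite (fc_ext _ (fun t => psi t *
      psum (fun k => Cconj (a m k)) (fun k => (- Z.of_nat k)%Z) m t)%C).
    - rewrite fc_mult_psum by assumption.
      apply sum_n_ext; intros k; do 2 f_equal; lia.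
    - intros t _; unfold psi, pcirc; now rewrite psum_conj. }
  assert (Hlow : forall j, (j < n)%nat -> fc psi (Z.of_nat j) = RtoC 0).
  { intros j; induction j as [j IH] using (well_founded_induction lt_wf); intros Hj.
    specialize (E j); rewrite sum_n_C_last in E.
    - destruct (Nat.eqb_spec n j); [lia|].
      destruct (proj1 Ho j) as [Hk Ha]; rewrite Ha in E.
      replace (Cconj (RtoC (kappa j))) with (RtoC (kappa j)) in E by (apply C_eq; simpl; ring).
      replace (fc psi (Z.of_nat j)) with (/ RtoC (kappa j) * (RtoC (kappa j) * fc psi (Z.of_nat j)))%C
        by (field; apply RtoC_neq_0; lra).
      rewrite E; ring.
    - intros k Hk; rewrite IH by lia; ring. }
  split; [exact Hlow|].
  specialize (E n); rewrite sum_n_C_last in E.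
  - rewrite Nat.eqb_refl in E.
    destruct (proj1 Ho n) as [Hk Ha]; rewrite Ha in E.
    replace (Cconj (RtoC (kappa n))) with (RtoC (kappa n)) in E by (apply C_eq; simpl; ring).
    replace (fc psi (Z.of_nat n)) with (/ RtoC (kappa n) * (RtoC (kappa n) * fc psi (Z.of_nat n)))%C
      by (field; apply RtoC_neq_0; lra).
    rewrite E, <- RtoC_inv, <- RtoC_mult by lra; f_equal; field; lra.
  - intros k Hk; rewrite Hlow by assumption; ring.
Qed.

(** Continuation of a product from |z| = 1 to |z| = r on the level of coefficients: if each factor
    scales by r^m, so does the product. *)
Lemma dilate_product (f fr : R -> C) (g : Z -> C) (b : nat -> C) (sg : nat -> Z) (r : R) (m : Z) :
  0 < r -> ccont f -> ccont fr ->
  (forall i, fc f i = g i) -> (forall i, fc fr i = (RtoC (powerRZ r i) * g i)%C) ->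
  ex_series (fun k => Cmod (b k)) ->
  ex_series (fun k => Cmod (b k * RtoC (powerRZ r (sg k)))%C) ->
  fc (fun t => fr t * tsum (fun k => b k * RtoC (powerRZ r (sg k)))%C sg t)%C m
  = (RtoC (powerRZ r m) * fc (fun t => f t * tsum b sg t)%C m)%C.
Proof.
  intros Hr Hf Hfr Hg Hgr S1 S2.
  assert (L1 := fc_mult_series _ _ _ _ m Hf (ccont_tsum _ sg S1) (ulim_tsum _ sg S1)).
  assert (L2 := fc_mult_series _ _ _ _ m Hfr (ccont_tsum _ sg S2) (ulim_tsum _ sg S2)).
  eapply Clim_unique; [exact L2|].
  eapply Clim_ext; [|apply Clim_scal, L1].
  intros n; simpl; rewrite <- sum_n_C_mult_l; apply sum_n_ext; intros k.
  rewrite Hg, Hgr.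
  rewrite <- (powerRZ_minus_C r m (sg k)) by lra; Ceq; ring.
Qed.

Lemma tsum_conj (g : nat -> C) (sg : nat -> Z) (t : R) :
  ex_series (fun k => Cmod (g k)) ->
  Cconj (tsum g sg t) = tsum (fun k => Cconj (g k)) (fun k => (- sg k)%Z) t.
Proof.
  intros Hs; assert (Hs' : ex_series (fun k => Cmod (Cconj (g k))))
    by (apply (ex_series_ext (fun k => Cmod (g k))); [intros k; now rewrite Cmod_conj|assumption]).
  eapply Clim_unique.
  - apply Clim_conj, (csum_lim _ _ Hs); intros k; rewrite Cmod_mult, Cmod_ek; lra.
  - eapply Clim_ext; [|apply (csum_lim _ _ Hs'); intros k; rewrite Cmod_mult, Cmod_ek; lra].
    intros n; symmetry; apply psum_conj.
Qed.

Lemma ex_series_scaled (b : nat -> C) (x : nat -> R) :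
  ex_series (fun k => Cmod (b k)) -> (forall k, 0 <= x k <= 1) ->
  ex_series (fun k => Cmod (b k * RtoC (x k))%C).
Proof.
  intros Hs Hx; apply (ex_series_le (V := R_CompleteNormedModule) _ (fun k => Cmod (b k))); [|assumption].
  intros k; change (norm (Cmod (b k * RtoC (x k))%C)) with (Rabs (Cmod (b k * RtoC (x k))%C)).
  rewrite Rabs_pos_eq, Cmod_mult, Cmod_R by apply Cmod_ge_0.
  rewrite Rabs_pos_eq by apply Hx.
  generalize (Cmod_ge_0 (b k)) (Hx k); nra.
Qed.

Lemma Cconj_RtoC (x : R) : Cconj (RtoC x) = RtoC x.
Proof. apply C_eq; simpl; ring. Qed.

(** The Riesz projection onto negative frequencies. C^1 regularity makes it an absolutely convergent
    series, hence again a continuous function. *)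
Lemma negative_part (psi psi' : R -> C) :
  cderiv psi psi' -> ccont psi -> ccont psi' -> (forall t, psi (t + 2 * PI) = psi t) ->
  exists b : nat -> C, ex_series (fun k => Cmod (b k)) /\
    let B := tsum b (fun k => (- Z.of_nat (S k))%Z) in
    (forall m, (m < 0)%Z -> fc B m = fc psi m) /\
    (forall m, (0 <= m)%Z -> fc B m = RtoC 0).
Proof.
  intros Hd Hc Hc' Hp; set (sg := fun k => (- Z.of_nat (S k))%Z).
  exists (fun k => fc psi (sg k)); assert (HS := c1_summable psi psi' Hd Hc Hc' Hp).
  split; [exact HS|].
  destruct (fc_series_coef _ _ sg (ccont_tsum _ sg HS) (ulim_tsum _ sg HS)) as [H1 H2].
  - unfold sg; intros i j; lia.
  - simpl; split; intros m Hm.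
    + replace m with (sg (Z.to_nat (- m - 1))) by (unfold sg; lia); apply H1.
    + apply H2; unfold sg; intros k; lia.
Qed.

Lemma fc_mult_analytic (q G : R -> C) (g : nat -> C) (n : Z) :
  ccont q -> ccont G -> ulim (psum g Z.of_nat) G ->
  (forall m, (m < n)%Z -> fc q m = RtoC 0) ->
  (forall m, (m < n)%Z -> fc (fun t => q t * G t)%C m = RtoC 0) /\
  fc (fun t => q t * G t)%C n = (g O * fc q n)%C.
Proof.
  intros Hq HG HS H0; split.
  - intros m Hm; apply Clim_sum_zero with (2 := fc_mult_series _ _ _ _ m Hq HG HS).
    intros k; rewrite H0 by lia; ring.
  - rewrite (Clim_sum_single _ _ O) with (2 := fc_mult_series _ _ _ _ n Hq HG HS).
    { f_equal; f_equal; simpl; lia. }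
    intros k Hk; rewrite H0 by lia; ring.
Qed.

(** All frequencies of [v] are at least 1, so each squared coefficient shrinks by at least r^2. This
    gain reflects v(0) = 0. *)
Lemma nsq_dilate_le (v vr : R -> C) (r : R) :
  0 < r < 1 -> ccont v -> ccont vr -> (forall t, vr (t + 2 * PI) = vr t) ->
  (forall m, fc vr m = (RtoC (powerRZ r m) * fc v m)%C) ->
  (forall m, (m <= 0)%Z -> fc v m = RtoC 0) ->
  nsq vr <= r ^ 2 * nsq v.
Proof.
  intros Hr Hv Hvr Hp Hf H0.
  set (sg := fun k => Z.of_nat (S k)).
  assert (Hsg : forall i j, sg i = sg j -> i = j) by (unfold sg; intros i j; lia).
  assert (Hn0 := nsq_ge_0 v Hv).
  assert (Hfk : forall k, fc vr (sg k) = (RtoC (r ^ S k) * fc v (sg k))%C)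
    by (intros k; rewrite Hf; unfold sg; now rewrite <- pow_powerRZ).
  destruct (fourier_series vr sg Hvr Hp Hsg) as [_ HU].
  - intros m Hm; rewrite Hf, H0; [ring|].
    destruct (Z_lt_le_dec 0 m) as [H|H]; [|assumption].
    exfalso; apply (Hm (Z.to_nat (m - 1))); unfold sg; lia.
  - apply (ex_series_geom_bound _ (sqrt (nsq v)) r); [lra|]; intros k.
    rewrite Hfk, Cmod_mult, Cmod_R, Rabs_pos_eq by (apply pow_le; lra).
    assert (H1 : Cmod (fc v (sg k)) <= sqrt (nsq v)).
    { rewrite <- (sqrt_pow2 (Cmod (fc v (sg k)))) by apply Cmod_ge_0.
      apply sqrt_le_1_alt; now apply Cmod_fc_sqr_le. }
    assert (H2 : 0 < r ^ k) by (apply pow_lt; lra).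
    assert (H3 := sqrt_pos (nsq v)); assert (H4 := Cmod_ge_0 (fc v (sg k))).
    simpl; rewrite (Rmult_comm (sqrt _)); apply Rmult_le_compat; try lra.
    + apply Rmult_le_pos; lra.
    + nra.
  - assert (L := parseval vr sg Hvr Hsg HU).
    apply (is_lim_seq_le (sum_n (fun k => Cmod (fc vr (sg k)) ^ 2))
      (fun _ => r ^ 2 * nsq v) (nsq vr) (r ^ 2 * nsq v));
      [|exact L|apply is_lim_seq_const].
    intros n; apply Rle_trans with (r ^ 2 * sum_n (fun k => Cmod (fc v (sg k)) ^ 2) n).
    + replace (r ^ 2 * sum_n (fun k => Cmod (fc v (sg k)) ^ 2) n)
        with (sum_n (fun k => r ^ 2 * Cmod (fc v (sg k)) ^ 2) n)
        by (apply (sum_n_mult_l (K := R_AbsRing))).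
      apply sum_n_m_le; intros k.
      rewrite Hfk, Cmod_mult, Cmod_R, Rabs_pos_eq, Rpow_mult_distr by (apply pow_le; lra).
      apply Rmult_le_compat_r; [apply pow2_ge_0|].
      rewrite <- pow_mult.
      replace (S k * 2)%nat with (2 + k * 2)%nat by lia; rewrite pow_add.
      assert (Hk : r ^ (k * 2) <= 1) by (rewrite <- (pow1 (k * 2)); apply pow_incr; lra).
      assert (Hk0 : 0 <= r ^ (k * 2)) by (apply pow_le; lra).
      assert (Hr2 : 0 <= r ^ 2) by apply pow2_ge_0; nra.
    + apply Rmult_le_compat_l; [apply pow2_ge_0|]; now apply bessel_le.
Qed.

(* [alf], [qf] and [v] below are the functions al, q and v of the opening comment; [qr] and
   [vr] are [q] and [v] on the circle of radius [r]. *)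
Lemma level_analysis w De c r0 e dl
    (a : nat -> nat -> C) (kappa : nat -> R) (n : nat) (r Lam : R) :
  positive_analytic_weight w -> orthonormal_polynomials w a kappa ->
  0 <= r0 -> r0 < r < 1 -> szego_data w De c r0 e dl ->
  0 <= Lam -> (forall t, Cmod (scattering w De (r * cis t)%C) <= Lam) ->
  let x := sqrt (2 * PI) * kappa n / tau w in
  exists (al q : nat -> C) (Q : R),
    x <= 1 /\ al O = RtoC (/ x) /\ q O = RtoC (x - / x) /\
    (forall k, Cmod (q (S k)) = Cmod (al (S k))) /\
    is_lim_seq (sum_n (fun k => Cmod (al k) ^ 2)) (Q + 1) /\
    (forall J, sum_n (fun k => (Cmod (q k) / r ^ k) ^ 2) J <= Lam ^ 2 * r ^ (2 * n) * r ^ 2 * Q) /\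
    Clim (sum_n (fun k => al k * c (- Z.of_nat n - Z.of_nat k)%Z)%C)
      (RtoC x * (a n O / RtoC (kappa n)))%C.
Proof.
  intros Hw Ho Hr0 Hr HD HLam HF x.
  assert (Hr01 : 0 <= r0 < 1) by lra.
  assert (H2pi := two_PI_pos).
  assert (Hk : 0 < kappa n /\ a n n = RtoC (kappa n)) by apply (proj1 Ho n).
  destruct Hk as [Hk Ha].
  assert (Htau : 0 < tau w) by apply exp_pos.
  (* The polynomials are normalised for arclength, [mean] for total mass 1; [S2] converts between
     the two and makes [f] of norm 1. *)
  set (S2 := sqrt (2 * PI)) in *.
  assert (HS2 : 0 < S2) by now apply sqrt_lt_R0.
  assert (HS2sq : S2 * S2 = 2 * PI) by (apply sqrt_sqrt; lra).
  assert (Hx : 0 < x) by (unfold x; apply Rdiv_lt_0_compat; [now apply Rmult_lt_0_compat|assumption]).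
  set (D := fun t => De (cis t)).
  set (W := fun t => RtoC (w (cis t))).
  set (p := pcirc a n).
  assert (HcD : ccont D) by exact (ccont_ext_boundary De r0 _ (proj2 Hr01) (sd_ext HD)).
  assert (HcW : ccont W) by (apply ccont_RtoC, weight_continuous, Hw).
  assert (Hcp : ccont p) by apply ccont_psum.
  assert (HDW : forall t, (D t * Cconj (D t) * W t)%C = RtoC 1) by apply (sd_weight HD).
  (* Boundary value of D_i; it equals D_e w there because |D_e|^2 w = 1. *)
  set (Di := fun t => (/ Cconj (D t))%C).
  assert (HD0 : forall t, D t <> RtoC 0) by (intros t; eapply sd_nonzero, HD).
  assert (HDi : forall t, Di t = (D t * W t)%C).
  { intros t; unfold Di; assert (N := conj_neq_0 _ (HD0 t)).
    transitivity (/ Cconj (D t) * (D t * Cconj (D t) * W t))%C; [rewrite HDW; ring|field; exact N]. }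
  assert (HcDi : ccont Di) by (apply (ccont_ext (fun t => D t * W t)%C); [intros t; now rewrite HDi|ccont_tac]).
  assert (HcW' : forall t, Cconj (W t) = W t) by (intros t; apply Cconj_RtoC).
  assert (fcD : forall m, fc D m = Cconj (e (- m)%Z)).
  { intros m; rewrite (fc_ext D (polar De 1)) by (intros t _; now rewrite polar_1).
    rewrite (proj2 (sd_ext HD 1 (proj2 Hr01))), powerRZ_R1; ring. }
  assert (fcDi : forall m, fc Di m = dl m) by apply (sd_int HD).
  assert (He0 := proj2 (sd_inv HD)).
  assert (Hdl0 := proj2 (sd_disc HD)).
  assert (UD := ext_series_1 _ _ _ _ _ _ Hr01 HD).
  assert (UDc : ulim (psum (fun k => e (Z.of_nat k)) Z.of_nat) (fun t => Cconj (D t))).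
  { destruct UD as [y [Hy Hb]]; exists y; split; [assumption|]; intros N t Ht.
    rewrite <- (Hb N t Ht), <- Cmod_conj, Cminus_conj, Cconj_conj; right; do 2 f_equal.
    apply psum_conj. }
  set (psi := fun t => (p t * W t)%C).
  assert (Hcpsi : ccont psi) by (unfold psi; ccont_tac).
  destruct (weight_C1 w De c r0 e dl Hw Hr01 HD) as [W' [HcW1 HdW]].
  assert (Hdp := cderiv_psum (a n) Z.of_nat n); fold (pcirc a n) in Hdp; fold p in Hdp.
  destruct (negative_part _ _ (cderiv_mult _ _ _ _ Hdp HdW)) as [b [Sb [HBneg HBpos]]].
  { exact Hcpsi. }
  { apply ccont_plus; apply ccont_mult; auto; apply ccont_psum. }
  { intros t; unfold p; rewrite !pcirc_eval, cis_periodic; reflexivity. }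
  set (sgb := fun k => (- Z.of_nat (S k))%Z) in *.
  set (B := tsum b sgb) in *.
  change (forall m, (m < 0)%Z -> fc B m = fc psi m) in HBneg.
  assert (HcB : ccont B) by now apply ccont_tsum.
  destruct (orthonormal_fc w a kappa n Hw Ho) as [Hlow Hn].
  fold p in Hlow, Hn; change (fun t => (p t * RtoC (w (cis t)))%C) with psi in Hlow, Hn.
  set (A := fun t => (psi t - B t)%C).
  assert (HcA : ccont A) by (unfold A; ccont_tac).
  assert (HAlow : forall m, (m < Z.of_nat n)%Z -> fc A m = RtoC 0).
  { intros m Hm; unfold A; rewrite fc_minus by assumption.
    destruct (Z_lt_le_dec m 0) as [H|H]; [rewrite HBneg by assumption; ring|].
    rewrite HBpos, <- (Z2Nat.id m H), Hlow by lia; ring. }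
  assert (HAn : fc A (Z.of_nat n) = RtoC (/ (2 * PI * kappa n))).
  { unfold A; rewrite fc_minus, HBpos, Hn by (assumption || lia); ring. }
  destruct (fc_mult_analytic A _ _ (Z.of_nat n) HcA (ccont_conj _ HcD) UDc HAlow) as [HADlow HADn].
  (* Here conj D is the boundary value of 1 / D_i, so alf = sqrt(2 pi) z^{-n} A / D_i, with
     frequencies >= 0. *)
  set (alf := fun t => (RtoC S2 * (ek (- Z.of_nat n) t * (A t * Cconj (D t))))%C).
  assert (Hcal : ccont alf) by (unfold alf; ccont_tac).
  assert (fcal : forall m, fc alf m = (RtoC S2 * fc (fun t => A t * Cconj (D t)) (m + Z.of_nat n))%C).
  { intros m; unfold alf; rewrite fc_scal by ccont_tac.
    rewrite (fc_ek_mul (fun t => A t * Cconj (D t))%C); do 2 f_equal; lia. }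
  assert (Hal_neg : forall m, (m < 0)%Z -> fc alf m = RtoC 0)
    by (intros m Hm; rewrite fcal, HADlow by lia; ring).
  assert (Hal0 : fc alf 0 = RtoC (/ x)).
  { rewrite fcal, Z.add_0_l, HADn, HAn; simpl Z.of_nat; rewrite (sd_inv_0 HD).
    rewrite <- !RtoC_mult; f_equal; unfold x; rewrite <- HS2sq; field; lra. }
  (* z^n conj(phi_n) is the reversed polynomial; its constant term kappa_n times D_i(0) = 1 / tau
     gives f(0) = x. *)
  set (f := fun t => (RtoC S2 * (Di t * (ek (Z.of_nat n) t * Cconj (p t))))%C).
  assert (Hcf : ccont f) by (unfold f; ccont_tac).
  set (sgr := fun k => (Z.of_nat n - Z.of_nat k)%Z).
  assert (Er : forall t, (ek (Z.of_nat n) t * Cconj (p t))%C = psum (fun k => Cconj (a n k)) sgr n t).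
  { intros t; unfold p, pcirc; rewrite psum_conj; apply ek_mult_psum. }
  assert (fcf : forall m, fc f m = (RtoC S2 * sum_n (fun k => Cconj (a n k) * dl (m - sgr k)%Z) n)%C).
  { intros m; unfold f; rewrite fc_scal by ccont_tac; f_equal.
    rewrite (fc_ext _ (fun t => Di t * psum (fun k => Cconj (a n k)) sgr n t)%C)
      by (intros t _; now rewrite Er).
    rewrite fc_mult_psum by assumption; apply sum_n_ext; intros k; now rewrite fcDi. }
  assert (Hf_neg : forall m, (m < 0)%Z -> fc f m = RtoC 0).
  { intros m Hm; rewrite fcf, sum_n_C_zero; [ring|].
    intros k Hkn; rewrite Hdl0 by (unfold sgr; lia); ring. }
  assert (Hf0 : fc f 0 = RtoC x).
  { rewrite fcf, sum_n_C_last.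
    - unfold sgr; rewrite Z.sub_diag, Z.sub_diag, (sd_dl_0 HD), Ha, Cconj_RtoC.
      rewrite <- !RtoC_mult; f_equal; unfold x; field; lra.
    - intros k Hkn; rewrite Hdl0 by (unfold sgr; lia); ring. }
  assert (Hekek : forall m t, (ek m t * Cconj (ek m t))%C = RtoC 1).
  { intros m t; rewrite <- Cmod2_conj, Cmod_ek; f_equal; ring. }
  assert (HSC : (RtoC S2 * RtoC S2)%C = RtoC (2 * PI)) by (rewrite <- RtoC_mult; now rewrite HS2sq).
  assert (Hnf : nsq f = 1).
  { apply RtoC_inj; rewrite nsq_mean.
    rewrite (mean_ext _ (fun t => RtoC (2 * PI) * (p t * W t * Cconj (p t)))%C).
    - rewrite mean_scal by ccont_tac.
      unfold p, W; rewrite (orthonormal_mean w a kappa n n Hw Ho), Nat.eqb_refl, <- RtoC_mult.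
      f_equal; field; lra.
    - intros t _; unfold f; rewrite !Cmult_conj, Cconj_RtoC, Cconj_conj, HDi, Cmult_conj, HcW'.
      transitivity ((RtoC S2 * RtoC S2) * (ek (Z.of_nat n) t * Cconj (ek (Z.of_nat n) t))
        * (D t * Cconj (D t) * W t) * (p t * W t * Cconj (p t)))%C; [ring|].
      rewrite HSC, Hekek, HDW; ring. }
  set (qf := fun t => (f t - Cconj (alf t))%C).
  assert (Hcq : ccont qf) by (unfold qf; ccont_tac).
  (* Substituting D_i = D_e w and A = phi_n w - B cancels the polynomial and leaves only the
     negative part. *)
  assert (Eq : forall t, qf t = (RtoC S2 * (ek (Z.of_nat n) t * (D t * Cconj (B t))))%C).
  { intros t; unfold qf, f, alf, A, psi.
    rewrite !Cmult_conj, Cconj_RtoC, Cconj_conj, ek_conj, Z.opp_involutive, Cminus_conj, Cmult_conj,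
      HcW', HDi; ring. }
  (* Pointwise f al = 2 pi conj(p) (p w - B). The product of B with conj(p) has only negative
     frequencies, hence mean zero, and what remains has mean 1 by normalisation; so <f, conj al> =
     1. *)
  assert (Hnq : nsq qf = nsq alf - 1).
  { unfold qf; rewrite nsq_minus by ccont_tac; rewrite Hnf.
    rewrite (nsq_ext (fun t => Cconj (alf t)) alf) by (intros t _; apply Cmod_conj).
    replace (mean (fun t => f t * Cconj (Cconj (alf t)))%C) with (RtoC 1); [simpl; ring|].
    rewrite (mean_ext _ (fun t => RtoC (2 * PI) * (p t * W t * Cconj (p t)
        - B t * psum (fun k => Cconj (a n k)) (fun k => (- Z.of_nat k)%Z) n t))%C).
    - assert (Hps := ccont_psum (fun k => Cconj (a n k)) (fun k => (- Z.of_nat k)%Z) n).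
      rewrite mean_scal by (apply ccont_minus; [ccont_tac|now apply ccont_mult]).
      rewrite mean_minus by (ccont_tac || now apply ccont_mult).
      unfold p at 1 2, W at 1.
      rewrite (orthonormal_mean w a kappa n n Hw Ho), Nat.eqb_refl.
      rewrite mean_fc, fc_mult_psum by assumption.
      rewrite sum_n_C_zero by (intros k _; rewrite HBpos by lia; ring).
      replace (RtoC (/ (2 * PI)) - RtoC 0)%C with (RtoC (/ (2 * PI))) by ring.
      rewrite <- RtoC_mult; f_equal; field; lra.
    - intros t _; rewrite Cconj_conj; unfold f, alf, A, psi.
      assert (N := conj_neq_0 _ (HD0 t)).
      assert (E1 : (Di t * Cconj (D t))%C = RtoC 1) by (unfold Di; field; exact N).
      assert (E2 : (ek (Z.of_nat n) t * ek (- Z.of_nat n) t)%C = RtoC 1)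
        by (rewrite Cmult_comm; apply ek_neg_l).
      assert (E3 : psum (fun k => Cconj (a n k)) (fun k => (- Z.of_nat k)%Z) n t = Cconj (p t))
        by (unfold p, pcirc; now rewrite psum_conj).
      rewrite E3, <- HSC.
      transitivity ((RtoC S2 * RtoC S2) * (Di t * Cconj (D t)) *
         (ek (Z.of_nat n) t * ek (- Z.of_nat n) t) * (Cconj (p t) * (p t * W t - B t)))%C; [ring|].
      rewrite E1, E2; ring. }
  assert (Hq0 : fc qf 0 = RtoC (x - / x)).
  { unfold qf; rewrite fc_minus, Hf0, fc_conj by ccont_tac; simpl Z.opp.
    rewrite Hal0, Cconj_RtoC, <- RtoC_minus; reflexivity. }
  assert (Hqneg : forall j, (0 < j)%Z -> Cmod (fc qf (- j)) = Cmod (fc alf j)).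
  { intros j Hj; unfold qf; rewrite fc_minus, Hf_neg, fc_conj by (ccont_tac || lia).
    rewrite Z.opp_involutive.
    replace (RtoC 0 - Cconj (fc alf j))%C with (- Cconj (fc alf j))%C by ring.
    now rewrite Cmod_opp, Cmod_conj. }
  set (bc := fun k => Cconj (b k)); set (sgc := fun k => Z.of_nat (S k)).
  assert (Sbc : ex_series (fun k => Cmod (bc k)))
    by (apply (ex_series_ext (fun k => Cmod (b k))); [intros k; unfold bc; now rewrite Cmod_conj|assumption]).
  assert (HBc : forall t, Cconj (B t) = tsum bc sgc t).
  { intros t; unfold B; rewrite tsum_conj by assumption.
    unfold tsum, csum, bc, sgb, sgc; f_equal; apply Series_ext; intros k;
      now rewrite Z.opp_involutive. }
  set (bcr := fun k => (bc k * RtoC (powerRZ r (sgc k)))%C).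
  assert (Sbcr : ex_series (fun k => Cmod (bcr k))).
  { apply ex_series_scaled; [assumption|]; intros k; unfold sgc; rewrite <- pow_powerRZ.
    split; [apply pow_le; lra|]; rewrite <- (pow1 (S k)); apply pow_incr; lra. }
  set (br := tsum bcr sgc).
  assert (Hcbr : ccont br) by now apply ccont_tsum.
  set (Er1 := polar (fun z => / szego w z)%C r).
  destruct (proj1 (sd_inv HD) r ltac:(lra)) as [HcE fcE]; fold Er1 in HcE, fcE.
  destruct (sd_ext HD r (proj1 Hr)) as [HcDr fcDr].
  (* [v] is analytic: conj D continues to 1 / D_i and conj B is a series in positive frequencies. So
     [vr] takes 1 / [szego] on radius r. *)
  set (v := fun t => (RtoC S2 * (Cconj (D t) * tsum bc sgc t))%C).
  set (vr := fun t => (RtoC S2 * (Er1 t * br t))%C).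
  assert (Hctb : ccont (tsum bc sgc)) by now apply ccont_tsum.
  assert (Hcv : ccont v) by (unfold v; ccont_tac).
  assert (Hcvr : ccont vr) by (unfold vr; ccont_tac).
  assert (fcDc : forall m, fc (fun t => Cconj (D t)) m = e m).
  { intros m; rewrite fc_conj, fcD, Z.opp_involutive, Cconj_conj by assumption; reflexivity. }
  assert (fcv : forall m, fc vr m = (RtoC (powerRZ r m) * fc v m)%C).
  { intros m; unfold v, vr; rewrite !fc_scal by ccont_tac.
    unfold br, bcr; rewrite (dilate_product (fun t => Cconj (D t)) Er1 e bc sgc r m);
      [ring|lra|ccont_tac|assumption|exact fcDc|exact fcE|exact Sbc|exact Sbcr]. }
  assert (Hv0 : forall m, (m <= 0)%Z -> fc v m = RtoC 0).
  { intros m Hm; unfold v; rewrite fc_scal by ccont_tac.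
    rewrite (Clim_sum_zero _ (fc (fun t => Cconj (D t) * tsum bc sgc t)%C m)) with
      (2 := fc_mult_series _ _ _ _ m (ccont_conj _ HcD) Hctb (ulim_tsum _ _ Sbc)); [ring|].
    intros k; rewrite fcDc, He0 by (unfold sgc; lia); ring. }
  (* Continuation of q to radius r: z^n contributes r^n, D_e its values at radius r, and conj B the
     scaled series [br]. *)
  set (qr := fun t => (RtoC S2 * RtoC (r ^ n) * (ek (Z.of_nat n) t * (polar De r t * br t)))%C).
  assert (Hcqr : ccont qr) by (unfold qr; ccont_tac).
  assert (fcq : forall m, fc qr m = (RtoC (powerRZ r m) * fc qf m)%C).
  { intros m; rewrite (fc_ext qf _ m (fun t _ => Eq t)).
    rewrite (fc_ext (fun t => RtoC S2 * (ek (Z.of_nat n) t * (D t * Cconj (B t))))%C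
      (fun t => RtoC S2 * (ek (Z.of_nat n) t * (D t * tsum bc sgc t)))%C)
      by (intros t _; now rewrite HBc).
    unfold qr; rewrite !fc_scal by ccont_tac.
    rewrite (fc_ek_mul (fun t => polar De r t * br t)%C), (fc_ek_mul (fun t => D t * tsum bc sgc t)%C).
    unfold br, bcr; rewrite (dilate_product D (polar De r) (fun m => Cconj (e (- m)%Z)) bc sgc r);
      [|lra|assumption|assumption|exact fcD|exact fcDr|exact Sbc|exact Sbcr].
    rewrite <- (powerRZ_minus_C r m (Z.of_nat n)), <- pow_powerRZ by lra; ring. }
  (* On |z| = r one has D_e = F / D_i; this is where the maximum of |F| enters. *)
  assert (Hqv : forall t, Cmod (qr t) <= Lam * r ^ n * Cmod (vr t)).
  { intros t; unfold qr, vr.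
    rewrite !Cmod_mult, Cmod_ek, !Cmod_R, (Rabs_pos_eq S2), (Rabs_pos_eq (r ^ n))
      by (try apply pow_le; lra).
    assert (Hz : Cmod (r * cis t)%C = r) by (apply Cmod_scis; lra).
    assert (N0 : szego w (r * cis t)%C <> RtoC 0) by (apply szego_neq_0; [assumption|lra]).
    assert (X : Cmod (polar De r t) <= Lam * Cmod (Er1 t)).
    { replace (polar De r t) with (scattering w De (r * cis t) * Er1 t)%C
        by (unfold scattering, Er1, polar; field; exact N0).
      rewrite Cmod_mult; apply Rmult_le_compat_r; [apply Cmod_ge_0|apply HF]. }
    assert (0 <= r ^ n) by (apply pow_le; lra).
    assert (P := Cmod_ge_0 (br t)).
    replace (Lam * r ^ n * (S2 * (Cmod (Er1 t) * Cmod (br t))))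
      with (S2 * r ^ n * (1 * ((Lam * Cmod (Er1 t)) * Cmod (br t)))) by ring.
    apply Rmult_le_compat_l; [apply Rmult_le_pos; lra|].
    apply Rmult_le_compat_l; [lra|]; now apply Rmult_le_compat_r. }
  assert (Hnv : nsq v = nsq qf).
  { apply nsq_ext; intros t _; rewrite Eq; unfold v; rewrite <- HBc, !Cmod_mult, Cmod_ek, Cmod_conj; ring. }
  assert (Hnvr : nsq vr <= r ^ 2 * nsq v).
  { apply nsq_dilate_le; auto; [lra|].
    intros t; unfold vr, Er1, br; now rewrite polar_periodic, tsum_periodic. }
  assert (Hnqr : nsq qr <= (Lam * r ^ n) ^ 2 * nsq vr).
  { assert (0 <= Lam * r ^ n) by (apply Rmult_le_pos; [assumption|apply pow_le; lra]).
    replace ((Lam * r ^ n) ^ 2) with (Cmod (RtoC (Lam * r ^ n)) ^ 2)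
      by (rewrite Cmod_R, Rabs_pos_eq by assumption; reflexivity).
    rewrite <- nsq_scal by assumption; apply nsq_le; [assumption|ccont_tac|].
    intros t _; rewrite Cmod_mult, Cmod_R, Rabs_pos_eq by assumption; apply Hqv. }
  (* At radius r the coefficient of index -k is magnified by r^{-k}, so Bessel's inequality for [qr]
     yields the weighted sum. *)
  assert (Hbess : forall J, sum_n (fun k => (Cmod (fc qf (- Z.of_nat k)) / r ^ k) ^ 2) J
     <= Lam ^ 2 * r ^ (2 * n) * r ^ 2 * nsq qf).
  { intros J; rewrite <- (sum_n_ext (fun k => Cmod (fc qr (- Z.of_nat k)) ^ 2)).
    - eapply Rle_trans; [apply (bessel_le qr (fun k => (- Z.of_nat k)%Z) J Hcqr); intros i j; lia|].
      eapply Rle_trans; [exact Hnqr|].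
      replace (Lam ^ 2 * r ^ (2 * n) * r ^ 2 * nsq qf) with ((Lam * r ^ n) ^ 2 * (r ^ 2 * nsq v)).
      + apply Rmult_le_compat_l; [apply pow2_ge_0|assumption].
      + rewrite Hnv, Rpow_mult_distr, <- pow_mult, (Nat.mul_comm n 2); ring.
    - intros k; rewrite fcq, Cmod_mult, Cmod_R, powerRZ_neg', <- pow_powerRZ by lra.
      assert (0 < r ^ k) by (apply pow_lt; lra).
      rewrite Rabs_pos_eq by (apply Rlt_le; now apply Rinv_0_lt_compat).
      f_equal; field; lra. }
  assert (Ual : ulim (psum (fun k => fc alf (Z.of_nat k)) Z.of_nat) alf).
  { apply (fourier_series alf Z.of_nat Hcal).
    - intros t; unfold alf, A, psi, B, D, W, p; rewrite !pcirc_eval.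
      now rewrite cis_2PI, tsum_periodic, cis_periodic.
    - intros i j; lia.
    - intros m Hm; apply Hal_neg; destruct (Z_lt_le_dec m 0) as [H|H]; [assumption|].
      exfalso; apply (Hm (Z.to_nat m)); lia.
    - apply (ex_series_geom_bound _ (Rmax (Cmod (fc alf 0)) (sqrt (nsq qr))) r); [lra|].
      intros [|k]; [simpl; rewrite Rmult_1_r; apply Rmax_l|].
      rewrite <- Hqneg by lia.
      apply Rle_trans with (sqrt (nsq qr) * r ^ S k);
        [|apply Rmult_le_compat_r; [apply pow_le; lra|apply Rmax_r]].
      apply Rle_div_l; [apply pow_lt; lra|].
      assert (X := sqrt_le_1_alt _ _ (Cmod_fc_sqr_le qr (- Z.of_nat (S k)) Hcqr)).
      rewrite sqrt_pow2, fcq, Cmod_mult, Cmod_R, powerRZ_neg', <- pow_powerRZ in X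
        by (lra || apply Cmod_ge_0).
      rewrite Rabs_pos_eq, Rmult_comm in X; [exact X|].
      apply Rlt_le, Rinv_0_lt_compat, pow_lt; lra. }
  exists (fun k => fc alf (Z.of_nat k)), (fun k => fc qf (- Z.of_nat k)), (nsq qf).
  repeat split.
  - assert (X := Cmod_fc_sqr_le f 0 Hcf); rewrite Hf0, Hnf, Cmod_R, Rabs_pos_eq in X by lra; nra.
  - exact Hal0.
  - exact Hq0.
  - intros k; apply Hqneg; lia.
  - replace (nsq qf + 1) with (nsq alf) by (rewrite Hnq; ring).
    apply parseval; [assumption|intros i j; lia|exact Ual].
  - exact Hbess.
  - set (Fb := fun t => (Di t * D t)%C).
    assert (HcFb : ccont Fb) by (unfold Fb; ccont_tac).
    assert (fcFb : forall m, fc Fb m = c m)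
      by (intros m; exact (scattering_boundary w De c r0 e dl m Hr01 HD)).
    assert (HcFe : ccont (fun t => ek (Z.of_nat n) t * Fb t)%C) by ccont_tac.
    assert (L := fc_mult_series _ _ _ _ 0 HcFe Hcal Ual).
    replace (RtoC x * (a n O / RtoC (kappa n)))%C
      with (fc (fun t => ek (Z.of_nat n) t * Fb t * alf t)%C 0).
    + eapply Clim_ext; [|exact L]; intros N; apply sum_n_ext; intros k; simpl.
      rewrite fc_ek_mul, fcFb; do 2 f_equal; lia.
    + set (h := fun t => (RtoC S2 * (Di t * p t))%C).
      set (bD := fun t => (RtoC S2 * (D t * B t))%C).
      assert (Hch : ccont h) by (unfold h; ccont_tac).
      assert (HcbD : ccont bD) by (unfold bD; ccont_tac).
      (* z^n F al = sqrt(2 pi) D_i phi_n - sqrt(2 pi) D_e B, and D_e B has only negative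
         frequencies, so its constant term vanishes. *)
      rewrite (fc_ext _ (fun t => h t - bD t)%C).
      * rewrite fc_minus by assumption.
        replace (fc bD 0) with (RtoC 0).
        -- unfold h; rewrite fc_scal by ccont_tac.
           unfold p, pcirc; rewrite fc_mult_psum by assumption.
           rewrite (sum_n_C_single _ n O); [|lia|].
           ++ rewrite fcDi, Z.sub_diag, (sd_dl_0 HD).
              unfold x; unfold Rdiv; rewrite !RtoC_mult, RtoC_inv by lra.
              field; split; apply RtoC_neq_0; lra.
           ++ intros k Hkn; rewrite fcDi, Hdl0 by lia; ring.
        -- unfold bD; rewrite fc_scal by ccont_tac.
           rewrite (Clim_sum_zero _ (fc (fun t => D t * B t)%C 0)) with
             (2 := fc_mult_series D B b sgb 0 HcD HcB (ulim_tsum _ _ Sb)); [ring|].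
           intros k; rewrite fcD, He0, Cconj_RtoC by (unfold sgb; lia); ring.
      * intros t _; unfold h, bD, Fb, alf, A, psi.
        assert (N := conj_neq_0 _ (HD0 t)).
        assert (E1 : (Di t * Cconj (D t))%C = RtoC 1) by (unfold Di; field; exact N).
        assert (E2 : (ek (Z.of_nat n) t * ek (- Z.of_nat n) t)%C = RtoC 1)
          by (rewrite Cmult_comm; apply ek_neg_l).
        rewrite (HDi t) at 2.
        transitivity ((ek (Z.of_nat n) t * ek (- Z.of_nat n) t) * (Di t * Cconj (D t)) *
          (RtoC S2 * D t * (p t * W t - B t)))%C; [ring|].
        rewrite E1, E2; ring.
Qed.

(** * Asymptotics *)

Lemma sum_n_R_S (u : nat -> R) (n : nat) : sum_n u (S n) = sum_n u n + u (S n).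
Proof. now rewrite sum_Sn. Qed.

Lemma sum_n_R_split (u : nat -> R) (n : nat) :
  sum_n u (S n) = u O + sum_n (fun k => u (S k)) n.
Proof.
  induction n as [|n IH].
  - rewrite sum_Sn, !sum_O; reflexivity.
  - rewrite sum_Sn, IH, (sum_Sn (fun k => u (S k))); unfold plus; simpl; ring.
Qed.

(* With [X = 1 - x^2] the two energy relations read
   [Q - X/x^2 + r^2 X^2/x^2 <= L r^4 Q] and [Q >= X/x^2]. *)
Lemma energy_bound (al q : nat -> C) (x Q L r : R) :
  0 < x <= 1 -> 0 < r < 1 -> 0 <= L ->
  al O = RtoC (/ x) -> q O = RtoC (x - / x) ->
  (forall k, Cmod (q (S k)) = Cmod (al (S k))) ->
  is_lim_seq (sum_n (fun k => Cmod (al k) ^ 2)) (Q + 1) ->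
  (forall J, sum_n (fun k => (Cmod (q k) / r ^ k) ^ 2) J <= L * r ^ 2 * Q) ->
  (1 - x ^ 2) / x ^ 2 <= Q /\
  Q - (1 - x ^ 2) / x ^ 2 + r ^ 2 * ((1 - x ^ 2) ^ 2 / x ^ 2) <= L * r ^ 4 * Q /\
  1 - x ^ 2 <= L * r ^ 2.
Proof.
  intros Hx Hr HL Ha0 Hq0 Hqa HQ HS.
  assert (Hix : 1 <= / x) by (rewrite <- Rinv_1; apply Rinv_le_contravar; lra).
  assert (Ea : Cmod (al O) ^ 2 = / x ^ 2).
  { rewrite Ha0, Cmod_R, Rabs_pos_eq, pow_inv by lra; reflexivity. }
  assert (Eq : (Cmod (q O) / r ^ 0) ^ 2 = (1 - x ^ 2) ^ 2 / x ^ 2).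
  { rewrite Hq0, Cmod_R, Rabs_left1 by lra; simpl; field; lra. }
  assert (Hr2 : 0 <= r ^ 2) by apply pow2_ge_0.
  assert (Q1 : (1 - x ^ 2) / x ^ 2 <= Q).
  { assert (X := is_lim_seq_incr_compare _ _ HQ
      ltac:(intros k; rewrite sum_n_R_S; generalize (pow2_ge_0 (Cmod (al (S k)))); lra) O).
    rewrite sum_O, Ea in X.
    replace ((1 - x ^ 2) / x ^ 2) with (/ x ^ 2 - 1) by (field; lra); lra. }
  (* For k >= 1 one has |al_k|^2 <= r^2 (|q_k| / r^k)^2; the weighted sum over k >= 1 is the full
     bound minus its k = 0 term. *)
  assert (Q2 : Q + 1 <= / x ^ 2 + r ^ 2 * (L * r ^ 2 * Q - (1 - x ^ 2) ^ 2 / x ^ 2)).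
  { apply (is_lim_seq_le (fun n => sum_n (fun k => Cmod (al k) ^ 2) (S n))
      (fun _ => / x ^ 2 + r ^ 2 * (L * r ^ 2 * Q - (1 - x ^ 2) ^ 2 / x ^ 2)) (Q + 1)
      (/ x ^ 2 + r ^ 2 * (L * r ^ 2 * Q - (1 - x ^ 2) ^ 2 / x ^ 2)));
      [|now apply (is_lim_seq_incr_1 (sum_n (fun k => Cmod (al k) ^ 2)))|apply is_lim_seq_const].
    intros n; rewrite sum_n_R_split, Ea; apply Rplus_le_compat_l.
    specialize (HS (S n)); rewrite sum_n_R_split, Eq in HS.
    apply Rle_trans with (r ^ 2 * sum_n (fun k => (Cmod (q (S k)) / r ^ S k) ^ 2) n);
      [|apply Rmult_le_compat_l; lra].
    replace (r ^ 2 * sum_n (fun k => (Cmod (q (S k)) / r ^ S k) ^ 2) n)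
      with (sum_n (fun k => r ^ 2 * (Cmod (q (S k)) / r ^ S k) ^ 2) n)
      by (apply (sum_n_mult_l (K := R_AbsRing))).
    apply sum_n_m_le; intros k; rewrite Hqa.
    assert (Hk : 0 < r ^ k) by (apply pow_lt; lra).
    replace (r ^ 2 * (Cmod (al (S k)) / r ^ S k) ^ 2) with (Cmod (al (S k)) ^ 2 * (/ r ^ k) ^ 2)
      by (simpl; field; lra).
    rewrite <- (Rmult_1_r (Cmod (al (S k)) ^ 2)) at 1.
    apply Rmult_le_compat_l; [apply pow2_ge_0|].
    rewrite <- (pow1 2); apply pow_incr; split; [lra|].
    rewrite <- Rinv_1; apply Rinv_le_contravar; [assumption|].
    rewrite <- (pow1 k); apply pow_incr; lra. }
  assert (Q3 : Q - (1 - x ^ 2) / x ^ 2 + r ^ 2 * ((1 - x ^ 2) ^ 2 / x ^ 2) <= L * r ^ 4 * Q).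
  { replace ((1 - x ^ 2) / x ^ 2) with (/ x ^ 2 - 1) by (field; lra).
    replace (L * r ^ 4 * Q) with (r ^ 2 * (L * r ^ 2 * Q)) by ring; lra. }
  split; [exact Q1|split; [exact Q3|]].
  assert (Hr21 : r ^ 2 <= 1) by (rewrite <- (pow1 2); apply pow_incr; lra).
  assert (Hr4 : r ^ 4 <= r ^ 2) by (replace (r ^ 4) with (r ^ 2 * r ^ 2) by ring; nra).
  assert (Hx2 : 0 < x ^ 2 <= 1) by (split; [apply pow_lt; lra|nra]).
  (* If L r^4 >= 1 the claim is trivial, as 1 - x^2 <= 1. Otherwise 1 - L r^4 is positive, Q can be
     replaced by its lower bound X / x^2, and division by X / x^2 leaves r^2 X <= L r^4. *)
  destruct (Rle_or_lt 1 (L * r ^ 4)) as [H|H].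
  { assert (L * r ^ 4 <= L * r ^ 2) by (now apply Rmult_le_compat_l); lra. }
  destruct (Req_dec (1 - x ^ 2) 0) as [E|E].
  { rewrite E; now apply Rmult_le_pos. }
  set (X := 1 - x ^ 2) in *.
  assert (HX : 0 < X) by (unfold X in *; lra).
  assert (HXx : 0 < X / x ^ 2) by (apply Rdiv_lt_0_compat; lra).
  assert (I1 : X / x ^ 2 * (1 - L * r ^ 4) <= Q * (1 - L * r ^ 4))
    by (apply Rmult_le_compat_r; lra).
  replace (r ^ 2 * (X ^ 2 / x ^ 2)) with (X / x ^ 2 * (r ^ 2 * X)) in Q3 by (field; lra).
  assert (I2 : X / x ^ 2 * (r ^ 2 * X) <= X / x ^ 2 * (L * r ^ 4)) by lra.
  apply Rmult_le_reg_l in I2; [|assumption].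
  apply Rmult_le_reg_l with (r ^ 2); [apply pow_lt; lra|].
  replace (r ^ 2 * (L * r ^ 2)) with (L * r ^ 4) by ring; exact I2.
Qed.

Lemma sum_geom_sqr_bound (r : R) (J : nat) :
  0 < r < 1 -> sum_n (fun k => (r ^ S k) ^ 2) J <= / (1 - r ^ 2).
Proof.
  intros Hr; assert (Hr2 : 0 < r ^ 2 < 1) by (split; [apply pow_lt; lra|nra]).
  assert (H : forall J, sum_n (fun k => (r ^ S k) ^ 2) J * (1 - r ^ 2) <= 1 - (r ^ 2) ^ S J).
  { clear J; induction J as [|J IH].
    - rewrite sum_O; simpl; nra.
    - rewrite sum_n_R_S.
      replace ((r ^ S (S J)) ^ 2) with ((r ^ 2) ^ S (S J))
        by (rewrite <- !pow_mult; f_equal; lia).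
      rewrite <- (tech_pow_Rmult (r ^ 2) (S J)).
      assert (P : 0 <= (r ^ 2) ^ S J * (1 - r ^ 2) ^ 2)
        by (apply Rmult_le_pos; [apply pow_le; lra|apply pow2_ge_0]); nra. }
  apply Rmult_le_reg_r with (1 - r ^ 2); [lra|].
  rewrite Rinv_l by lra; specialize (H J).
  assert (P : 0 <= (r ^ 2) ^ S J) by (apply pow_le; lra); lra.
Qed.

Lemma sum_n_C_split (u : nat -> C) (n : nat) :
  sum_n u (S n) = (u O + sum_n (fun k => u (S k)) n)%C.
Proof.
  induction n as [|n IH].
  - rewrite sum_n_C_S, !sum_O; reflexivity.
  - rewrite sum_n_C_S, IH, (sum_n_C_S (fun k => u (S k))); Ceq; ring.
Qed.

Lemma Cmod_sum_n_le (u : nat -> C) (v : nat -> R) (n : nat) :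
  (forall k, Cmod (u k) <= v k) -> Cmod (sum_n u n) <= sum_n v n.
Proof.
  intros H; induction n as [|n IH].
  - rewrite !sum_O; apply H.
  - rewrite sum_n_C_S, sum_Sn; eapply Rle_trans; [apply Cmod_triangle|].
    apply Rplus_le_compat; [exact IH|apply H].
Qed.

Lemma scattering_coef_bound w De c r0 e dl (r Lam : R) (k : nat) :
  szego_data w De c r0 e dl -> 0 <= r0 -> r0 < r < 1 -> 0 <= Lam ->
  (forall t, Cmod (scattering w De (r * cis t)%C) <= Lam) ->
  Cmod (c (- Z.of_nat k)%Z) <= Lam * r ^ k.
Proof.
  intros HD Hr0 Hr HL HF; destruct (sd_scat HD r Hr) as [Hc Hf].
  apply (laurent_neg_coef_bound (polar (scattering w De) r)); auto; [lra|].
  intros t _; apply HF.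
Qed.

Lemma kappa_ratio_bound w De c r0 e dl
    (a : nat -> nat -> C) (kappa : nat -> R) (n : nat) (r Lam : R) :
  positive_analytic_weight w -> orthonormal_polynomials w a kappa ->
  0 <= r0 -> r0 < r < 1 -> szego_data w De c r0 e dl ->
  0 <= Lam -> (forall t, Cmod (scattering w De (r * cis t)%C) <= Lam) ->
  Rabs (kappa n ^ 2 - tau w ^ 2 / (2 * PI))
    <= tau w ^ 2 / (2 * PI) * (Lam ^ 2 * r ^ (2 * n) * r ^ 2).
Proof.
  intros Hw Ho Hr0 Hr HD HLam HF.
  assert (Htau : 0 < tau w) by apply exp_pos.
  assert (Hk := proj1 (proj1 Ho n)).
  assert (H2pi := two_PI_pos).
  assert (HS2 : 0 < sqrt (2 * PI)) by now apply sqrt_lt_R0.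
  assert (HS2sq : sqrt (2 * PI) * sqrt (2 * PI) = 2 * PI) by (apply sqrt_sqrt; lra).
  destruct (level_analysis w De c r0 e dl a kappa n r Lam Hw Ho Hr0 Hr HD HLam HF)
    as (al & q & Q & Hx1 & Ha0 & Hq0 & Hqa & HQ & HS & _).
  set (x := sqrt (2 * PI) * kappa n / tau w) in *.
  assert (Hx : 0 < x) by (unfold x; apply Rdiv_lt_0_compat; [now apply Rmult_lt_0_compat|assumption]).
  assert (HLpos : 0 <= Lam ^ 2 * r ^ (2 * n))
    by (apply Rmult_le_pos; [apply pow2_ge_0|apply pow_le; lra]).
  destruct (energy_bound al q x Q (Lam ^ 2 * r ^ (2 * n)) r) as [_ [_ H]]; auto; [lra|].
  assert (E : kappa n ^ 2 = tau w ^ 2 / (2 * PI) * x ^ 2).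
  { unfold x; set (S2 := sqrt (2 * PI)) in *; rewrite <- HS2sq; field; lra. }
  assert (Hc : 0 < tau w ^ 2 / (2 * PI)) by (apply Rdiv_lt_0_compat; [now apply pow_lt|assumption]).
  rewrite E.
  replace (tau w ^ 2 / (2 * PI) * x ^ 2 - tau w ^ 2 / (2 * PI))
    with (- (tau w ^ 2 / (2 * PI) * (1 - x ^ 2))) by ring.
  rewrite Rabs_Ropp, Rabs_pos_eq by (apply Rmult_le_pos; [lra|nra]).
  apply Rmult_le_compat_l; lra.
Qed.

(** The smallness hypothesis keeps x >= 1/2 and Q <= 2 L, where L = Lam^2 r^{2n}. The error has two
    sources: the terms k >= 1, which with 1/x <= 2 give 4 Lam^3 / (1 - r^2), and the replacement of
    c_{-n} / x^2 by c_{-n}, which gives 2 Lam^3. *)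
Lemma monic_constant_term w De c r0 e dl
    (a : nat -> nat -> C) (kappa : nat -> R) (n : nat) (r Lam : R) :
  positive_analytic_weight w -> orthonormal_polynomials w a kappa ->
  0 <= r0 -> r0 < r < 1 -> szego_data w De c r0 e dl ->
  0 <= Lam -> (forall t, Cmod (scattering w De (r * cis t)%C) <= Lam) ->
  Lam ^ 2 * r ^ (2 * n) <= / 4 ->
  Cmod (a n O / RtoC (kappa n) - c (- Z.of_nat n)%Z)%C
    <= (4 * Lam ^ 3 / (1 - r ^ 2) + 2 * Lam ^ 3) * r ^ (3 * n).
Proof.
  intros Hw Ho Hr0 Hr HD HLam HF Hsmall.
  assert (Htau : 0 < tau w) by apply exp_pos.
  assert (Hk := proj1 (proj1 Ho n)).
  assert (H2pi := two_PI_pos).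
  assert (HS2 : 0 < sqrt (2 * PI)) by now apply sqrt_lt_R0.
  destruct (level_analysis w De c r0 e dl a kappa n r Lam Hw Ho Hr0 Hr HD HLam HF)
    as (al & q & Q & Hx1 & Ha0 & Hq0 & Hqa & HQ & HS & HP).
  set (x := sqrt (2 * PI) * kappa n / tau w) in *.
  assert (Hx : 0 < x) by (unfold x; apply Rdiv_lt_0_compat; [now apply Rmult_lt_0_compat|assumption]).
  set (L := Lam ^ 2 * r ^ (2 * n)) in *.
  assert (HLpos : 0 <= L)
    by (apply Rmult_le_pos; [apply pow2_ge_0|apply pow_le; lra]).
  destruct (energy_bound al q x Q L r) as [E1 [E2 E3]]; auto; [lra|].
  assert (Hr2 : 0 < r ^ 2 < 1) by (split; [apply pow_lt; lra|nra]).
  assert (Hr4 : 0 <= r ^ 4 <= r ^ 2) by (replace (r ^ 4) with (r ^ 2 * r ^ 2) by ring; nra).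
  assert (HX : 1 - x ^ 2 <= L) by nra.
  assert (Hx2 : 3 / 4 <= x ^ 2 <= 1) by (split; [lra|nra]).
  assert (Hx12 : 1 / 2 <= x) by nra.
  assert (HX0 : 0 <= 1 - x ^ 2) by lra.
  assert (HXx : (1 - x ^ 2) / x ^ 2 <= 4 / 3 * L).
  { apply Rmult_le_reg_r with (x ^ 2); [lra|].
    replace ((1 - x ^ 2) / x ^ 2 * x ^ 2) with (1 - x ^ 2) by (field; lra); nra. }
  assert (HXx0 : 0 <= (1 - x ^ 2) / x ^ 2).
  { apply Rmult_le_pos; [lra|apply Rlt_le, Rinv_0_lt_compat; lra]. }
  (* The energy relation gives Q <= (4/3) L + Q/4, the last term by L r^4 <= 1/4. *)
  assert (HQ2 : Q <= 2 * L).
  { assert (P : 0 <= r ^ 2 * ((1 - x ^ 2) ^ 2 / x ^ 2)).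
    { apply Rmult_le_pos; [lra|]; apply Rmult_le_pos; [apply pow2_ge_0|].
      apply Rlt_le, Rinv_0_lt_compat; lra. }
    assert (Lr : L * r ^ 4 <= / 4) by nra.
    nra. }
  assert (Hal : forall k, Cmod (al (S k)) <= 2 * L * r ^ S k).
  { intros k; rewrite <- Hqa.
    assert (Hrk : 0 < r ^ S k) by (apply pow_lt; lra).
    assert (T : (Cmod (q (S k)) / r ^ S k) ^ 2 <= L * r ^ 2 * Q).
    { eapply Rle_trans; [|apply (HS (S k))]; rewrite sum_n_R_S.
      assert (P : 0 <= sum_n (fun k => (Cmod (q k) / r ^ k) ^ 2) k).
      { rewrite <- (sum_n_ext (fun k => Cmod (RtoC (Cmod (q k) / r ^ k)) ^ 2)).
        - clear; induction k as [|k IH]; [rewrite sum_O; apply pow2_ge_0|].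
          rewrite sum_Sn; apply Rplus_le_le_0_compat; [exact IH|apply pow2_ge_0].
        - intros j; now rewrite Cmod_R, pow2_abs. }
      set (S1 := sum_n _ k) in *; set (S3 := (Cmod (q (S k)) / r ^ S k) ^ 2) in *.
      change (S3 <= S1 + S3); lra. }
    assert (T2 : Cmod (q (S k)) / r ^ S k <= 2 * L).
    { apply Rsqr_incr_0_var; [|lra]; rewrite !Rsqr_pow2.
      eapply Rle_trans; [exact T|].
      assert (HLr : 0 <= L * r ^ 2 <= L) by (split; [apply Rmult_le_pos; lra|nra]).
      replace ((2 * L) ^ 2) with (2 * (L * (2 * L))) by ring.
      assert (L * r ^ 2 * Q <= L * (2 * L)) by (apply Rmult_le_compat; lra).
      assert (0 <= L * (2 * L)) by (apply Rmult_le_pos; lra); lra. }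
    replace (Cmod (q (S k))) with (Cmod (q (S k)) / r ^ S k * r ^ S k) by (field; lra).
    apply Rmult_le_compat_r; lra. }
  assert (Hc : forall k, Cmod (c (- Z.of_nat n - Z.of_nat k)%Z) <= Lam * (r ^ n * r ^ k)).
  { intros k; rewrite <- pow_add; replace (- Z.of_nat n - Z.of_nat k)%Z
      with (- Z.of_nat (n + k))%Z by lia.
    now apply (scattering_coef_bound w De c r0 e dl). }
  assert (Hrn : 0 < r ^ n) by (apply pow_lt; lra).
  set (c0 := c (- Z.of_nat n)%Z).
  assert (Hc0 : Cmod c0 <= Lam * r ^ n).
  { generalize (Hc O); simpl Z.of_nat; rewrite Z.sub_0_r, pow_O, Rmult_1_r; auto. }
  set (Phi := (a n O / RtoC (kappa n))%C) in *.
  assert (Hxc : RtoC x <> RtoC 0) by (apply RtoC_neq_0; lra).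
  (* The k = 0 term of the limit formula is c_{-n} / x; the remaining terms are bounded by a
     geometric series in r^2. *)
  assert (M1 : Cmod (RtoC x * Phi - / RtoC x * c0)%C <= 2 * L * Lam * r ^ n / (1 - r ^ 2)).
  { apply Clim_Cmod_le with (fun J => sum_n (fun k =>
      al (S k) * c (- Z.of_nat n - Z.of_nat (S k))%Z)%C J).
    - intros J.
      eapply Rle_trans; [apply (Cmod_sum_n_le _ (fun k => 2 * L * Lam * r ^ n * (r ^ S k) ^ 2))|].
      + intros k; rewrite Cmod_mult.
        replace (2 * L * Lam * r ^ n * (r ^ S k) ^ 2)
          with ((2 * L * r ^ S k) * (Lam * (r ^ n * r ^ S k))) by ring.
        apply Rmult_le_compat; auto using Cmod_ge_0.
      + replace (sum_n (fun k => 2 * L * Lam * r ^ n * (r ^ S k) ^ 2) J)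
          with (2 * L * Lam * r ^ n * sum_n (fun k => (r ^ S k) ^ 2) J)
          by (symmetry; apply (sum_n_mult_l (K := R_AbsRing))).
        apply Rmult_le_compat_l; [|apply sum_geom_sqr_bound; lra].
        apply Rmult_le_pos; [|lra]; apply Rmult_le_pos; [|lra]; lra.
    - unfold Clim; apply (is_lim_seq_incr_1 (fun n0 => Cmod (sum_n (fun k =>
        al k * c (- Z.of_nat n - Z.of_nat k)%Z)%C n0 - RtoC x * Phi)%C)) in HP.
      eapply is_lim_seq_ext; [|exact HP]; intros J; simpl; f_equal.
      rewrite sum_n_C_split, Ha0, RtoC_inv by lra; simpl Z.of_nat.
      rewrite Z.sub_0_r; fold c0; ring. }
  assert (Hix : / x <= 2).
  { rewrite <- (Rinv_inv 2); apply Rinv_le_contravar; lra. }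
  assert (Hix0 : 0 < / x) by (apply Rinv_0_lt_compat; lra).
  replace (Phi - c0)%C with (/ RtoC x * (RtoC x * Phi - / RtoC x * c0)
     + RtoC ((1 - x ^ 2) / x ^ 2) * c0)%C.
  - eapply Rle_trans; [apply Cmod_triangle|].
    rewrite !Cmod_mult, <- RtoC_inv, !Cmod_R, !Rabs_pos_eq by lra.
    assert (M2 : 0 <= 2 * L * Lam * r ^ n / (1 - r ^ 2)).
    { eapply Rle_trans; [apply Cmod_ge_0|exact M1]. }
    replace ((4 * Lam ^ 3 / (1 - r ^ 2) + 2 * Lam ^ 3) * r ^ (3 * n))
      with (2 * (2 * L * Lam * r ^ n / (1 - r ^ 2)) + 2 * L * (Lam * r ^ n)).
    + apply Rplus_le_compat.
      * rewrite <- RtoC_inv in M1 by lra.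
        apply Rmult_le_compat; try lra; apply Cmod_ge_0.
      * apply Rmult_le_compat; try lra; apply Cmod_ge_0.
    + unfold L; replace (3 * n)%nat with (2 * n + n)%nat by lia; rewrite pow_add; field; lra.
  - rewrite RtoC_div by (apply pow_nonzero; lra).
    rewrite RtoC_minus, !RtoC_pow; field; exact Hxc.
Qed.

(** Also covers an infinite infimum, which [real] sends to 0. *)
Lemma rho_nonneg (w : C -> R) : 0 <= rho w.
Proof.
  unfold rho; set (E := fun s => 0 < s < 1 /\ exists De, ext_szego_extension w s De).
  destruct (Glb_Rbar_correct E) as [_ H].
  assert (H0 : Rbar_le 0 (Glb_Rbar E)) by (apply H; intros s [Hs _]; simpl; lra).
  destruct (Glb_Rbar E); simpl in *; lra.
Qed.

Lemma poly_eval_0 (a : nat -> nat -> C) (n : nat) : poly_eval a n (RtoC 0) = a n O.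
Proof.
  unfold poly_eval; rewrite (sum_n_C_single _ n O); [simpl; ring|lia|].
  intros [|k] Hk; [lia|]; rewrite Cpow_S; ring.
Qed.

Lemma bigO_eventually (e : nat -> C) (b : nat -> R) (M : R) (N : nat) :
  (forall n, 0 < b n) -> (forall n, (N <= n)%nat -> Cmod (e n) <= M * b n) -> is_bigO e b.
Proof.
  intros Hb; induction N as [|N IH] in M |- *; intros H.
  - exists M; intros n; apply H; lia.
  - apply (IH (Rmax M (Cmod (e N) / b N))); intros n Hn.
    destruct (Nat.eq_dec n N) as [->|Hne].
    + apply Rle_trans with (Cmod (e N) / b N * b N).
      * right; field; apply Rgt_not_eq, Hb.
      * apply Rmult_le_compat_r; [apply Rlt_le, Hb|apply Rmax_r].
    + apply Rle_trans with (M * b n); [apply H; lia|].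
      apply Rmult_le_compat_r; [apply Rlt_le, Hb|apply Rmax_l].
Qed.

Lemma pow_double_small (q K eps : R) :
  0 <= q < 1 -> 0 <= K -> 0 < eps ->
  exists N, forall n, (N <= n)%nat -> K * q ^ (2 * n) <= eps.
Proof.
  intros Hq HK He.
  destruct (pow_lt_1_zero q ltac:(rewrite Rabs_pos_eq; lra) (eps / (K + 1))
    ltac:(apply Rdiv_lt_0_compat; lra)) as [N HN].
  exists N; intros n Hn; specialize (HN (2 * n)%nat ltac:(lia)).
  assert (P : 0 <= q ^ (2 * n)) by (apply pow_le; lra).
  rewrite Rabs_pos_eq in HN by assumption.
  apply Rmult_lt_compat_r with (r := K + 1) in HN; [|lra].
  replace (eps / (K + 1) * (K + 1)) with eps in HN by (field; lra); nra.
Qed.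

(** With dz = i z dt the integrand is i r^{n+1} e^{i(n+1)t} G, so the contour integral is a Fourier
    coefficient at index -n-1. *)
Lemma contour_int_laurent (G : C -> C) (g : Z -> C) (P : R -> Prop) (r : R) (n : nat) :
  0 < r -> P r -> laurent_on P G g ->
  (1 / (2 * PI * Ci) * contour_int r (fun t => t ^ n * G t))%C = g (- Z.of_nat n - 1)%Z.
Proof.
  intros Hr HP HG; destruct (HG r HP) as [Hc Hf].
  set (m := (- Z.of_nat n - 1)%Z).
  set (F := fun t => (Ci * RtoC (r ^ S n) * (polar G r t * ek (- m) t))%C).
  assert (HF : ccont F) by (unfold F; ccont_tac).
  assert (E : forall t, F t = ((r * cis t) ^ n * G (r * cis t) * (Ci * (r * cis t)))%C).
  { intros t; unfold F, polar.
    replace (- m)%Z with (Z.of_nat (S n)) by (unfold m; lia).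
    rewrite ek_nat, RtoC_pow.
    rewrite Cpow_mult_l, !Cpow_S; ring. }
  unfold contour_int.
  rewrite CInt_mean by (exact (ccont_ext F _ E HF)).
  rewrite <- (mean_ext F) by (intros t _; apply E).
  unfold F; rewrite mean_scal by ccont_tac; fold (fc (polar G r) m); rewrite Hf.
  replace (powerRZ r m) with (/ r ^ S n).
  2:{ rewrite pow_powerRZ, <- powerRZ_neg' by lra; f_equal; unfold m; lia. }
  assert (Hp : r ^ S n <> 0) by (apply pow_nonzero; lra).
  rewrite RtoC_inv, RtoC_mult by exact Hp.
  field; repeat split.
  - now apply RtoC_neq_0.
  - intros X; apply (f_equal Im) in X; unfold Im in X; simpl in X; lra.
  - apply RtoC_neq_0, PI_neq0.
Qed.

(** The bound on kappa_n appears in two forms. Replacing w by a positive multiple C w leaves F and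
    Lambda unchanged but divides kappa_n^2 and tau^2 by C. So for fixed n the bound without the
    factor tau^2 / (2 pi) cannot be uniform in w; it is stated for n beyond a threshold depending on
    w, and with the factor for every n. *)
Theorem corollary2
  (w : C -> R) (hw : positive_analytic_weight w)
  (a : nat -> nat -> C) (kappa : nat -> R)
  (hphi : orthonormal_polynomials w a kappa)
  (De : C -> C) (hDe : ext_szego_extension w (rho w) De)
  (c : Z -> C)
  (hc : laurent_expansion (annulus (rho w) 1) (scattering w De) c)
  (r : R) (hr : rho w < r < 1)
  (Lambda : R) (hLambda : is_max_mod_on_circle r (scattering w De) Lambda) :
  is_bigO (fun n => Cconj (verblunsky a kappa n)
             - (- (1 / (2 * PI * Ci)
                   * contour_int r (fun t => t ^ n * scattering w De t))))%C
          (fun n => r ^ (3 * n))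
  /\
  is_bigO (fun n => Cconj (verblunsky a kappa n)
             - (- c (- Z.of_nat n - 1)%Z))%C
          (fun n => r ^ (3 * n))
  /\
  (exists M : R, forall n : nat,
     Cmod (verblunsky a kappa n) <= Lambda * r ^ (n + 1) + M * r ^ (3 * n))
  /\
  (exists N : nat, forall n : nat, (N <= n)%nat ->
     Rabs (kappa n ^ 2 - tau w ^ 2 / (2 * PI))
       <= Lambda ^ 2 * r ^ (2 * n) / (1 - r ^ 2))
  /\
  (forall n : nat,
     Rabs (kappa n ^ 2 - tau w ^ 2 / (2 * PI))
       <= tau w ^ 2 / (2 * PI) * (Lambda ^ 2 * r ^ (2 * n) / (1 - r ^ 2))).
Proof.
  assert (Hrho := rho_nonneg w); set (r0 := rho w) in *.
  destruct (szego_data_exists w De c r0 hw ltac:(lra) hDe hc) as [e [dl HD]].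
  destruct hLambda as [[z0 [_ Hz0]] HLmax].
  assert (HL : 0 <= Lambda) by (rewrite <- Hz0; apply Cmod_ge_0).
  assert (HF : forall t, Cmod (scattering w De (r * cis t)%C) <= Lambda).
  { intros t; apply HLmax; unfold circ; apply Cmod_scis; lra. }
  assert (Htau : 0 < tau w ^ 2 / (2 * PI)).
  { apply Rdiv_lt_0_compat; [apply pow_lt, exp_pos|apply two_PI_pos]. }
  assert (Hr2 : 0 < 1 - r ^ 2) by nra.
  (* The energy argument yields the factor r^2, which is below the stated 1 / (1 - r^2). *)
  assert (Hr1 : r ^ 2 <= / (1 - r ^ 2)).
  { apply Rmult_le_reg_r with (1 - r ^ 2); [assumption|]; rewrite Rinv_l by lra; nra. }
  assert (B2 : is_bigO (fun n => Cconj (verblunsky a kappa n)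
             - (- c (- Z.of_nat n - 1)%Z))%C (fun n => r ^ (3 * n))).
  (* [N] ensures the smallness hypothesis; the finitely many earlier n are absorbed in the constant.
     The estimate is used at n + 1, since alpha_n involves Phi_{n+1}(0). *)
  { destruct (pow_double_small r (Lambda ^ 2) (/ 4)) as [N HN]; [lra|apply pow2_ge_0|lra|].
    set (M := 4 * Lambda ^ 3 / (1 - r ^ 2) + 2 * Lambda ^ 3).
    assert (HM : 0 <= M).
    { assert (0 <= Lambda ^ 3) by now apply pow_le.
      apply Rplus_le_le_0_compat; [apply Rmult_le_pos|]; try lra.
      apply Rlt_le, Rinv_0_lt_compat; lra. }
    apply (bigO_eventually _ _ M N); [intros n; apply pow_lt; lra|].
    intros n Hn; unfold verblunsky, monic_poly.
    rewrite Copp_conj, Cconj_conj.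
    rewrite poly_eval_0.
    replace (- Z.of_nat n - 1)%Z with (- Z.of_nat (S n))%Z by lia.
    replace (- (a (S n) O / kappa (S n)) - - c (- Z.of_nat (S n))%Z)%C
      with (- (a (S n) O / kappa (S n) - c (- Z.of_nat (S n))%Z))%C by ring.
    rewrite Cmod_opp.
    eapply Rle_trans; [apply (monic_constant_term w De c r0 e dl a kappa (S n) r Lambda);
      auto; apply HN; lia|].
    fold M; apply Rmult_le_compat_l; [assumption|].
    replace (3 * S n)%nat with (3 + 3 * n)%nat by lia; rewrite pow_add.
    assert (P : 0 < r ^ (3 * n)) by (apply pow_lt; lra).
    assert (P3 : r ^ 3 <= 1) by (rewrite <- (pow1 3); apply pow_incr; lra); nra. }
  assert (K5 : forall n : nat, Rabs (kappa n ^ 2 - tau w ^ 2 / (2 * PI))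
       <= tau w ^ 2 / (2 * PI) * (Lambda ^ 2 * r ^ (2 * n) / (1 - r ^ 2))).
  { intros n; eapply Rle_trans;
      [apply (kappa_ratio_bound w De c r0 e dl a kappa n r Lambda); assumption|].
    apply Rmult_le_compat_l; [lra|]; apply Rmult_le_compat_l; [|assumption].
    apply Rmult_le_pos; [apply pow2_ge_0|apply pow_le; lra]. }
  split; [|split; [exact B2|split; [|split; [|exact K5]]]].
  - destruct B2 as [M HM]; exists M; intros n.
    rewrite (contour_int_laurent _ c (fun s => r0 < s < 1) r n);
      [apply HM|lra|assumption|exact (sd_scat HD)].
  - destruct B2 as [M HM]; exists M; intros n.
    assert (X := scattering_coef_bound w De c r0 e dl r Lambda (n + 1) HD Hrho hr HL HF).
    replace (- Z.of_nat (n + 1))%Z with (- Z.of_nat n - 1)%Z in X by lia.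
    set (k := c (- Z.of_nat n - 1)%Z) in *.
    rewrite <- Cmod_conj; specialize (HM n); fold k in HM.
    replace (Cconj (verblunsky a kappa n))
      with (- k + (Cconj (verblunsky a kappa n) - - k))%C by ring.
    eapply Rle_trans; [apply Cmod_triangle|]; rewrite Cmod_opp; lra.
  (* The threshold below is chosen from Lambda^2 > 0; when Lambda = 0 the bound with the factor
     already gives the claim. *)
  - destruct (Req_dec Lambda 0) as [E|E].
    { exists O; intros n _; eapply Rle_trans; [apply K5|]; rewrite E, pow_i by lia.
      unfold Rdiv; rewrite !Rmult_0_l, Rmult_0_r; lra. }
    (* The factor [tau^2 / (2 pi)] may exceed 1; it is absorbed by the gain [(s / r)^(2 n)]. *)
    set (s := (r0 + r) / 2); assert (Hs : r0 < s < r) by (unfold s; lra).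
    destruct (sd_scat HD s ltac:(lra)) as [Hcs _].
    destruct (ccont_bounded _ Hcs) as [Ls [HLs Hbs]].
    assert (HFs : forall t, Cmod (scattering w De (s * cis t)%C) <= Ls).
    { apply periodic_reduce; [exact Hbs|]; intros t; now rewrite cis_periodic. }
    assert (HLam2 : 0 < Lambda ^ 2) by (apply pow_lt; lra).
    assert (Hsr : 0 <= s / r < 1).
    { split; [apply Rlt_le, Rdiv_lt_0_compat; lra|].
      apply Rmult_lt_reg_r with r; [lra|]; replace (s / r * r) with s by (field; lra); lra. }
    destruct (pow_double_small (s / r) (tau w ^ 2 / (2 * PI) * Ls ^ 2)
      (Lambda ^ 2 / (1 - r ^ 2)) Hsr) as [N HN].
    { apply Rmult_le_pos; [lra|apply pow2_ge_0]. }
    { now apply Rdiv_lt_0_compat. }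
    exists N; intros n Hn; specialize (HN n Hn).
    eapply Rle_trans; [apply (kappa_ratio_bound w De c r0 e dl a kappa n s Ls); auto; lra|].
    assert (Hrn : 0 < r ^ (2 * n)) by (apply pow_lt; lra).
    assert (Hsn : 0 < s ^ (2 * n)) by (apply pow_lt; lra).
    apply Rmult_le_compat_r with (r := r ^ (2 * n)) in HN; [|lra].
    replace (Lambda ^ 2 / (1 - r ^ 2) * r ^ (2 * n))
      with (Lambda ^ 2 * r ^ (2 * n) / (1 - r ^ 2)) in HN by (field; lra).
    eapply Rle_trans; [|exact HN].
    replace (tau w ^ 2 / (2 * PI) * Ls ^ 2 * (s / r) ^ (2 * n) * r ^ (2 * n))
      with (tau w ^ 2 / (2 * PI) * (Ls ^ 2 * s ^ (2 * n) * 1))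
      by (unfold Rdiv; rewrite (Rpow_mult_distr s (/ r)), pow_inv; field; split;
          [lra|apply PI_neq0]).
    apply Rmult_le_compat_l; [lra|]; apply Rmult_le_compat_l; [|nra].
    apply Rmult_le_pos; [apply pow2_ge_0|lra].
Qed.
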